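(* Let $a<b$ and let $Y:[a,b]\to S_{-1}$ be a function which is continuous when $S_{-1}$ is endowed with its strong topology (as the dual of $S_1$). Then there exists $p\in\mathbb N$ such that the function $t\mapsto Y(t)\lozenge W_m(t)$, $t\in[a,b]$, is $\mathcal H_p'$-valued, and $$\int_a^b Y(t)\lozenge W_m(t)\,dt=\lim_{|\Delta|\to 0}\sum_{k=0}^{n-1}Y(t_k)\lozenge\big(X_m(t_{k+1})-X_m(t_k)\big),$$ where the limit is in the norm of $\mathcal H_p'$, $\Delta: a=t_0<t_1<\cdots<t_n=b$ is a partition of $[a,b]$, and $|\Delta|=\max_{0\le k\le n-1}(t_{k+1}-t_k)$.
   Context: **The function $m$ and the operator $T_m$.** $m:\mathbb R\to[0,\infty)$ is a measurable even function such that, for some $b_0<2$, $N\in\mathbb N_0=\{0,1,2,\dots\}$ and $0<K<\infty$, $m(u)\le K|u|^{-b_0}$ for $|u|\le1$ and $m(u)\le K|u|^{2N}$ for $|u|>1$; moreover $\int_{\mathbb R}\frac{m(u)}{1+u^2}du<\infty$. With $\widehat f(u)=\int_{\mathbb R}e^{-iux}f(x)dx$, the operator $T_m$ is defined by $\widehat{T_mf}(u)=\sqrt{m(u)}\,\widehat f(u)$ on those $f\in\mathbf L_2(\mathbb R)$ with $\sqrt m\,\widehat f\in\mathbf L_2(\mathbb R)$. For $f$ in the Schwartz space, $T_mf$ denotes the continuous representative $T_mf(t)=\frac1{2\pi}\int_{\mathbb R}e^{iut}\sqrt{m(u)}\widehat f(u)du$. **White noise space.** $\Omega=\mathscr S(\mathbb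 R)'$ is the dual of the space $\mathscr S(\mathbb R)$ of real-valued Schwartz functions, $\mathcal F$ its Borel $\sigma$-algebra, and $P$ the probability measure with $\int_\Omega e^{i\langle\omega,s\rangle}dP(\omega)=e^{-\|s\|_{\mathbf L_2(\mathbb R)}^2/2}$ for all $s\in\mathscr S(\mathbb R)$. $\mathcal W=\mathbf L_2(\Omega,\mathcal F,P)$ (real-valued). $Q_s(\omega)=\langle\omega,s\rangle$ extends to an isometry $s\mapsto Q_s$ from real $\mathbf L_2(\mathbb R)$ into $\mathcal W$. Let $h_n$ be the (probabilists') Hermite polynomials and $\widetilde h_k(x)=\pi^{-1/4}((k-1)!)^{-1/2}e^{-x^2/2}h_{k-1}(\sqrt2x)$, $k\ge1$, the Hermite functions, an orthonormal basis of $\mathbf L_2(\mathbb R)$. Let $\ell$ be the set of sequences $\alpha=(\alpha_1,\alpha_2,\dots)$ in $\mathbb N_0$ with finitely many nonzero entries, $\alpha!=\prod_k\alpha_k!$, $(2\mathbb N)^{\pm k\alpha}=\prod_{j\ge1}(2j)^{\pm k\alpha_j}$, and $H_\alpha(\omega)=\prod_{k\ge1}h_{\alpha_k}(Q_{\widetilde h_k}(\omega))$. The $H_\alpha$ form an orthogonal basis of $\mathcal W$, with $\|\sum f_\alpha H_\alpha\|_{\mathcal W}^2=\sum\alpha!f_\alpha^2$. $\epsilon^{(k)}\in\ell$ has $k$-th entry $1$ and all other entries $0$. **Kondratiev spaces.** For $k\in\mathbb N$, $\mathcal H_k$ is the Hilbert space of $F=\sum_\alpha f_\alpha H_\alpha$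 with $\|F\|_k^2=\sum_\alpha(\alpha!)^2f_\alpha^2(2\mathbb N)^{k\alpha}<\infty$; $\mathcal H_k'$ is the Hilbert space of families $G=(g_\alpha)_{\alpha\in\ell}$ with $\|G\|_{\mathcal H_k'}^2=\sum_\alpha g_\alpha^2(2\mathbb N)^{-k\alpha}<\infty$, also written $G=\sum_\alpha g_\alpha H_\alpha$; $\mathcal W\subset\mathcal H_k'$ by taking coefficients. $S_1=\bigcap_{k\ge1}\mathcal H_k$ (with the topology defined by the norms $\|\cdot\|_k$) and $S_{-1}=\bigcup_{k\ge1}\mathcal H_k'$, which is the dual of $S_1$ via $\langle G,F\rangle=\sum_\alpha\alpha!f_\alpha g_\alpha$. The strong topology of $S_{-1}$ is that of uniform convergence on bounded subsets of $S_1$. The Wick product on $S_{-1}$ is determined by $H_\alpha\lozenge H_\beta=H_{\alpha+\beta}$, i.e. $(\sum g_\alpha H_\alpha)\lozenge(\sum f_\beta H_\beta)=\sum_\gamma\big(\sum_{\alpha+\beta=\gamma}g_\alpha f_\beta\big)H_\gamma$; it maps $S_{-1}\times S_{-1}$ into $S_{-1}$. **The process and its derivative.** $X_m(t)=Q_{T_m(1_{[0,t]})}=\sum_{k\ge1}\Big(\int_0^tT_m\widetilde h_k(u)du\Big)H_{\epsilon^{(k)}}\in\mathcal W$, $t\in\mathbb R$ (for $t<0$, $1_{[0,t]}$ means $-1_{[t,0]}$), and $W_m(t)=\sum_{k\ge1}(T_m\widetilde h_k)(t)H_{\epsilon^{(k)}}\in S_{-1}$. The integral $\int_a^bY(t)\lozenge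 W_m(t)dt$ is the Riemann integral of a continuous function with values in the Hilbert space $\mathcal H_p'$. *)

(* Defs.v *)
From HB Require Import structures.
From mathcomp Require Import all_boot all_order all_algebra finmap complex.
From mathcomp Require Import all_classical all_reals all_analysis.
From mathcomp Require Import ring lra.
Set Implicit Arguments.
Unset Strict Implicit.
Unset Printing Implicit Defensive.
Import Order.TTheory GRing.Theory Num.Theory.
Import numFieldNormedType.Exports.
Local Open Scope classical_set_scope.
Local Open Scope ring_scope.

Section schwartz.
Context {R : realType}.

Definition smooth (f : R -> R) := forall n x, derivable (derive1n n f) x 1.

Definition rapidly_decreasing (f : R -> R) :=
  forall j k, exists C : R, forall x, `|x ^+ j * derive1n k f x| <= C.

Definition schwartz_fun : {pred R -> R} :=
  mem [set f | smooth f /\ rapidly_decreasing f].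

Lemma derive1n_lin (a : R) (f g : R -> R) n : smooth f -> smooth g ->
  derive1n n (a *: f + g) = a *: derive1n n f + derive1n n g.
Proof.
move=> sf sg; elim: n => // n IH.
rewrite /derive1n !iterS -!/(derive1n _ _) IH; apply/funext => x.
rewrite derive1E deriveD ?deriveZ -?derive1E //.
exact: derivableZ.
Qed.

Lemma schwartz_submod : submod_closed schwartz_fun.
Proof.
have z : forall n, derive1n n (0 : R -> R) = 0.
  elim => // n IH; rewrite /derive1n iterS -/(derive1n _ _) IH.
  by apply/funext => x; rewrite derive1E derive_cst.
split.
  rewrite inE; split => [n x|j k].
    by rewrite z; exact: derivable_cst.
  by exists 0 => x; rewrite z mulr0 normr0.
move=> a f g; rewrite !inE => -[sf rf] [sg rg]; split => [n x|j k].
  by rewrite derive1n_lin//; apply: derivableD => //; exact: derivableZ.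
have [C HC] := rf j k; have [D HD] := rg j k.
exists (`|a| * C + D) => x; rewrite derive1n_lin//.
rewrite mulrDr (le_trans (ler_normD _ _))// lerD//.
by rewrite mulrCA normrM ler_wpM2l.
Qed.

HB.instance Definition _ :=
  GRing.isSubmodClosed.Build R (R -> R) schwartz_fun schwartz_submod.

Record schwartz := Schwartz {
  schwartz_val :> R -> R ; schwartz_valP : schwartz_val \in schwartz_fun }.

HB.instance Definition _ := [isSub for schwartz_val].
HB.instance Definition _ := [Choice of schwartz by <:].
HB.instance Definition _ := [SubChoice_isSubLmodule of schwartz by <:].

End schwartz.
Arguments schwartz R : clear implicits.

Section hermite.
Context {R : realType}.

(* probabilists' Hermite polynomials, by He_(n+1) = X He_n - He_n' *)
Fixpoint hermite (n : nat) : {poly R} :=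
  if n is n'.+1 then 'X * hermite n' - (hermite n')^`() else 1.

(* Indexed from 0: this is the (k+1)-st Hermite function. *)
Definition hermite_fun (k : nat) (x : R) : R :=
  pi `^ (- 4^-1) * (Num.sqrt (k`!%:R))^-1
  * expR (- (x ^+ 2) / 2) * (hermite k).[Num.sqrt 2 * x].

Definition gauss_poly (p : {poly R}) (x : R) := p.[x] * expR (- (x ^+ 2) / 2).

Lemma is_derive_gauss_poly (p : {poly R}) (x : R) :
  is_derive x (1 : R) (gauss_poly p) (gauss_poly (p^`() - 'X * p) x).
Proof.
pose q : {poly R} := - (2^-1 *: 'X^2).
have qE y : - (y ^+ 2) / 2 = q.[y] by rewrite /q hornerN hornerZ hornerXn; field.
have -> : gauss_poly p = (horner p) * (expR \o horner q).
  by apply/funext => y; rewrite /gauss_poly qE.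
have dp : is_derive x (1 : R) (horner p) (p^`()).[x] by exact: is_derive_poly.
have dq : is_derive x (1 : R) (horner q) (q^`()).[x] by exact: is_derive_poly.
have de : is_derive x (1 : R) (expR \o horner q) (expR q.[x] * (q^`()).[x]).
  exact: is_derive1_comp.
have qd : q^`() = - 'X.
  rewrite /q derivN derivZ derivXn expr1; congr (- _).
  by apply/polyP => i; rewrite coefZ coefMn; field.
rewrite qd in de; clearbody q; apply: is_derive_eq.
rewrite /gauss_poly qE !(hornerD, hornerN, hornerM, hornerX) /GRing.scale/=.
by ring.
Qed.

Lemma derive1n_gauss_poly (p : {poly R}) n : exists q,
  derive1n n (gauss_poly p) = gauss_poly q.
Proof.
elim: n => [|n [q IH]]; first by exists p.
exists (q^`() - 'X * q); rewrite /derive1n iterS -/(derive1n _ _) IH.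
apply/funext => x; rewrite derive1E.
by apply: derive_val; exact: is_derive_gauss_poly.
Qed.

Lemma gauss_monom_bounded n :
  exists C : R, forall x, `|x ^+ n * expR (- (x ^+ 2) / 2)| <= C.
Proof.
exists (1 + 2 ^+ n.+1 * n.+1`!%:R) => x.
rewrite normrM (ger0_norm (expR_ge0 _)).
have [x1|x1] := leP `|x| 1.
  have e1 : expR (- x ^+ 2 / 2) <= 1.
    by rewrite -[leRHS]expR0 ler_expR mulNr oppr_le0 divr_ge0 // sqr_ge0.
  rewrite (@le_trans _ _ 1) ?mulr_ile1 ?expR_ge0//.
    by rewrite normrX exprn_ile1.
  by rewrite lerDl mulr_ge0// exprn_ge0.
have h : 1 + (x ^+ 2 / 2) ^+ n.+1 / n.+1`!%:R <= expR (x ^+ 2 / 2).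
  by apply: expR_ge1Dxn; rewrite divr_ge0// sqr_ge0.
rewrite mulNr expRN ler_pdivrMr ?expR_gt0//.
have f0 : (0:R) < n.+1`!%:R by rewrite ltr0n fact_gt0.
have two0 : (0:R) < 2 ^+ n.+1 by rewrite exprn_gt0.
have E : 2 ^+ n.+1 * n.+1`!%:R * ((x ^+ 2 / 2) ^+ n.+1 / n.+1`!%:R)
   = (x ^+ 2) ^+ n.+1.
  by rewrite expr_div_n; field; rewrite !gt_eqF.
apply: (@le_trans _ _ ((x ^+ 2) ^+ n.+1)).
  rewrite normrX -real_normK ?num_real// -exprM.
  by apply: ler_weXn2l; [exact: ltW|rewrite (leq_trans (leqnSn n))// leq_pmull].
rewrite -E mulrDl mul1r.
have : 2 ^+ n.+1 * n.+1`!%:R * ((x ^+ 2 / 2) ^+ n.+1 / n.+1`!%:R) <=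
  2 ^+ n.+1 * n.+1`!%:R * expR (x ^+ 2 / 2).
  by rewrite ler_pM2l ?mulr_gt0//; lra.
have := expR_ge0 (x^+2/2); lra.
Qed.

Lemma gauss_poly_bounded (p : {poly R}) :
  exists C : R, forall x, `|gauss_poly p x| <= C.
Proof.
have [C HC] := choice gauss_monom_bounded.
exists (\sum_(i < size p) `|p`_i| * C i) => x.
rewrite /gauss_poly horner_coef mulr_suml (le_trans (ler_norm_sum _ _ _))//.
by apply: ler_sum => i _; rewrite -mulrA normrM ler_wpM2l.
Qed.

Lemma gauss_poly_schwartz (p : {poly R}) : gauss_poly p \in schwartz_fun.
Proof.
rewrite inE; split => [n x|j k].
  have [q ->] := derive1n_gauss_poly p n.
  exact: (@ex_derive _ _ _ _ _ _ _ (is_derive_gauss_poly q x)).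
have [q ->] := derive1n_gauss_poly p k.
have [C HC] := gauss_poly_bounded ('X^j * q).
by exists C => x; have := HC x; rewrite /gauss_poly hornerM hornerXn mulrA.
Qed.

Lemma hermite_fun_schwartz k : hermite_fun k \in schwartz_fun.
Proof.
have -> : hermite_fun k = (pi `^ (- 4^-1) * (Num.sqrt (k`!%:R))^-1) *:
    gauss_poly (hermite k \Po (Num.sqrt 2 *: 'X)).
  apply/funext => x; rewrite fctE /hermite_fun /gauss_poly horner_comp.
  by rewrite hornerZ hornerX /GRing.scale/= -!mulrA [expR _ * _]mulrC.
by rewrite rpredZ// gauss_poly_schwartz.
Qed.

Definition hermite_schwartz (k : nat) : schwartz R :=
  Schwartz (hermite_fun_schwartz k).

End hermite.
Arguments hermite R : clear implicits.
Arguments hermite_fun R : clear implicits.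
Arguments hermite_schwartz R : clear implicits.

Section tempered.
Context {R : realType}.

(* Continuity at 0 for the Frechet topology of the Schwartz space given by the
   seminorms sup_x |x^j f^(k)(x)|; for a linear functional this is continuity. *)
Definition schwartz_continuous (w : schwartz R -> R) :=
  forall e : R, 0 < e -> exists n, exists2 d : R, 0 < d &
    forall s : schwartz R,
      (forall j k x, (j <= n)%N -> (k <= n)%N ->
         `|x ^+ j * derive1n k s x| <= d) ->
      `|w s| < e.

Record tempered := Tempered {
  tempered_val :> {linear schwartz R -> R^o} ;
  temperedP : schwartz_continuous tempered_val }.

Lemma tempered0_subproof :
  schwartz_continuous (\0 : {linear schwartz R -> R^o}).
Proof. by move=> e e0; exists 0, 1 => //= s _; rewrite normr0. Qed.

HB.instance Definition _ := gen_eqMixin tempered.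
HB.instance Definition _ := gen_choiceMixin tempered.
HB.instance Definition _ := isPointed.Build tempered
  (Tempered tempered0_subproof).

Definition tempered_eval (w : tempered) : {ptws schwartz R -> R} := w.

(* the weak-* topology; its Borel sigma-algebra is also that of the strong
   topology *)
HB.instance Definition _ :=
  Topological.copy tempered (initial_topology tempered_eval).

End tempered.
Arguments tempered R : clear implicits.

Definition white_noise_space (R : realType) :=
  g_sigma_algebraType (@open (tempered R)).

Section fourier.
Context {R : realType}.
Local Open Scope complex_scope.
Local Notation mu := (@lebesgue_measure R).

Definition expi (x : R) : R[i] := cos x +i* sin x.

Definition Cintegral d (T : measurableType d) (P : {measure set T -> \bar R})
    (F : T -> R[i]) : R[i] :=
  (\int[P]_x complex.Re (F x)) +i* (\int[P]_x complex.Im (F x)).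

Definition fourier (f : R -> R) (u : R) : R[i] :=
  Cintegral mu (fun x => expi (- (u * x)) * (f x)%:C).

Definition in_CL2 (F : R -> R[i]) :=
  (fun u => complex.Re (F u)) \in Lfun mu 2%:E /\
  (fun u => complex.Im (F u)) \in Lfun mu 2%:E.

(* F is the Fourier transform of f in L^2, as the limit in the mean of the
   Fourier integrals over [-n, n] (Plancherel). *)
Definition is_fourierL2 (f : R -> R) (F : R -> R[i]) :=
  [/\ f \in Lfun mu 2%:E, in_CL2 F &
    (Lnorm mu 2%:E (fun u => (Normc.normc
       (fourier (f \* \1_`[- n%:R, n%:R]) u - F u))%:E) @[n --> \oo] --> 0)%E].

(* (|u| ^ -b0) is +oo at u = 0 when b0 > 0, and 0 `^ x is 0 by convention in the
   library; hence 0 is excluded from the first bound. *)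
Definition admissible (m : R -> R) :=
  [/\ measurable_fun setT m, (forall u, m (- u) = m u), (forall u, 0 <= m u),
   (exists (b0 : R) (N : nat) (K : R),
      [/\ b0 < 2, 0 < K,
        (forall u, 0 < `|u| <= 1 -> m u <= K * `|u| `^ (- b0)) &
        (forall u, 1 < `|u| -> m u <= K * `|u| ^+ (2 * N))]) &
   (\int[mu]_u (m u / (1 + u ^+ 2))%:E < +oo)%E].

(* g = T_m f *)
Definition is_Tm (m : R -> R) (f g : R -> R) :=
  exists2 F, is_fourierL2 f F &
    is_fourierL2 g (fun u => (Num.sqrt (m u))%:C * F u).

(* The integral is real because m is even and f is real. *)
Definition Tm_schwartz (m : R -> R) (f : schwartz R) (t : R) : R :=
  (2 * pi)^-1 * complex.Re (Cintegral mu
     (fun u => expi (u * t) * (Num.sqrt (m u))%:C * fourier f u)).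

(* 1_[0,t], meaning - 1_[t,0] for t < 0 *)
Definition signed_indic (t : R) : R -> R :=
  if 0 <= t then \1_`[0, t] else \- \1_`[t, 0].

End fourier.

Section white_noise.
Context {R : realType}.
Local Open Scope complex_scope.
Local Notation mu := (@lebesgue_measure R).
Local Notation Omega := (white_noise_space R).
Implicit Type P : probability Omega R.

Definition is_white_noise P := forall s : schwartz R,
  Cintegral P (fun w => expi (w s))
  = (expR (- (\int[mu]_x (s x ^+ 2)) / 2))%:C.

(* X is (a version of) Q_f, Q being the continuous extension of s |-> <., s> *)
Definition is_Q P (f : R -> R) (X : Omega -> R) :=
  [/\ f \in Lfun mu 2%:E, X \in Lfun P 2%:E &
   exists s : nat -> schwartz R,
     (Lnorm mu 2%:E (fun x => (s n x - f x)%:E) @[n --> \oo] --> 0)%E /\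
     (Lnorm P 2%:E (fun w => (w (s n) - X w)%:E) @[n --> \oo] --> 0)%E].

(* X t is (a version of) Q_(T_m 1_[0,t]) *)
Definition is_Xm P (m : R -> R) (X : R -> Omega -> R) :=
  forall t, exists2 g, is_Tm m (signed_indic t) g & is_Q P g (X t).

End white_noise.

(* Multi-indices; positions are counted from 0, so that position k stands for
   the (k+1)-st entry. *)
Definition multi_index := {fsfun nat -> nat with 0%N}.

Definition mfact (alpha : multi_index) : nat :=
  (\prod_(k <- finsupp alpha) (alpha k)`!)%N.

(* (2N)^alpha *)
Definition m2N (alpha : multi_index) : nat :=
  (\prod_(k <- finsupp alpha) (2 * k.+1) ^ alpha k)%N.

Definition meps (k : nat) : multi_index := [fsfun j in [fset k]%fset => 1%N].

Section kondratiev.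
Context {R : realType}.
Implicit Types (F G : multi_index -> R) (k : nat).

Definition Halpha (alpha : multi_index) (w : white_noise_space R) : R :=
  \prod_(k <- finsupp alpha) (hermite R (alpha k)).[w (hermite_schwartz R k)].

(* Coefficients in the orthogonal basis Halpha; the squared norm of Halpha is
   alpha!. *)
Definition chaos_coef (P : probability (white_noise_space R) R)
    (X : white_noise_space R -> R) : multi_index -> R :=
  fun alpha => (\int[P]_w (X w * Halpha alpha w)) / (mfact alpha)%:R.

Definition Hnorm k F : \bar R :=
  sqrte (\esum_(alpha in [set: multi_index])
    ((mfact alpha)%:R ^+ 2 * F alpha ^+ 2 * (m2N alpha)%:R ^+ k)%:E).

Definition H'norm k G : \bar R :=
  sqrte (\esum_(alpha in [set: multi_index])
    (G alpha ^+ 2 * (m2N alpha)%:R ^- k)%:E).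

Definition in_H k F := (Hnorm k F < +oo)%E.

Definition in_H' k G := (H'norm k G < +oo)%E.

Record S1 := MkS1 {
  S1_val :> multi_index -> R ;
  S1P : forall k, (0 < k)%N -> in_H k S1_val }.

Record Sm1 := MkSm1 {
  Sm1_val :> multi_index -> R ;
  Sm1P : exists2 k, (0 < k)%N & in_H' k Sm1_val }.

HB.instance Definition _ := gen_eqMixin S1.
HB.instance Definition _ := gen_choiceMixin S1.
HB.instance Definition _ := gen_eqMixin Sm1.
HB.instance Definition _ := gen_choiceMixin Sm1.

Definition S1_bounded (B : set S1) :=
  forall k, (0 < k)%N -> exists M : R, forall F : S1, B F -> (Hnorm k F <= M%:E)%E.

(* sum of an absolutely summable real family *)
Definition msum (f : multi_index -> R) : R :=
  fine (\esum_(alpha in [set: multi_index]) (f^\+ alpha)%:E)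
  - fine (\esum_(alpha in [set: multi_index]) (f^\- alpha)%:E).

Definition dual_pairing (G : Sm1) (F : S1) : R :=
  msum (fun alpha => (mfact alpha)%:R * F alpha * G alpha).

Definition strong_dual_embedding (G : Sm1) : {family S1_bounded, S1 -> R} :=
  dual_pairing G.

(* the strong topology: uniform convergence on the bounded subsets of S1 *)
HB.instance Definition _ :=
  Topological.copy Sm1 (initial_topology strong_dual_embedding).

Definition wick G F : multi_index -> R := fun gamma =>
  \sum_(p \in [set p : multi_index * multi_index |
                forall k, (p.1 k + p.2 k)%N = gamma k]) (G p.1 * F p.2).

Definition Wm (m : R -> R) (t : R) : multi_index -> R := fun alpha =>
  \sum_(k \in [set k | meps k = alpha]) Tm_schwartz m (hermite_schwartz R k) t.

End kondratiev.
Arguments H'norm {R} k%_N G%_R.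
Arguments S1 R : clear implicits.
Arguments Sm1 R : clear implicits.

(* Partitions a = t_0 < ... < t_n = b are given by the sequence s of
    t_1, ..., t_n, as in itv_partition. *)
Section riemann.
Context {R : realType}.
Implicit Types (a b : R) (s : seq R) (p : nat).

Definition pt a s (k : nat) : R := nth 0 (a :: s) k.

Definition mesh a s : R :=
  \big[Num.max/0]_(k < size s) (pt a s k.+1 - pt a s k).

Definition H'_continuous p a b (phi : R -> multi_index -> R) :=
  forall t, t \in `[a, b] -> forall e : R, 0 < e -> exists2 d : R, 0 < d &
    forall u, u \in `[a, b] -> `|u - t| < d ->
      (H'norm p (phi u - phi t) < e%:E)%E.

(* I is the Riemann integral of phi over [a, b] in the Hilbert space H'_p *)
Definition is_RInt p a b (phi : R -> multi_index -> R) (I : multi_index -> R) :=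
  in_H' p I /\
  forall e : R, 0 < e -> exists2 d : R, 0 < d &
    forall s (xi : nat -> R), itv_partition a b s -> mesh a s < d ->
      (forall k, (k < size s)%N -> pt a s k <= xi k <= pt a s k.+1) ->
      (H'norm p (\sum_(k < size s) (pt a s k.+1 - pt a s k) *: phi (xi k) - I)
       < e%:E)%E.

(* the limit of S Delta in H'_p is I as the mesh of Delta tends to 0 *)
Definition mesh_lim p a b (S : seq R -> multi_index -> R)
    (I : multi_index -> R) :=
  forall e : R, 0 < e -> exists2 d : R, 0 < d &
    forall s, itv_partition a b s -> mesh a s < d ->
      (H'norm p (S s - I) < e%:E)%E.

End riemann.

(* Main.v *)
Require Import Defs.
From HB Require Import structures.
From mathcomp Require Import all_boot all_order all_algebra finmap complex.
From mathcomp Require Import all_classical all_reals all_analysis.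
From mathcomp Require Import measurable_realfun.
From mathcomp Require Import ring lra.
Set Implicit Arguments.
Unset Strict Implicit.
Unset Printing Implicit Defensive.
Import Order.TTheory GRing.Theory Num.Theory.
Import numFieldNormedType.Exports.
Local Open Scope classical_set_scope.
Local Open Scope ring_scope.

(** Write [w_k(t) = T_m h_k (t)] for the Hermite functions [h_k].  The noise
    [W_m(t)] and the increments of [X_m] live in the first chaos: they are the
    families [fchaos v] supported on the unit multi-indices, with coefficients
    [w_k(t)] and [int_s^t w_k].  Everything rests on the bounds
      [|w_k(t)| <= B (k + 1)]  and  [|w_k(t) - w_k(s)| <= B (k + 1) |t - s|]
    ([Tm_hermite_bounded], [Tm_hermite_lipschitz]): as [h_k] is an eigenfunction
    of the Fourier transform, [w_k] is a cosine transform of [sqrt m * h_k], and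
    Cauchy-Schwarz compares it with [int m / (1 + u ^+ 2)] and a polynomially
    weighted norm of [h_k], which grows polynomially in [k].

    Wick multiplication by the [k]-th unit index multiplies the norm of [H'_(2r)]
    by at most [(2 (k + 1)) ^- r]; hence, by the triangle inequality, [fchaos v]
    is a bounded Wick multiplier of [H'_(2r)] as soon as [|v_k| <= C (k + 1)] and
    [r >= 3] ([bnd_wick_linear]).

    A strongly continuous path [Y] is bounded in some [H'_k] on the compact
    segment ([strong_bounded]): otherwise a bounded sequence of test functions
    would detect arbitrarily large values.  On bounded sets of [H'_k] the norm of
    [H'_(k+1)] is determined by finitely many coordinates up to a small error, so
    [Y] is continuous into [H'_(k+1)] ([strong_norm_continuous]).  Therefore the
    Wick product of [Y(t)] and [W_m(t)] is continuous into [H'_p] for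
    [p = 2 (k + 3)], and its coordinatewise integral is the Riemann integral
    ([is_RInt_path]).

    It remains to compare two sums.  With [D_j = t_(j+1) - t_j], the coefficients
    [int_(t_j)^(t_(j+1)) w_k] and [D_j w_k(t_j)] differ by at most
    [B (k + 1) D_j ^+ 2], so the [X_m]-sum and the Riemann sum tagged at the left
    endpoints differ by [O(mesh)] in [H'_p].

    The chaos coefficients of the increments of [X_m] are computed by Gaussian
    integration by parts ([stein]), obtained by differentiating the characteristic
    functional, which also yields that Gaussian variables have moments of all
    orders ([allmom_of_char]).  They are the pairings of [T_m 1_[0,t]] with [h_k],
    which Parseval's identity turns into the integral of [w_k] over [0,t]
    ([parseval_hermite], [Tm_pairing_signed]). *)

(** * Multi-indices and their weights *)

Section fin_index.
Implicit Types (al be ga : multi_index) (A : {fset multi_index}).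

(** Replacing the product over the support by one over an initial segment makes
    products for different multi-indices directly comparable. *)
Lemma prod_finsupp_ord al n (f : nat -> nat -> nat) : (forall k, f k 0%N = 1%N) ->
  (forall k, (n <= k)%N -> al k = 0%N) ->
  (\prod_(k <- finsupp al) f k (al k) = \prod_(k < n) f k (al k))%N.
Proof.
move=> f0 aln; rewrite -(big_mkord xpredT (fun k => f k (al k))).
rewrite [RHS](bigID (mem (finsupp al)) xpredT) /= [X in (_ * X)%N]big1 ?muln1; last first.
  by move=> k kn; rewrite fsfun_dflt.
rewrite -[RHS]big_filter; apply: perm_big; apply: uniq_perm.
- exact: fset_uniq.
- by rewrite filter_uniq// iota_uniq.
move=> k; rewrite mem_filter mem_index_iota leq0n/=.
case: (boolP (k \in finsupp al)) => //= kal.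
apply/esym; rewrite ltnNge; apply/negP => /aln; apply/eqP.
by rewrite -mem_finsupp.
Qed.

Lemma m2N_ord al n : (forall k, (n <= k)%N -> al k = 0%N) ->
  m2N al = (\prod_(k < n) (2 * k.+1) ^ al k)%N.
Proof. exact: (@prod_finsupp_ord al n (fun k j => (2 * k.+1) ^ j)%N). Qed.

Lemma finsupp_bound al : exists n, forall k, (n <= k)%N -> al k = 0%N.
Proof.
exists (\sum_(k <- finsupp al) k.+1)%N => k nk; apply: fsfun_dflt.
apply/negP => kal; move: nk; rewrite (big_fsetD1 k)//= leqNgt => /negP; apply.
exact: leq_addr.
Qed.

Lemma finsupp_bound_fset A :
  exists n, forall al, al \in A -> forall k, (n <= k)%N -> al k = 0%N.
Proof.
have [f fP] := choice finsupp_bound.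
exists (\sum_(al <- A) f al)%N => al alA k nk; apply: fP.
by apply: leq_trans nk; rewrite (big_fsetD1 al)//= leq_addr.
Qed.

Definition madd al k : multi_index := [fsfun al with k |-> (al k).+1].
Definition msub al k : multi_index := [fsfun al with k |-> (al k).-1].

Lemma maddE al k j : madd al k j = (al j + (j == k))%N.
Proof. by rewrite fsfun_withE; case: eqP => [->|]; rewrite ?addn1 ?addn0. Qed.

Lemma msubE al k j : msub al k j = (al j - (j == k))%N.
Proof. by rewrite fsfun_withE; case: eqP => [->|]; rewrite ?subn1 ?subn0. Qed.

Lemma mepsE k j : meps k j = (j == k) :> nat.
Proof. by rewrite fsfunE inE; case: eqP. Qed.

Lemma meps_inj : injective meps.
Proof.
move=> j k /fsfunP /(_ j); rewrite !mepsE eqxx.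
by case: eqP.
Qed.

Lemma msubK al k : (0 < al k)%N -> madd (msub al k) k = al.
Proof.
move=> ak; apply/fsfunP => j; rewrite maddE msubE.
by case: eqP => [->|]; rewrite ?subn0 ?addn0// subn1 addn1 prednK.
Qed.

Lemma m2N_madd al k : m2N (madd al k) = (m2N al * (2 * k.+1))%N.
Proof.
have [n aln] := finsupp_bound al.
have mx j : (maxn n k.+1 <= j)%N -> al j = 0%N /\ (j == k) = false.
  rewrite geq_max => /andP[nj kj]; split; first exact: aln.
  by apply/eqP => jk; rewrite jk ltnn in kj.
rewrite (@m2N_ord _ (maxn n k.+1)); last first.
  by move=> j /mx[aj jk]; rewrite maddE aj jk.
rewrite (@m2N_ord al (maxn n k.+1)); last by move=> j /mx[].
have kn : (k < maxn n k.+1)%N by rewrite leq_maxr.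
rewrite (bigD1 (Ordinal kn))//= [in RHS](bigD1 (Ordinal kn))//=.
rewrite maddE eqxx addn1 expnSr mulnAC; congr (_ * _ * _)%N.
apply: eq_bigr => j jk.
by rewrite maddE -(inj_eq val_inj)/= in jk *; rewrite (negbTE jk) addn0.
Qed.

Lemma m2N_gt0 al : (0 < m2N al)%N.
Proof.
by apply: prodn_gt0 => k; rewrite expn_gt0 muln_gt0.
Qed.

Lemma mfact_gt0 al : (0 < mfact al)%N.
Proof.
by apply: prodn_gt0 => k; rewrite fact_gt0.
Qed.

(** A multi-index of weight at most [C] is supported in [0, C] and has entries at
    most [C], since every factor [(2 (k + 1)) ^ n] with [n > 0] is at least [n] and
    at least [k + 1]. *)
Lemma m2N_finite C : exists A, forall al, (m2N al <= C)%N -> al \in A.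
Proof.
pose mk (f : {ffun 'I_C.+1 -> 'I_C.+1}) : multi_index :=
  [fsfun j in [fset val i | i in 'I_C.+1]%fset => val (f (inord j))].
exists [fset mk f | f in {ffun 'I_C.+1 -> 'I_C.+1}]%fset => al alC.
have alk k : ((2 * k.+1) ^ al k <= C)%N.
  case: (boolP (k \in finsupp al)) => kal; last first.
    by rewrite fsfun_dflt// expn0 (leq_trans _ alC)// m2N_gt0.
  apply: leq_trans alC; rewrite /m2N (big_fsetD1 k)//= leq_pmulr//.
  by apply: prodn_gt0 => j; rewrite expn_gt0 muln_gt0.
have al_le k : (al k <= C)%N.
  apply: leq_trans (alk k); apply: (@leq_trans (2 ^ al k)); first exact/ltnW/ltn_expl.
  by case: (al k) => // j; rewrite leq_exp2r// leq_pmulr.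
have al0 k : (C < k)%N -> al k = 0%N.
  move=> Ck; apply/eqP; rewrite -leqn0 leqNgt; apply/negP => ak.
  have := alk k; rewrite leqNgt => /negP; apply.
  apply: (@leq_trans ((2 * k.+1) ^ 1)); first by rewrite expn1 (leq_trans (leqW Ck))// leq_pmull.
  by rewrite leq_pexp2l// muln_gt0.
apply/imfsetP; exists [ffun i : 'I_C.+1 => inord (al i)] => //=.
apply/fsfunP => k; rewrite fsfunE; case: ifPn => [|kC].
  case/imfsetP => i _ ->; rewrite ffunE inord_val.
  by rewrite /= inordK// ltnS.
apply: al0; rewrite ltnNge; apply/negP => kC'; move/negP: kC; apply.
by apply/imfsetP; exists (inord k) => //=; rewrite inordK.
Qed.

End fin_index.

(** * Norms of the dual Kondratiev spaces through finite partial sums *)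

Section bound.
Context {R : realType}.
Implicit Types (G F : multi_index -> R) (A : {fset multi_index}) (p k : nat) (M : R).

Lemma sqrte_esum_le (a : multi_index -> R) M : 0 <= M -> (forall al, 0 <= a al) ->
  (sqrte (\esum_(al in [set: multi_index]) (a al)%:E) <= M%:E)%E <->
  (forall A, \sum_(al <- A) a al <= M ^+ 2).
Proof.
move=> M0 a0.
have -> : (sqrte (\esum_(al in [set: multi_index]) (a al)%:E) <= M%:E)%E =
          (\esum_(al in [set: multi_index]) (a al)%:E <= (M ^+ 2)%:E)%E.
  have e0 : (0 <= \esum_(al in [set: multi_index]) (a al)%:E)%E.
    by apply: esum_ge0 => al _; rewrite lee_fin.
  rewrite -[M%:E]gee0_abs ?lee_fin// -sqrte_sqr lee_sqrt ?expe_ge0 ?lee_fin//.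
split => [h A|h].
  rewrite -lee_fin -sumEFin.
  apply: le_trans h; apply: esum_ge; exists [set` A] => //.
  by rewrite fsbig_seq// fset_uniq.
apply: ge_ereal_sup => _ [S [Sf _]] <-.
have := h (fset_set S); rewrite -lee_fin -sumEFin => {h}.
by rewrite fsbig_finite.
Qed.

(** For [M >= 0], the inequality [||G|| <= M] in [H'_p], expressed by finite partial
    sums so that triangle and Cauchy-Schwarz inequalities reduce to finite ones. *)
Definition bnd p G M := forall A, \sum_(al <- A) G al ^+ 2 * (m2N al)%:R ^- p <= M ^+ 2.

Lemma wt_gt0 p al : 0 < (m2N al)%:R ^- p :> R.
Proof. by rewrite invr_gt0 exprn_gt0// ltr0n m2N_gt0. Qed.

Lemma H'normP p G M : 0 <= M -> (H'norm p G <= M%:E)%E <-> bnd p G M.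
Proof.
move=> M0; apply: sqrte_esum_le => // al.
by rewrite mulr_ge0 ?sqr_ge0// ltW// wt_gt0.
Qed.

Lemma HnormP k F M : 0 <= M -> (Hnorm k F <= M%:E)%E <->
  forall A, \sum_(al <- A) (mfact al)%:R ^+ 2 * F al ^+ 2 * (m2N al)%:R ^+ k <= M ^+ 2.
Proof. move=> M0; apply: sqrte_esum_le => // al.
by rewrite mulr_ge0 ?exprn_ge0 ?ler0n// mulr_ge0// sqr_ge0. Qed.

Lemma in_H'P p G : in_H' p G <-> exists2 M, 0 < M & bnd p G M.
Proof.
split => [GH|[M M0 /(H'normP _ _ (ltW M0)) h]]; last exact: le_lt_trans h (ltry _).
exists (fine (H'norm p G) + 1); first by rewrite ltr_wpDl// fine_ge0// sqrte_ge0.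
apply/H'normP; first by rewrite addr_ge0// fine_ge0// sqrte_ge0.
by rewrite EFinD fineK ?leeDl// ?lee_fin// ge0_fin_numE// sqrte_ge0.
Qed.

Lemma H'norm_lt p G e : 0 < e -> bnd p G (e / 2) -> (H'norm p G < e%:E)%E.
Proof.
move=> e0 /H'normP h; apply: le_lt_trans (h _) _; first by rewrite ltW// divr_gt0.
by rewrite lte_fin ltr_pdivrMr// ltr_pMr// ltr1n.
Qed.

Lemma bnd_le p G M N : 0 <= M -> M <= N -> bnd p G M -> bnd p G N.
Proof.
move=> M0 MN h A; apply: le_trans (h A) _.
by rewrite ler_sqr ?nnegrE// (le_trans M0).
Qed.

Lemma bnd0 p M : 0 <= M -> bnd p 0 M.
Proof. by move=> M0 A; rewrite big1 ?sqr_ge0// => al _; rewrite expr0n mul0r. Qed.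

Lemma bnd_coord p G M al : bnd p G M -> G al ^+ 2 * (m2N al)%:R ^- p <= M ^+ 2.
Proof. by move=> /(_ [fset al]%fset); rewrite big_seq_fset1. Qed.

Lemma bnd_eq0 p G : bnd p G 0 -> G = 0.
Proof.
move=> h; apply/funext => al; have := bnd_coord al h; rewrite expr0n/=.
rewrite pmulr_lle0 ?wt_gt0// => g0; apply/eqP; rewrite -sqrf_eq0.
by rewrite eq_le g0 sqr_ge0.
Qed.

Lemma bndZ p (c : R) G M : bnd p G M -> bnd p (c *: G) (`|c| * M).
Proof.
move=> h A; rewrite exprMn real_normK ?num_real//.
apply: le_trans (ler_wpM2l (sqr_ge0 c) (h A)).
by rewrite mulr_sumr; apply: ler_sum => al _; rewrite mulrA -exprMn.
Qed.

Lemma bndN p G M : bnd p G M -> bnd p (- G) M.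
Proof. by move=> h A; under eq_bigr do rewrite sqrrN; exact: h. Qed.

(** The triangle inequality, from [(x + y)^2 <= (1 + N/M) x^2 + (1 + M/N) y^2] in
    each coordinate; the weights are those giving [(M + N)^2] after summation. *)
Lemma bndD p G F M N : 0 <= M -> 0 <= N -> bnd p G M -> bnd p F N -> bnd p (G + F) (M + N).
Proof.
rewrite le_eqVlt => /orP[/eqP <- _ /bnd_eq0 ->|M0]; first by rewrite !add0r.
rewrite le_eqVlt => /orP[/eqP <- + /bnd_eq0 ->|N0]; first by rewrite !addr0.
move=> hG hF A.
have -> : (M + N) ^+ 2 = (1 + N / M) * M ^+ 2 + (1 + M / N) * N ^+ 2.
  by field; rewrite !gt_eqF.
apply: (@le_trans _ _ ((1 + N / M) * (\sum_(al <- A) G al ^+ 2 * (m2N al)%:R ^- p) +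
  (1 + M / N) * (\sum_(al <- A) F al ^+ 2 * (m2N al)%:R ^- p))); last first.
  by rewrite lerD// ler_wpM2l ?hG ?hF// addr_ge0// ltW// divr_gt0.
rewrite !mulr_sumr -big_split/=; apply: ler_sum => al _.
rewrite [X in _ <= X + _]mulrA [X in _ <= _ + X]mulrA -mulrDl.
rewrite ler_wpM2r ?(ltW (wt_gt0 _ _))// -subr_ge0.
have -> : (1 + N / M) * G al ^+ 2 + (1 + M / N) * F al ^+ 2 - (G + F) al ^+ 2 =
  (N * G al - M * F al) ^+ 2 / (M * N) by rewrite !fctE; field; rewrite !gt_eqF.
by rewrite divr_ge0 ?sqr_ge0// ltW// mulr_gt0.
Qed.

Lemma bnd_sum p n (G : nat -> multi_index -> R) (M : nat -> R) :
  (forall k, (k < n)%N -> 0 <= M k) ->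
  (forall k, (k < n)%N -> bnd p (G k) (M k)) ->
  bnd p (\sum_(k < n) G k) (\sum_(k < n) M k).
Proof.
elim: n => [|n IH] M0 h; first by rewrite !big_ord0; exact: bnd0.
rewrite !big_ord_recr/=; apply: bndD.
- by apply: sumr_ge0 => k _; rewrite M0// ltnS ltnW.
- exact: M0.
- by apply: IH => k kn; [apply: M0|apply: h]; rewrite ltnS ltnW.
- exact: h.
Qed.

End bound.

(** * Wick multiplication by elements of the first chaos *)

Section wick.
Context {R : realType}.
Implicit Types (G F : multi_index -> R) (A : {fset multi_index}) (M : R).

(** The element [\sum_k w_k H_(eps_k)] of the first chaos; by injectivity of [meps]
    the sum has at most one term. *)
Definition fchaos (w : nat -> R) : multi_index -> R := fun al =>
  \sum_(k \in [set k | meps k = al]) w k.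

(** The Wick product of [G] with the basis vector of index [meps k]. *)
Definition wshift k G : multi_index -> R := fun ga =>
  if (0 < ga k)%N then G (msub ga k) else 0.

Lemma fchaos_meps w k : fchaos w (meps k) = w k.
Proof.
rewrite /fchaos; have -> : [set j | meps j = meps k] = [set k].
  by apply/seteqP; split => [j /= /meps_inj|j /= ->].
by rewrite fsbig_set1.
Qed.

Lemma fchaos_out w al : (forall k, meps k != al) -> fchaos w al = 0.
Proof.
move=> h; rewrite /fchaos; have -> : [set j | meps j = al] = set0.
  by apply/seteqP; split => // j /= /eqP; rewrite (negbTE (h j)).
by rewrite fsbig_set0.
Qed.

Lemma fchaosE w F : (forall k, F (meps k) = w k) ->
  (forall al, (forall k, meps k != al) -> F al = 0) -> F = fchaos w.
Proof.
move=> h1 h2; apply/funext => al.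
have [[k <-]|h] := pselect (exists k, meps k = al); first by rewrite h1 fchaos_meps.
have {}h k : meps k != al by apply/eqP => e; apply: h; exists k.
by rewrite h2// fchaos_out.
Qed.

(** Shifting by a unit index multiplies the weight [m2N] by [2 (k + 1)], and the
    shift is injective on the indices where it does not vanish. *)
Lemma bnd_wshift r k G M : bnd (2 * r) G M ->
  bnd (2 * r) (wshift k G) ((2 * k.+1)%:R ^- r * M).
Proof.
move=> h A.
pose B := [fset msub ga k | ga in A & (0 < ga k)%N]%fset.
apply: (@le_trans _ _ (\sum_(al <- B) G al ^+ 2 * (m2N al)%:R ^- (2 * r) * (2 * k.+1)%:R ^- (2 * r))); last first.
  rewrite -mulr_suml exprMn mulrC exprVn -exprM [(r * 2)%N]mulnC; apply: ler_wpM2l (h B).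
  by rewrite invr_ge0 exprn_ge0.
rewrite big_imfset/=; last first.
  by move=> x y /= /andP[_ x0] /andP[_ y0] e; rewrite -(msubK x0) e msubK.
rewrite [X in _ <= X]big_filter (bigID (fun ga : multi_index => 0 < ga k)%N)/=.
rewrite [X in _ + X]big1 ?addr0.
  rewrite le_eqVlt; apply/orP; left; apply/eqP; apply: eq_bigr => ga g0.
  rewrite /wshift g0 -mulrA -invfM -exprMn -natrM -m2N_madd msubK//.
by move=> ga g0; rewrite /wshift (negbTE g0) expr0n mul0r.
Qed.

(** Only the indices in the support of [ga] contribute, so the Wick product is a
    finite combination of shifts in each coordinate. *)
Lemma wick_fchaos G w n (ga : multi_index) : (forall k, (n <= k)%N -> ga k = 0%N) ->
  wick G (fchaos w) ga = \sum_(k < n) w k * wshift k G ga.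
Proof.
move=> gan; rewrite /wick.
pose s := [seq (msub ga k, meps k) | k <- iota 0 n & (0 < ga k)%N].
have sub : [set` s] `<=` [set p : multi_index * multi_index |
    forall k, (p.1 k + p.2 k)%N = ga k].
  move=> p /= /mapP[k]; rewrite mem_filter => /andP[gk _] -> j /=.
  by rewrite msubE mepsE; case: eqP => [->|_]; rewrite ?subn0 ?addn0// subn1 addn1 prednK.
rewrite (@fsbigE _ _ _ _ _ s) //; first last.
- move=> [be al] /= hp ns; rewrite fchaos_out ?mulr0// => k; apply/eqP => e.
  move/negP: ns; apply; apply/mapP; exists k; last first.
    congr pair => //; apply/fsfunP => j; rewrite msubE -hp -e mepsE addnK//.
  have gk : (0 < ga k)%N by rewrite -hp -e mepsE eqxx addn1.
  rewrite mem_filter gk/= mem_iota/= add0n ltnNge; apply/negP => /gan gk0.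
  by rewrite gk0 in gk.
- rewrite map_inj_uniq ?filter_uniq ?iota_uniq// => x y [_].
  exact: meps_inj.
transitivity (\sum_(p <- s) G p.1 * fchaos w p.2).
  rewrite big_seq_cond [RHS]big_seq; apply: eq_bigl => p.
  by case: (boolP (p \in s)) => //= ps; apply/mem_set/sub.
rewrite big_map big_filter -(big_mkord xpredT (fun k => w k * wshift k G ga)).
rewrite /index_iota subn0 big_mkcond/=; apply: eq_bigr => k _.
by rewrite fchaos_meps /wshift; case: ifP; rewrite ?mulr0// mulrC.
Qed.

(** The triangle inequality for the shifts composing the product. *)
Lemma bnd_wick r G (w : nat -> R) M C : 0 <= M -> 0 <= C -> bnd (2 * r) G M ->
  (forall n, \sum_(k < n) `|w k| * (2 * k.+1)%:R ^- r <= C) ->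
  bnd (2 * r) (wick G (fchaos w)) (C * M).
Proof.
move=> M0 C0 hG hw A.
have [n An] := finsupp_bound_fset A.
have hs := @bnd_sum R (2 * r) n (fun k => w k *: wshift k G)
  (fun k => `|w k| * ((2 * k.+1)%:R ^- r * M)).
have {}hs := hs _ _ A.
apply: (@le_trans _ _ ((\sum_(k < n) `|w k| * ((2 * k.+1)%:R ^- r * M)) ^+ 2)); last first.
  rewrite ler_sqr ?nnegrE ?mulr_ge0//.
    under eq_bigr do rewrite mulrA.
    by rewrite -mulr_suml ler_wpM2r.
  by apply: sumr_ge0 => k _; rewrite !mulr_ge0 ?invr_ge0 ?exprn_ge0.
apply: le_trans (hs _ _).
- rewrite le_eqVlt; apply/orP; left; apply/eqP; apply: eq_big_seq => ga gaA.
  by rewrite (wick_fchaos _ _ (An _ gaA)) fct_sumE.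
- by move=> k _; rewrite !mulr_ge0 ?invr_ge0 ?exprn_ge0.
- by move=> k _; apply/bndZ/bnd_wshift.
Qed.

Lemma wick_fchaosB G w v : 
  wick G (fchaos w) - wick G (fchaos v) = wick G (fchaos (w - v)).
Proof.
apply/funext => ga; have [n gan] := finsupp_bound ga.
rewrite !fctE !(wick_fchaos _ _ gan) -sumrB; apply: eq_bigr => k _.
by rewrite mulrBl.
Qed.

Lemma wickB_fchaos G F w : 
  wick (G - F) (fchaos w) = wick G (fchaos w) - wick F (fchaos w).
Proof.
apply/funext => ga; have [n gan] := finsupp_bound ga.
rewrite !fctE !(wick_fchaos _ _ gan) -sumrB; apply: eq_bigr => k _.
by rewrite /wshift; case: ifP => _; rewrite ?mulr0 ?subrr// mulrBr.
Qed.

Lemma wick_fchaosZ G (c : R) w : wick G (fchaos (c *: w)) = c *: wick G (fchaos w).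
Proof.
apply/funext => ga; have [n gan] := finsupp_bound ga.
rewrite !fctE !(wick_fchaos _ _ gan) scaler_sumr; apply: eq_bigr => k _.
by rewrite /GRing.scale/= mulrA.
Qed.

End wick.

(** * Strongly continuous paths in the dual of the Kondratiev space *)

(** Compactness, applied to the balls of half the given radii: these are the ones
    for which membership survives a perturbation by the smallest half radius. *)
Lemma segment_lebesgue_number (R : realType) (a b : R) (d : R -> R) :
  (forall t, t \in `[a, b] -> 0 < d t) ->
  exists (s : seq R) (e : R), [/\ 0 < e, forall t, t \in s -> t \in `[a, b] &
    forall u, u \in `[a, b] -> exists2 t, t \in s &
      forall v, `|v - u| < e -> `|v - t| < d t].
Proof.
move=> d0; have := @segment_compact R a b; rewrite compact_cover => cpt.
have d2 t : t \in `[a, b] -> 0 < d t / 2 by move=> /d0 dt; rewrite divr_gt0.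
pose r t := if t \in `[a, b] then d t / 2 else 1.
have r0 t : 0 < r t by rewrite /r; case: ifP => [/d2|].
have [t tab|t tab|D Dab cov] := cpt R `[a, b]%classic (fun t => ball t (r t)).
- exact: ball_open.
- by exists t => //; exact: ballxx.
have Dab' t : t \in D -> t \in `[a, b] by move=> /Dab; rewrite inE.
have [e e0 eP] : exists2 e : R, 0 < e & forall t, t \in enum_fset D -> e <= d t / 2.
  elim: (enum_fset D) (fun t (tD : t \in enum_fset D) => d2 t (Dab' t tD)) => [_|t s IH h].
    by exists 1.
  have [|e e0 eP] := IH; first by move=> u us; apply: h; rewrite inE us orbT.
  exists (Num.min (d t / 2) e); first by rewrite lt_min e0 h// mem_head.
  by move=> u; rewrite inE => /orP[/eqP ->|/eP eu]; rewrite ge_min ?lexx// eu orbT.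
exists (enum_fset D), e; split; [exact: e0|by move=> x xD; apply: Dab'|].
move=> u uab; have [t /= tD] := cov u uab.
rewrite /ball/= /r Dab'// => tu; exists t => // v vu.
rewrite -(subrKA u) (le_lt_trans (ler_normD _ _))// [d t]splitr ltrD//.
  exact: lt_le_trans vu (eP _ tD).
by rewrite distrC.
Qed.

Section finite_sums.
Context {R : realType}.

Lemma sum_fset_supp (T : choiceType) (f : T -> R) (A B : {fset T}) :
  (forall x, 0 <= f x) -> (forall x, x \notin A -> f x = 0) ->
  \sum_(x <- B) f x <= \sum_(x <- A) f x.
Proof.
move=> f0 fA; rewrite (bigID (mem A))/= [X in _ + X]big1 ?addr0; last by move=> x /fA.
rewrite [leRHS](bigID (mem B))/= -[leLHS]addr0; apply: lerD; last exact: sumr_ge0.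
rewrite -big_filter -[leRHS]big_filter le_eqVlt; apply/orP; left; apply/eqP.
apply: perm_big; apply: uniq_perm; rewrite ?filter_uniq ?fset_uniq// => x.
by rewrite !mem_filter andbC.
Qed.

Lemma cauchy_schwarz_sum (T : choiceType) (f g w : T -> R) (s : seq T) :
  (forall x, 0 < w x) ->
  (\sum_(x <- s) f x * g x) ^+ 2 <=
  (\sum_(x <- s) f x ^+ 2 * w x) * (\sum_(x <- s) g x ^+ 2 * (w x)^-1).
Proof.
move=> w0.
set p := \sum_(x <- s) f x * g x; set q := \sum_(x <- s) f x ^+ 2 * w x.
set r := \sum_(x <- s) g x ^+ 2 / w x.
have h (c : R) : 0 <= q * c ^+ 2 - 2 * c * p + r.
  rewrite /q /p /r mulr_sumr mulr_suml -sumrB -big_split/=.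
  apply: sumr_ge0 => x _.
  have -> : f x ^+ 2 * w x * c ^+ 2 - 2 * c * (f x * g x) + g x ^+ 2 / w x =
    (c * f x * w x - g x) ^+ 2 / w x by field; rewrite gt_eqF.
  by rewrite divr_ge0 ?sqr_ge0// ltW.
have q0 : 0 <= q by apply: sumr_ge0 => x _; rewrite mulr_ge0 ?sqr_ge0// ltW.
move: q0; rewrite le_eqVlt => /orP[/eqP q0|q0].
  rewrite -q0 mul0r.
  have f0 : p = 0.
    apply/eqP; apply: contraT => p0.
    have := h ((r + 1) / (2 * p)); rewrite -q0 mul0r add0r.
    have -> : - (2 * ((r + 1) / (2 * p)) * p) + r = -1 by field; lra.
    by rewrite ler0N1.
  by rewrite f0 expr0n.
have := h (p / q); have -> : q * (p / q) ^+ 2 - 2 * (p / q) * p + r = r - p ^+ 2 / q.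
  by field; rewrite gt_eqF.
by rewrite subr_ge0 ler_pdivrMr// mulrC.
Qed.

End finite_sums.

Section strong.
Context {R : realType}.
Implicit Types (G : Sm1 R) (F : S1 R) (A : {fset multi_index}) (a b : R).

Lemma strong_continuousP a b (Y : R -> Sm1 R) t (B : set (S1 R)) (e : R) :
  {within `[a, b], continuous Y} -> t \in `[a, b] -> S1_bounded B -> 0 < e ->
  exists2 d : R, 0 < d & forall u, u \in `[a, b] -> `|u - t| < d ->
    forall F, B F -> `|dual_pairing (Y t) F - dual_pairing (Y u) F| < e.
Proof.
move=> /subspace_continuousP cY tab Bb e0.
have {}cY := cY t tab.
have h : strong_dual_embedding (Y x) @[x --> within `[a, b] (nbhs t)] -->
   strong_dual_embedding (Y t).
  apply: (cvg_comp _ _ cY).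
  exact: (@initial_continuous _ _ (@strong_dual_embedding R)).
move/fam_cvgP : h => /(_ B Bb) h.
have /h : nbhs (strong_dual_embedding (Y t) : {uniform` B -> R})
   [set f : {uniform` B -> R} | forall y, B y -> ball (strong_dual_embedding (Y t) y) e (f y)].
  apply/uniform_nbhs; exists [set xy | ball xy.1 e xy.2]; split => //.
  exact: entourage_ball (PosNum e0).
rewrite /= /within/= => /nbhs_ballP[d /= d0 hd].
exists d => // u uab ut F BF.
by have /(_ _ uab _ BF) := hd u; apply; rewrite /ball/= distrC.
Qed.

Lemma msum_fin (f : multi_index -> R) A : (forall al, al \notin A -> f al = 0) ->
  Defs.msum f = \sum_(al <- A) f al.
Proof.
move=> f0; rewrite /Defs.msum.
have E (g : multi_index -> R) : (forall al, 0 <= g al) -> (forall al, al \notin A -> g al = 0) ->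
    fine (\esum_(al in [set: multi_index]) (g al)%:E) = \sum_(al <- A) g al.
  move=> g0 gA; have -> : \esum_(al in [set: multi_index]) (g al)%:E =
      \esum_(al in [set` A]) (g al)%:E.
    rewrite [RHS]esum_mkcond; apply: eq_esum => al _.
    case: ifPn => // alA; rewrite gA//; apply: contraNN alA => alA.
    by rewrite inE.
  rewrite esum_fset//; last by move=> al _; rewrite lee_fin.
  by rewrite -fsbig_seq ?fset_uniq// sumEFin.
rewrite !E.
- by rewrite -sumrB; apply: eq_bigr => al _; rewrite -[in RHS](funrposBneg f).
- by move=> al; exact: funrneg_ge0.
- by move=> al /f0; rewrite /funrneg => ->; rewrite oppr0 maxxx.
- by move=> al; exact: funrpos_ge0.
- by move=> al /f0; rewrite /funrpos => ->; rewrite maxxx.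
Qed.

Lemma in_H_fin (phi0 : multi_index -> R) A k : (forall al, al \notin A -> phi0 al = 0) -> in_H k phi0.
Proof.
move=> f0; pose S := \sum_(al <- A) (mfact al)%:R ^+ 2 * phi0 al ^+ 2 * (m2N al)%:R ^+ k : R.
have t0 al : 0 <= (mfact al)%:R ^+ 2 * phi0 al ^+ 2 * (m2N al)%:R ^+ k.
  by rewrite mulr_ge0 ?exprn_ge0 ?ler0n// mulr_ge0// sqr_ge0.
have S0 : 0 <= S by exact: sumr_ge0.
apply: (@le_lt_trans _ _ (Num.sqrt S)%:E); last exact: ltry.
apply/HnormP; first exact: sqrtr_ge0.
move=> B; rewrite sqr_sqrtr//; apply: sum_fset_supp => // al /f0 ->.
by rewrite expr0n mulr0 mul0r.
Qed.

(** Finitely supported test functions suffice to separate the dual. *)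
Definition S1_fin (phi0 : multi_index -> R) A (h : forall al, al \notin A -> phi0 al = 0) : S1 R :=
  MkS1 (fun k _ => in_H_fin k h).

Lemma dual_pairing_fin G F A : (forall al, al \notin A -> F al = 0) ->
  dual_pairing G F = \sum_(al <- A) (mfact al)%:R * F al * G al.
Proof. by move=> f0; apply: msum_fin => al /f0 ->; rewrite mulr0 mul0r. Qed.

(** Cauchy-Schwarz; the factor [mfact al] of the pairing is the one squared in the
    norm of [H_k]. *)
Lemma dual_pairing_le G F A k M N : 0 <= M -> 0 <= N ->
  (forall al, al \notin A -> F al = 0) ->
  bnd k G M -> (Hnorm k F <= N%:E)%E -> `|dual_pairing G F| <= M * N.
Proof.
move=> M0 N0 f0 hG /(HnormP _ _ N0) hF; rewrite (dual_pairing_fin _ f0).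
have w0 al : 0 < (m2N al)%:R ^+ k :> R by rewrite exprn_gt0// ltr0n m2N_gt0.
rewrite -ler_sqr ?nnegrE ?mulr_ge0//.
rewrite real_normK ?num_real//.
apply: le_trans (cauchy_schwarz_sum _ _ _ w0) _.
rewrite exprMn mulrC; apply: ler_pM.
- by apply: sumr_ge0 => al _; rewrite mulr_ge0 ?sqr_ge0// invr_ge0 ltW.
- by apply: sumr_ge0 => al _; rewrite mulr_ge0 ?sqr_ge0// ltW.
- exact: hG.
- by apply: le_trans (hF A); apply: ler_sum => al _; rewrite exprMn.
Qed.

(** A uniform boundedness principle by duality.  If the path is unbounded in every
    [H'_(k+1)], choose [t_k] and a finitely supported test function [F_k], of norm
    one in [H_(k+1)], whose pairing with [Y (t_k)] exceeds [k + 1].  As the norms of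
    [H_j] increase with [j], the [F_k] form a bounded set of test functions, over
    which the pairing with [Y t] is bounded uniformly in [t] by compactness. *)
Lemma strong_bounded a b (Y : R -> Sm1 R) : {within `[a, b], continuous Y} ->
  exists k M, [/\ (0 < k)%N, 0 < M & forall t, t \in `[a, b] -> bnd k (Y t) M].
Proof.
move=> cY; apply: contrapT => nb.
have /choice[t tP] (k : nat) : exists t, t \in `[a, b] /\ ~ bnd k.+1 (Y t) k.+1%:R.
  apply: contrapT => h; apply: nb; exists k.+1, k.+1%:R; split => // t tab.
  by apply: contrapT => h'; apply: h; exists t.
have /choice[A AP] (k : nat) : exists A, k.+1%:R ^+ 2 <
    \sum_(al <- A) Y (t k) al ^+ 2 * (m2N al)%:R ^- k.+1.
  by have [_ /existsNP[A /negP]] := tP k; rewrite -ltNge; exists A.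
pose c k : R := Num.sqrt (\sum_(al <- A k) Y (t k) al ^+ 2 * (m2N al)%:R ^- k.+1).
have c0 k : k.+1%:R < c k.
  have := AP k; rewrite -ltr_sqrt ?(le_lt_trans _ (AP k)) ?sqr_ge0//.
  by rewrite sqrtr_sqr ger0_norm.
have cgt k : 0 < c k by apply: lt_trans (c0 k).
have csq k : c k ^+ 2 = \sum_(al <- A k) Y (t k) al ^+ 2 * (m2N al)%:R ^- k.+1.
  by rewrite sqr_sqrtr// (le_trans _ (ltW (AP k)))// sqr_ge0.
(* The Riesz representative of [Y (t k)] restricted to [A k], normalized in
   [H_(k+1)]. *)
pose phi0 k al : R := if al \in A k then
  Y (t k) al * (m2N al)%:R ^- k.+1 / (mfact al)%:R / c k else 0.
have phi00 k al : al \notin A k -> phi0 k al = 0 by rewrite /phi0 => /negbTE ->.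
pose F k := S1_fin (phi00 k).
have mf0 al : (mfact al)%:R != 0 :> R by rewrite pnatr_eq0 -lt0n mfact_gt0.
have w0 al : (m2N al)%:R != 0 :> R by rewrite pnatr_eq0 -lt0n m2N_gt0.
have w1 al k : (m2N al)%:R ^+ k != 0 :> R by rewrite expf_neq0.
have FH k : (Hnorm k.+1 (F k) <= 1%:E)%E.
  apply/HnormP => // B; rewrite expr1n.
  apply: le_trans (sum_fset_supp (A := A k) _ _ _) _.
  - by move=> al; rewrite mulr_ge0 ?exprn_ge0 ?ler0n// mulr_ge0// sqr_ge0.
  - by move=> al alA; rewrite /= phi00// expr0n mulr0 mul0r.
  rewrite -[leRHS](@divff _ (c k ^+ 2)) ?expf_neq0 ?gt_eqF// {1}csq mulr_suml.
  rewrite le_eqVlt; apply/orP; left; apply/eqP; apply: eq_big_seq => al alA.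
  rewrite /= /phi0 alA; move: (w1 al k.+1) (mf0 al) (gt_eqF (cgt k)).
  move: (_ ^+ k.+1) (c k) (mfact al)%:R => x y z x0 z0 /negbT y0.
  by field; rewrite x0 y0 z0.
have FY k : dual_pairing (Y (t k)) (F k) = c k.
  rewrite (@dual_pairing_fin _ (F k) _ (phi00 k)).
  apply: (mulfI (_ : c k != 0)); first by rewrite gt_eqF.
  rewrite -[RHS]expr2 csq mulr_sumr; apply: eq_big_seq => al alA.
  rewrite /= /phi0 alA; move: (w1 al k.+1) (mf0 al) (gt_eqF (cgt k)).
  move: (_ ^+ k.+1) (c k) (mfact al)%:R => x y z x0 z0 /negbT y0.
  by field; rewrite x0 y0 z0.
pose B := range F.
have Bb : S1_bounded B.
  move=> j j0.
  (* For [k >= j] the norm in [H_j] is at most the norm in [H_(k+1)], which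
     is one. *)
  pose m := \sum_(k < j) fine (Hnorm j (F k)) + 1.
  have h0 k : 0 <= fine (Hnorm j (F k)) by rewrite fine_ge0// sqrte_ge0.
  exists m => _ [k _ <-].
  have [kj|jk] := ltnP k j.
    apply: (@le_trans _ _ (fine (Hnorm j (F k)))%:E).
      rewrite fineK// ge0_fin_numE ?sqrte_ge0//; exact: S1P.
    rewrite lee_fin /m (bigD1 (Ordinal kj))//= -addrA lerDl addr_ge0//.
    by apply: sumr_ge0 => i _; exact: (h0 i).
  have m1 : 1 <= m by rewrite /m lerDr sumr_ge0.
  apply: (@le_trans _ _ 1%:E); last by rewrite lee_fin.
  apply/HnormP => // C; apply: le_trans (proj1 (HnormP _ _ _) (FH k) C) => //.
  apply: ler_sum => al _; rewrite ler_wpM2l//.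
    by rewrite mulr_ge0 ?sqr_ge0.
  by rewrite ler_weXn2l ?(leq_trans jk)// ler1n m2N_gt0.
have /choice[d dP] (u : R) : exists d, u \in `[a, b] -> 0 < d /\
    forall v, v \in `[a, b] -> `|v - u| < d ->
    forall f, B f -> `|dual_pairing (Y u) f - dual_pairing (Y v) f| < 1.
  case: (boolP (u \in `[a, b])) => uab; last by exists 0.
  have [d d0 dP] := strong_continuousP cY uab Bb ltr01.
  by exists d.
have [s [e [e0 sab cov]]] := @segment_lebesgue_number R a b d (fun u uab => (dP u uab).1).
have /choice[N NP] (u : R) : exists N : R, forall f, B f -> `|dual_pairing (Y u) f| <= N.
  have [j j0 /in_H'P[M M0 hM]] := Sm1P (Y u).
  have [N hN] := Bb j j0.
  exists (M * Num.max N 0) => _ [k _ <-]; apply: (@dual_pairing_le _ (F k) (A k) j) => //.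
  - exact: ltW.
  - by rewrite le_max lexx orbT.
  - exact: phi00.
  apply: (@le_trans _ _ N%:E); last by rewrite lee_fin le_max lexx.
  by apply: hN; exists k.
(* One more than the bounds at the finitely many points of the net: the
   pairing varies by less than one around each. *)
pose K := \sum_(u <- s) `|N u| + 1.
have KP v f : v \in `[a, b] -> B f -> `|dual_pairing (Y v) f| <= K.
  move=> vab Bf; have [u us /(_ v)] := cov v vab; rewrite subrr normr0 => /(_ e0) vu.
  have [_ /(_ v vab vu f Bf) h] := dP u (sab _ us).
  have -> : dual_pairing (Y v) f = dual_pairing (Y u) f -
    (dual_pairing (Y u) f - dual_pairing (Y v) f) by rewrite subKr.
  rewrite (le_trans (ler_normB _ _))// /K lerD ?(ltW h)//.
  apply: le_trans (NP u f Bf) _; rewrite (big_rem u)//=.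
  by rewrite (le_trans (ler_norm _))// lerDl sumr_ge0.
have [k Kk] : exists k : nat, K < k.+1%:R.
  exists (Num.truncn K); apply: truncnS_gt.
have := KP (t k) (F k) (tP k).1 (ex_intro2 _ _ k I erefl).
rewrite FY leNgt => /negP; apply; apply: lt_trans Kk _.
by apply: lt_le_trans (c0 k) _; rewrite ler_norm.
Qed.

(** A coordinate is the pairing with a multiple of a basis vector. *)
Lemma coord_continuous a b (Y : R -> Sm1 R) t al e :
  {within `[a, b], continuous Y} -> t \in `[a, b] -> 0 < e ->
  exists2 d : R, 0 < d & forall u, u \in `[a, b] -> `|u - t| < d ->
    `|Y u al - Y t al| < e.
Proof.
move=> cY tab e0.
pose phi0 be : R := if be == al then (mfact al)%:R^-1 else 0.
have phi00 be : be \notin [fset al]%fset -> phi0 be = 0.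
  by rewrite inE /phi0 => /negbTE ->.
have E (G : Sm1 R) : dual_pairing G (S1_fin phi00) = G al.
  rewrite (@dual_pairing_fin _ (S1_fin phi00) _ phi00) big_seq_fset1 /= /phi0 eqxx divff ?mul1r//.
  by rewrite pnatr_eq0 -lt0n mfact_gt0.
have Bb : S1_bounded [set S1_fin phi00].
  move=> j j0; exists (fine (Hnorm j (S1_fin phi00))) => _ ->.
  by rewrite fineK// ge0_fin_numE ?sqrte_ge0//; exact: (S1P (S1_fin phi00)).
have [d d0 h] := strong_continuousP cY tab Bb e0; exists d => // u uab ut.
by rewrite distrC -!E; exact: h.
Qed.

(** Strong continuity upgrades to norm continuity at the price of one index:
   on norm-bounded sets the weight [m2N al ^- 1] makes the tails uniformly
   small, and only finitely many coordinates remain. *)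
Lemma strong_norm_continuous a b (Y : R -> Sm1 R) k M t e :
  {within `[a, b], continuous Y} -> 0 < M ->
  (forall t, t \in `[a, b] -> bnd k (Y t) M) -> t \in `[a, b] -> 0 < e ->
  exists2 d : R, 0 < d & forall u, u \in `[a, b] -> `|u - t| < d ->
    bnd k.+1 ((Y u : multi_index -> R) - (Y t : multi_index -> R)) e.
Proof.
move=> cY M0 YM tab e0.
(* Outside the indices of weight at most [C], the extra factor [m2N al ^- 1]
   brings the squared norm [(2 M)^2] below [e^2 / 2]. *)
pose C := (Num.truncn ((2 * M) ^+ 2 / (e ^+ 2 / 2))).
have e2 : 0 < e ^+ 2 / 2 by rewrite divr_gt0// exprn_gt0.
have CP : (2 * M) ^+ 2 / (e ^+ 2 / 2) < C.+1%:R by exact: truncnS_gt.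
have [A AP] := m2N_finite C.
have [d d0 dP] : exists2 d : R, 0 < d & forall u, u \in `[a, b] -> `|u - t| < d ->
    \sum_(al <- A) (Y u al - Y t al) ^+ 2 * (m2N al)%:R ^- k.+1 <= e ^+ 2 / 2.
  elim: (enum_fset A) (e ^+ 2 / 2) e2 => [|al s IH] r r0.
    by exists 1 => // u _ _; rewrite big_nil ltW.
  have r2 : 0 < r / 2 by rewrite divr_gt0.
  have [d d0 dP] := IH _ r2.
  have [|d' d'0 d'P] := @coord_continuous a b Y t al (Num.sqrt (r / 2)) cY tab.
    by rewrite sqrtr_gt0.
  exists (Num.min d d'); first by rewrite lt_min d0.
  move=> u uab; rewrite lt_min => /andP[ud ud'].
  rewrite big_cons [r]splitr lerD ?dP//.
  have := d'P u uab ud'; rewrite -ltr_sqr ?nnegrE ?sqrtr_ge0//.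
  rewrite sqr_sqrtr ?(ltW r2)// real_normK ?num_real// => /ltW h.
  apply: le_trans h; rewrite ler_piMr ?sqr_ge0// invf_le1 ?exprn_gt0 ?ltr0n ?m2N_gt0//.
  by rewrite exprn_ege1// ler1n m2N_gt0.
exists d => // u uab ut B.
pose f al := (Y u al - Y t al) ^+ 2 * (m2N al)%:R ^- k.+1.
have f0 al : 0 <= f al by rewrite mulr_ge0 ?sqr_ge0// ltW// wt_gt0.
rewrite (bigID (mem A))/= [e ^+ 2]splitr; apply: lerD.
  apply: le_trans (dP u uab ut).
  rewrite [leRHS](bigID (mem B))/= -[leLHS]addr0; apply: lerD; last by apply: sumr_ge0 => al _; exact: f0.
  rewrite -big_filter -[leRHS]big_filter le_eqVlt; apply/orP; left; apply/eqP.
  apply: perm_big; apply: uniq_perm; rewrite ?filter_uniq ?fset_uniq// => x.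
  by rewrite !mem_filter andbC.
have Yb : bnd k ((Y u : multi_index -> R) - (Y t : multi_index -> R)) (M + M).
  by apply: bndD; rewrite ?ltW//; [exact: YM|apply/bndN/YM].
have C0 : (0 : R) < C.+1%:R by [].
apply: (@le_trans _ _ (\sum_(al <- B | al \notin A) C.+1%:R^-1 *
    ((Y u al - Y t al) ^+ 2 * (m2N al)%:R ^- k))).
  apply: ler_sum => al alA; rewrite [X in _ / X]exprS invfM mulrCA ler_wpM2r//.
    by rewrite mulr_ge0 ?sqr_ge0// ltW// wt_gt0.
  rewrite lef_pV2 ?posrE ?ltr0n ?m2N_gt0// ler_nat ltnNge.
  by apply: contraNN alA; exact: AP.
rewrite -mulr_sumr ler_pdivrMl//.
apply: (@le_trans _ _ ((M + M) ^+ 2)).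
  apply: le_trans (Yb B); rewrite [leRHS](bigID (mem A))/= lerDr sumr_ge0// => al _.
  by rewrite mulr_ge0 ?sqr_ge0// ltW// wt_gt0.
move: CP; rewrite ltr_pdivrMr// mulrDl mul1r => /ltW; exact.
Qed.

End strong.

(** * Square integrable functions, parametric integrals and Schwartz functions *)

Section L2.
Context d (T : measurableType d) (R : realType) (mu : {measure set T -> \bar R}).
Implicit Types f g h : T -> R.

Lemma integrable_measurable f : mu.-integrable setT (EFin \o f) -> measurable_fun setT f.
Proof. by move=> /measurable_int /measurable_EFinP. Qed.

Lemma integrable_dominated f g : measurable_fun setT f -> (forall x, `|f x| <= g x) ->
  mu.-integrable setT (EFin \o g) -> mu.-integrable setT (EFin \o f).
Proof.
move=> mf fg; apply: le_integrable => //; first exact/measurable_EFinP.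
by move=> x _ /=; rewrite lee_fin (le_trans (fg x))// ler_norm.
Qed.

Lemma Lfun2_measurable f : f \in Lfun mu 2%:E -> measurable_fun setT f.
Proof. by move=> /sub_Lfun_mfun; rewrite inE. Qed.

Lemma Lfun2_Lnorm f : f \in Lfun mu 2%:E -> (Lnorm mu 2%:E (EFin \o f) < +oo)%E.
Proof. by move=> /sub_Lfun_finLfun; rewrite inE. Qed.

Lemma Lfun2I f : measurable_fun setT f ->
  mu.-integrable setT (EFin \o (fun x => f x ^+ 2)) -> f \in Lfun mu 2%:E.
Proof.
move=> mf /integrableP[_ fi]; rewrite inE; apply/andP; split; first by rewrite inE.
rewrite inE/= /finite_norm unlock poweR_lty//.
apply: le_lt_trans fi; rewrite le_eqVlt; apply/orP; left; apply/eqP.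
apply: eq_integral => x _ /=.
by rewrite powR_mulrn// normrX.
Qed.

Lemma Lfun2_mul_integrable f g : f \in Lfun mu 2%:E -> g \in Lfun mu 2%:E ->
  mu.-integrable setT (EFin \o (f \* g)).
Proof. by move=> fL gL; apply/Lfun1_integrable/Lfun2_mul_Lfun1. Qed.

(** Hoelder's inequality. Integrability of the products replaces square integrability
    of the [f_ n], which for Fourier transforms would require Plancherel's theorem. *)
Lemma Lfun2_cvg_mul (f_ : nat -> T -> R) f g :
  (forall n, measurable_fun setT (f_ n)) -> measurable_fun setT f ->
  (forall n, mu.-integrable setT (EFin \o (f_ n \* g))) ->
  mu.-integrable setT (EFin \o (f \* g)) -> g \in Lfun mu 2%:E ->
  (Lnorm mu 2%:E (fun x => (f_ n x - f x)%:E) @[n --> \oo] --> 0)%E ->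
  \int[mu]_x (f_ n x * g x) @[n --> \oo] --> \int[mu]_x (f x * g x).
Proof.
move=> mf_ mf if_ iff gL cvf.
have [mg gfin] := (Lfun2_measurable gL, Lfun2_Lnorm gL).
pose c := fine (Lnorm mu 2%:E (EFin \o g)).
have cE : c%:E = Lnorm mu 2%:E (EFin \o g) by rewrite fineK// ge0_fin_numE ?Lnorm_ge0.
have c0 : 0 <= c by rewrite fine_ge0// Lnorm_ge0.
apply/cvgrPdist_le => e e0.
have ec : 0 < e / (c + 1) by rewrite divr_gt0// ltr_wpDl.
have : \forall n \near \oo, (Lnorm mu 2%:E (fun x => (f_ n x - f x)%:E) < (e / (c + 1))%:E)%E.
  apply: (cvf [set x | (x < (e / (c + 1))%:E)%E]).
  by apply: open_nbhs_nbhs; split; [exact: open_ereal_lt_ereal|rewrite /= lte_fin].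
apply: filterS => n hn.
rewrite distrC -RintegralB//; last exact: if_.
have ii : mu.-integrable setT (EFin \o ((f_ n \- f) \* g)).
  have := integrableB measurableT (if_ n) iff; apply: eq_integrable => // x _ /=.
  by rewrite -EFinB mulrBl.
rewrite -lee_fin (_ : \int[mu]_x _ = \int[mu]_x ((f_ n \- f) \* g) x); last first.
  by apply: eq_Rintegral => x _ /=; rewrite mulrBl.
apply: (@le_trans _ _ (Lnorm mu 1%:E (EFin \o ((f_ n \- f) \* g)))).
  rewrite Lnorm1 EFin_normr_Rintegral//; apply: le_abse_integral => //.
  exact: measurable_int ii.
apply: le_trans (@hoelder _ _ _ mu (f_ n \- f) g 2 2 _ _ _ _ _) _ => //.
- exact: measurable_funB.
- by rewrite [RHS]splitr !div1r.
rewrite -[e](@divfK _ (c + 1)) ?gt_eqF ?ltr_wpDl// EFinM.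
apply: lee_pmul; rewrite ?Lnorm_ge0//; first exact: ltW.
by rewrite -cE lee_fin lerDl.
Qed.

End L2.

Section trig_integral.
Context d (T : measurableType d) (R : realType) (mu : {measure set T -> \bar R}).
Implicit Types w q r : T -> R.

Lemma measurable_cos_comp q : measurable_fun setT q -> measurable_fun setT (fun x => cos (q x)).
Proof.
move=> mq; apply: (measurableT_comp (f := @cos R)) => //.
by apply: continuous_measurable_fun; exact: continuous_cos.
Qed.

Lemma norm_cos_le1 (x : R) : `|cos x| <= 1.
Proof. by rewrite ler_norml cos_geN1 cos_le1. Qed.

Lemma integrable_mul_cos w q : measurable_fun setT q ->
  mu.-integrable setT (EFin \o w) -> mu.-integrable setT (EFin \o (fun x => w x * cos (q x))).
Proof.
move=> mq iw; apply: (@integrable_dominated _ _ _ mu _ (fun x => `|w x|)).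
- by apply: measurable_funM; [exact: integrable_measurable iw|exact: measurable_cos_comp].
- by move=> x; rewrite normrM ler_piMr// norm_cos_le1.
- exact: integrable_norm.
Qed.

Lemma cosD_pihalf (x : R) : cos (x + pi / 2) = - sin x.
Proof. by rewrite cosD cos_pihalf sin_pihalf mulr0 mulr1 sub0r. Qed.

(** A derivative is kept as a cosine with phase advanced by [pi / 2], so that
    iterated derivatives stay within the same family of integrals; the phase [r]
    may depend on the point. *)
Lemma derive_integral_cos w q r : measurable_fun setT q -> measurable_fun setT r ->
  mu.-integrable setT (EFin \o w) -> mu.-integrable setT (EFin \o (fun x => w x * q x)) ->
  forall a : R, is_derive a 1 (fun t : R => \int[mu]_x (w x * cos (t * q x + r x)) : R)
    (\int[mu]_x (w x * q x * cos (a * q x + r x + pi / 2))).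
Proof.
move=> mq mr iw iwq a.
pose f (t : R) x := w x * cos (t * q x + r x).
have mtq t : measurable_fun setT (fun x => t * q x + r x).
  by apply: measurable_funD => //; exact: measurable_funM.
have df (t : R) x : is_derive t (1 : R) (f ^~ x) (w x * q x * cos (t * q x + r x + pi / 2)).
  have h : is_derive t (1 : R) (fun t : R => t * q x + r x) (q x).
    have : is_derive t (1 : R) ((id : R -> R) * cst (q x) + cst (r x)) (q x); last exact.
    by apply: is_derive_eq; rewrite /GRing.scale/= mulr0 add0r mulr1 addr0.
  have h2 : is_derive t (1 : R) (cos \o (fun t : R => t * q x + r x)) (- sin (t * q x + r x) * q x).
    exact: is_derive1_comp.
  have : is_derive t (1 : R) (w x *: (cos \o (fun t : R => t * q x + r x)))
      (w x * q x * cos (t * q x + r x + pi / 2)); last exact.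
  by apply: is_derive_eq; rewrite cosD_pihalf /GRing.scale/=; ring.
have p1 t x : partial1of2 f t x = w x * q x * cos (t * q x + r x + pi / 2).
  by rewrite partial1of2E; exact: derive_val.
have Ia : `]a - 1, a + 1[%classic a by rewrite /= in_itv/= ltrBlDr ltrDl ltr01.
have A1 t : `]a - 1, a + 1[%classic t -> mu.-integrable setT (EFin \o f t).
  by move=> _; exact: integrable_mul_cos.
have A2 t x : `]a - 1, a + 1[%classic t -> setT x -> derivable (f ^~ x) t 1.
  by move=> _ _; exact: ex_derive.
have A3 x : 0 <= `|w x * q x| by [].
have A4 : mu.-integrable setT (EFin \o (fun x => `|w x * q x|)) by exact: integrable_norm.
have A5 t x : `]a - 1, a + 1[%classic t -> setT x -> `|partial1of2 f t x| <= `|w x * q x|.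
  by move=> _ _; rewrite p1 normrM ler_piMr// norm_cos_le1.
apply: DeriveDef.
  exact: (derivable_under_integral measurableT Ia A1 A2 A3 A4 A5).
rewrite -derive1E (differentiation_under_integral measurableT Ia A1 A2 A3 A4 A5).
by apply: eq_Rintegral => x _; rewrite p1.
Qed.

End trig_integral.

Section line.
Context {R : realType}.
Local Notation mu := (@lebesgue_measure R).
Implicit Types f g F : R -> R.

Lemma continuous_measurable f : continuous f -> measurable_fun setT f.
Proof. exact: continuous_measurable_fun. Qed.

Lemma integrable_inv_1Dsqr C : mu.-integrable setT (EFin \o (fun x : R => C * (1 + x ^+ 2)^-1)).
Proof.
have cf : continuous (fun x : R => (1 + x ^+ 2)^-1).
  move=> x; apply: cvgV; first by rewrite gt_eqF// ltr_pwDl// sqr_ge0.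
  apply: cvgD; [exact: cvg_cst|exact: exprn_continuous].
have := @integrableZl _ _ _ mu setT measurableT C (EFin \o (fun x : R => (1 + x ^+ 2)^-1)).
apply.
have mf : measurable_fun setT (EFin \o (fun x : R => (1 + x ^+ 2)^-1)).
  by apply/measurable_EFinP; apply: continuous_measurable.
apply/integrableP; split => //.
have -> : (\int[mu]_x `|((1 + x ^+ 2)^-1)%:E| =
   \int[mu]_x ((1 + x ^+ 2)^-1)%:E)%E.
  by apply: eq_integral => x _ /=; rewrite ger0_norm// invr_ge0 addr_ge0// sqr_ge0.
rewrite (@ge0_symfun_integralT _ (fun x : R => (1 + x ^+ 2)^-1))//=.
- rewrite (_ : [set x | _] = `[0, +oo[%classic); last first.
    by apply/seteqP; split => x/=; rewrite in_itv/= andbT.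
  by rewrite integral0y_oneDsqr -EFinM ltry.
- by move=> x; rewrite invr_ge0 addr_ge0// sqr_ge0.
- by move=> x/=; rewrite sqrrN.
Qed.

Lemma decay_integrable f C : measurable_fun setT f ->
  (forall x, `|f x| <= C * (1 + x ^+ 2)^-1) -> mu.-integrable setT (EFin \o f).
Proof. by move=> mf fC; apply: (@integrable_dominated _ _ _ mu f _ mf fC (integrable_inv_1Dsqr C)). Qed.

Lemma cvg_Rintegral_trunc f : mu.-integrable setT (EFin \o f) ->
  \int[mu]_x (f \_ `[- n%:R, n%:R]) x @[n --> \oo] --> \int[mu]_x f x.
Proof.
move=> fi; have mf := integrable_measurable fi.
apply: fine_cvg; rewrite fineK; last exact: integrable_fin_num.
apply: (@dominated_cvg _ _ _ mu setT measurableT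
    (fun n => EFin \o (f \_ `[- n%:R, n%:R])) (EFin \o f) (EFin \o (fun x => `|f x|))).
- move=> n; apply/measurable_EFinP.
  apply/(measurable_restrictT f (@measurable_itv R `[- n%:R, n%:R])).
  exact: measurable_funTS.
- move=> x _; apply: cvg_near_cst; near=> n; rewrite /= patchE mem_set//= in_itv/=.
  by rewrite -ler_norml; near: n; exact: nbhs_infty_ger.
- by [].
- by apply: integrable_norm.
- move=> n x _; rewrite /= lee_fin patchE; case: ifP => _ //.
  by rewrite normr0.
Unshelve. all: by end_near.
Qed.

(** The fundamental theorem of calculus on [-n, n], with vanishing boundary terms. *)
Lemma integral_derive0 F f C : (forall x, is_derive x (1 : R) F (f x)) -> continuous f ->
  mu.-integrable setT (EFin \o f) ->
  (forall x, `|F x| <= C * (1 + x ^+ 2)^-1) -> \int[mu]_x f x = 0.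
Proof.
move=> dF cf fi FC.
have cF : continuous F.
  move=> x; apply: differentiable_continuous; apply/derivable1_diffP.
  exact: ex_derive.
have h1 : (\int[mu]_x (f \_ `[- n%:R, n%:R]) x) @[n --> \oo] --> \int[mu]_x f x.
  exact: cvg_Rintegral_trunc.
have h2 n : (0 < n)%N -> \int[mu]_x (f \_ `[- n%:R, n%:R]) x = F n%:R - F (- n%:R).
  move=> n0; rewrite -Rintegral_mkcond /Rintegral (@continuous_FTC2 _ f F)//.
  - by rewrite gtrN// ltr0n.
  - exact: continuous_subspaceT.
  - split => [x _||]; first exact: ex_derive.
      by apply: cvg_at_right_filter; exact: cF.
    by apply: cvg_at_left_filter; exact: cF.
  - by move=> x _; rewrite derive1E; exact: derive_val.
apply: (cvg_unique _ h1) => //.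
apply/cvgrPdist_le => e e0.
have C0 : 0 <= C by have := FC 0; rewrite expr0n addr0 invr1 mulr1; exact: le_trans.
near=> n; rewrite h2; last by near: n; exists 1%N.
rewrite sub0r normrN (le_trans (ler_normB _ _))// (le_trans (lerD (FC _) (FC _)))//.
rewrite sqrrN -mulrDl ler_pdivrMr ?ltr_pwDl ?sqr_ge0//.
have hn : (C + C) / e <= n%:R by near: n; exact: nbhs_infty_ger.
rewrite ler_pdivrMr// in hn; apply: le_trans hn _.
rewrite mulrC ler_wpM2l ?(ltW e0)//.
have n0 : (0:R) <= n%:R by [].
have n1 : (1:R) <= n%:R by rewrite ler1n; near: n; exists 1%N.
by rewrite expr2; nra.
Unshelve. all: by end_near. Qed.

End line.

Section schwartz_integrals.
Context {R : realType}.
Local Notation mu := (@lebesgue_measure R).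
Implicit Types s t : schwartz R.

Lemma schwartzP s : smooth s /\ rapidly_decreasing s.
Proof. by have := schwartz_valP s; rewrite inE. Qed.

Lemma schwartz_continuous_fun s : continuous s.
Proof.
move=> x; apply: differentiable_continuous; apply/derivable1_diffP.
exact: (schwartzP s).1 0%N x.
Qed.

Lemma schwartz_measurable s : measurable_fun setT s.
Proof. by apply: continuous_measurable; exact: schwartz_continuous_fun. Qed.

Lemma schwartz_bounded s : exists C : R, forall x, `|s x| <= C.
Proof. by have [C hC] := (schwartzP s).2 0%N 0%N; exists C => x; have := hC x; rewrite mul1r. Qed.

Lemma schwartz_decay s : exists C : R, forall x, `|s x| <= C * (1 + x ^+ 2)^-1.
Proof.
have [C hC] := schwartz_bounded s; have [D hD] := (schwartzP s).2 2%N 0%N.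
exists (C + D) => x; rewrite ler_pdivlMr ?ltr_pwDl ?sqr_ge0// mulrDr mulr1 lerD//.
by have := hD x; rewrite normrM mulrC (@ger0_norm _ (x ^+ 2)) ?sqr_ge0.
Qed.

Lemma schwartz_integrable s : mu.-integrable setT (EFin \o s).
Proof.
have [C hC] := schwartz_decay s; apply: decay_integrable hC; exact: schwartz_measurable.
Qed.

Lemma schwartz_mul_integrable s t : mu.-integrable setT (EFin \o (s \* t)).
Proof.
have [C hC] := schwartz_bounded s; have [D hD] := schwartz_decay t.
apply: (@decay_integrable _ _ (C * D)).
  by apply: measurable_funM; exact: schwartz_measurable.
by move=> x /=; rewrite normrM -mulrA ler_pM.
Qed.

Lemma schwartz_Lfun2 s : (s : R -> R) \in Lfun mu 2%:E.
Proof.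
apply: Lfun2I; first exact: schwartz_measurable.
by have := schwartz_mul_integrable s s.
Qed.

End schwartz_integrals.

(** * Hermite functions and their Fourier transforms *)

Section hermite_functions.
Context {R : realType}.
Local Notation mu := (@lebesgue_measure R).
Local Notation h := (hermite_fun R).
Local Notation sq2 := (Num.sqrt (2 : R)).

Lemma deriv_hermite n : (hermite R n.+1)^`() = n.+1%:R *: hermite R n.
Proof.
elim: n => [|n IH].
  by rewrite /= derivB derivM derivX !derivC mulr0 addr0 mul1r subr0 scale1r.
have -> : hermite R n.+2 = 'X * hermite R n.+1 - (hermite R n.+1)^`() by [].
rewrite derivB derivM derivX mul1r IH derivZ.
have -> : 'X * (n.+1%:R *: hermite R n) = n.+1%:R *: (hermite R n.+1 + (hermite R n)^`()).
  by rewrite /= subrK scalerAr.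
by rewrite scalerDr addrA addrK -[n.+2%:R]natr1 scalerDl scale1r addrC.
Qed.

Lemma sq2K : sq2 * sq2 = 2.
Proof. by rewrite -expr2 sqr_sqrtr. Qed.

Lemma sq2_neq0 : sq2 != 0.
Proof. by rewrite gt_eqF// sqrtr_gt0. Qed.

Definition hcoef (k : nat) : R := pi `^ (- 4^-1) * (Num.sqrt (k`!%:R))^-1.

Lemma hcoefS k : hcoef k = Num.sqrt k.+1%:R * hcoef k.+1.
Proof.
rewrite /hcoef factS natrM sqrtrM// invfM.
have s0 : Num.sqrt k.+1%:R != 0 :> R by rewrite gt_eqF// sqrtr_gt0.
by rewrite [RHS]mulrCA mulVKf.
Qed.

Lemma hermite_fun0 x : h 0 x = pi `^ (- 4^-1) * expR (- x ^+ 2 / 2).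
Proof. by rewrite /hermite_fun /= hornerE fact0 sqrtr1 invr1 !mulr1. Qed.

Lemma hermite_funE k x :
  h k x = hcoef k * expR (- x ^+ 2 / 2) * (hermite R k).[sq2 * x].
Proof. by []. Qed.

Lemma is_derive_hermite_fun_aux k x : is_derive x (1 : R) (h k)
  (hcoef k * expR (- x ^+ 2 / 2) * (sq2 * (hermite R k)^`().[sq2 * x] - x * (hermite R k).[sq2 * x])).
Proof.
have -> : h k = hcoef k *: gauss_poly (hermite R k \Po (sq2 *: 'X)).
  apply/funext => y; rewrite fctE hermite_funE /gauss_poly horner_comp.
  by rewrite hornerZ hornerX /GRing.scale/= -mulrA [expR _ * _]mulrC.
have d := is_derive_gauss_poly (hermite R k \Po (sq2 *: 'X)) x.
apply: is_derive_eq.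
rewrite /gauss_poly deriv_comp derivZ derivX /GRing.scale/=.
rewrite !(hornerD, hornerN, hornerM, hornerX, horner_comp, hornerZ, hornerC).
by ring.
Qed.

(** Up to scaling, [x - d/dx] is the raising operator of the family. *)
Lemma is_derive_hermite_fun k x : is_derive x (1 : R) (h k)
  (x * h k x - sq2 * Num.sqrt k.+1%:R * h k.+1 x).
Proof.
have d := is_derive_hermite_fun_aux k x; apply: is_derive_eq.
rewrite [in RHS]hermite_funE hermite_funE [in LHS]hcoefS.
have -> : sq2 * Num.sqrt k.+1%:R * (hcoef k.+1 * expR (- x ^+ 2 / 2) * (hermite R k.+1).[sq2 * x])
  = sq2 * (Num.sqrt k.+1%:R * hcoef k.+1) * expR (- x ^+ 2 / 2) * (hermite R k.+1).[sq2 * x].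
  by ring.
rewrite -hcoefS /= hornerD hornerN hornerM hornerX.
have -> : sq2 * hcoef k * expR (- x ^+ 2 / 2) *
   (sq2 * x * (hermite R k).[sq2 * x] - (hermite R k)^`().[sq2 * x]) =
   hcoef k * expR (- x ^+ 2 / 2) *
   (sq2 * sq2 * x * (hermite R k).[sq2 * x] - sq2 * (hermite R k)^`().[sq2 * x]) by ring.
by rewrite sq2K; ring.
Qed.

Lemma hermite_fun_rec k x :
  sq2 * x * h k.+1 x = Num.sqrt k.+2%:R * h k.+2 x + Num.sqrt k.+1%:R * h k x.
Proof.
rewrite !hermite_funE.
have -> : Num.sqrt k.+2%:R * (hcoef k.+2 * expR (- x ^+ 2 / 2) * (hermite R k.+2).[sq2 * x]) =
  hcoef k.+1 * expR (- x ^+ 2 / 2) * (hermite R k.+2).[sq2 * x].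
  by rewrite [in RHS]hcoefS; ring.
have -> : hermite R k.+2 = 'X * hermite R k.+1 - (hermite R k.+1)^`() by [].
have -> : ('X * hermite R k.+1 - (hermite R k.+1)^`()).[sq2 * x] =
  sq2 * x * (hermite R k.+1).[sq2 * x] - k.+1%:R * (hermite R k).[sq2 * x].
  by rewrite deriv_hermite hornerD hornerN hornerM hornerX hornerZ.
rewrite (hcoefS k).
have s2 : Num.sqrt k.+1%:R * Num.sqrt k.+1%:R = k.+1%:R :> R by rewrite -expr2 sqr_sqrtr.
rewrite -[in X in _ = X + _]s2; ring.
Qed.

Lemma hermite_fun_rec0 x : sq2 * x * h 0 x = h 1 x.
Proof.
rewrite !hermite_funE (hcoefS 0) sqrtr1 mul1r.
have -> : (hermite R 0).[sq2 * x] = 1 by rewrite /= hornerE.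
have -> : (hermite R 1).[sq2 * x] = sq2 * x by rewrite /= derivC subr0 mulr1 hornerX.
by ring.
Qed.

Lemma hermite_fun_integrable k : mu.-integrable setT (EFin \o h k).
Proof. exact: (schwartz_integrable (hermite_schwartz R k)). Qed.

Lemma hermite_fun_measurable k : measurable_fun setT (h k).
Proof. exact: (schwartz_measurable (hermite_schwartz R k)). Qed.

Lemma hermite_fun_continuous k : continuous (h k).
Proof. by move=> x; exact: (@schwartz_continuous_fun R (hermite_schwartz R k) x). Qed.

Lemma hermite_fun_mul_integrable j k :
  mu.-integrable setT (EFin \o (fun x => h j x * h k x)).
Proof. exact: (schwartz_mul_integrable (hermite_schwartz R j) (hermite_schwartz R k)). Qed.

Lemma lowerE k x : x * h k x + (x * h k x - sq2 * Num.sqrt k.+1%:R * h k.+1 x) =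
  if k is k'.+1 then sq2 * Num.sqrt k%:R * h k' x else 0.
Proof.
have e2 j : x * h j x = sq2 * (sq2 * x * h j x) / 2 by rewrite !mulrA sq2K; field.
case: k => [|k].
  by rewrite e2 hermite_fun_rec0 sqrtr1; field.
by rewrite e2 hermite_fun_rec; field.
Qed.

(** The integral of the derivative of [h j * h k] vanishes; the raising operator
    acts on the first factor and the lowering operator on the second. *)
Lemma hermite_fun_ibp j k :
  Num.sqrt j.+1%:R * \int[mu]_x (h j.+1 x * h k x) =
  if k is k'.+1 then Num.sqrt k%:R * \int[mu]_x (h j x * h k' x) else 0.
Proof.
pose g x := (x * h j x - sq2 * Num.sqrt j.+1%:R * h j.+1 x) * h k x +
            h j x * (x * h k x - sq2 * Num.sqrt k.+1%:R * h k.+1 x).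
have gE x : g x = (if k is k'.+1 then sq2 * Num.sqrt k%:R * (h j x * h k' x) else 0) -
   sq2 * Num.sqrt j.+1%:R * (h j.+1 x * h k x).
  transitivity (h j x * (x * h k x + (x * h k x - sq2 * Num.sqrt k.+1%:R * h k.+1 x)) -
    sq2 * Num.sqrt j.+1%:R * (h j.+1 x * h k x)); first by rewrite /g; ring.
  by rewrite lowerE; case: (k) => [|k']; ring.
have gi : mu.-integrable setT (EFin \o (fun x => if k is k'.+1 then sq2 * Num.sqrt k%:R * (h j x * h k' x) else 0)).
  case: (k) => [|k']; first exact: integrable0.
  exact: (integrableZl measurableT _ (hermite_fun_mul_integrable j k')).
have gi' : mu.-integrable setT (EFin \o (fun x => sq2 * Num.sqrt j.+1%:R * (h j.+1 x * h k x))).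
  exact: (integrableZl measurableT _ (hermite_fun_mul_integrable _ _)).
have dg x : is_derive x (1 : R) (fun x => h j x * h k x) (g x).
  have d1 := is_derive_hermite_fun j x; have d2 := is_derive_hermite_fun k x.
  have : is_derive x (1 : R) (h j * h k) (g x); last exact.
  by apply: is_derive_eq; rewrite /g /GRing.scale/=; ring.
have [C hC] := schwartz_decay (hermite_schwartz R k).
have [D hD] := schwartz_bounded (hermite_schwartz R j).
have g0 : \int[mu]_x g x = 0.
  apply: (@integral_derive0 _ (fun x => h j x * h k x) g (D * C)) => //.
  - have ch := hermite_fun_continuous.
    rewrite /g => x; apply: cvgD; apply: cvgM => //; try exact: ch.
      apply: cvgB; apply: cvgM; try exact: ch; [exact: cvg_id|exact: cvg_cst].
    apply: cvgB; apply: cvgM; try exact: ch; [exact: cvg_id|exact: cvg_cst].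
  - rewrite (_ : g = fun x => (if k is k'.+1 then sq2 * Num.sqrt k%:R * (h j x * h k' x) else 0) -
   sq2 * Num.sqrt j.+1%:R * (h j.+1 x * h k x)); last exact/funext.
    exact: (integrableB measurableT gi gi').
  - by move=> x; rewrite normrM -mulrA ler_pM//; [exact: hD|exact: hC].
have := g0; rewrite (funext gE) RintegralB// => /eqP; rewrite subr_eq0 => /eqP E.
apply: (mulfI sq2_neq0); rewrite mulrA -RintegralZl ?hermite_fun_mul_integrable// -E.
case: (k) => [|k']; first by rewrite mulr0 /Rintegral integral0.
by rewrite mulrA -RintegralZl ?hermite_fun_mul_integrable.
Qed.

Lemma int_hermite_fun0_sqr : \int[mu]_x (h 0 x * h 0 x) = 1.
Proof.
transitivity (\int[mu]_x ((Num.sqrt pi)^-1 * gauss_fun x)).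
  apply: eq_Rintegral => x _; rewrite !hermite_fun0 mulrACA -powRD; last first.
    by apply/implyP => _; rewrite gt_eqF ?pi_gt0.
  rewrite -expRD /gauss_fun; congr (_ * expR _); last by field.
  have -> : - 4^-1 - 4^-1 = - 2^-1 :> R by field.
  by rewrite powRN powR12_sqrt ?pi_ge0.
rewrite RintegralZl//; last exact: integrableT_gauss.
rewrite /Rintegral integralT_gauss/= mulVf// gt_eqF// sqrtr_gt0 pi_gt0//.
Qed.

Lemma hermite_fun_orthonormal j k : \int[mu]_x (h j x * h k x) = (j == k)%:R.
Proof.
have sn n : Num.sqrt n.+1%:R != 0 :> R by rewrite gt_eqF// sqrtr_gt0.
elim: j k => [|j IH] [|k]; first exact: int_hermite_fun0_sqr.
- have := hermite_fun_ibp k 0.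
  rewrite (_ : \int[mu]_x (h k.+1 x * h 0 x) = \int[mu]_x (h 0 x * h k.+1 x)); last first.
    by apply: eq_Rintegral => x _; rewrite mulrC.
  by move/eqP; rewrite mulf_eq0 (negbTE (sn k))/= => /eqP.
- by have := hermite_fun_ibp j 0 => /eqP; rewrite mulf_eq0 (negbTE (sn j))/= => /eqP.
have := hermite_fun_ibp j k.+1; rewrite IH eqSS.
case: eqP => [->|_].
  by move/(mulfI (sn k)).
by rewrite mulr0 => /eqP; rewrite mulf_eq0 (negbTE (sn j))/= => /eqP.
Qed.

Lemma hermite_fun_recE k x :
  sq2 * x * h k x = Num.sqrt k.+1%:R * h k.+1 x + Num.sqrt k%:R * h k.-1 x.
Proof.
case: k => [|k]; last exact: hermite_fun_rec.
by rewrite hermite_fun_rec0 sqrtr0 sqrtr1 mul0r addr0 mul1r.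
Qed.

(** The three-term recursion and [(a + b)^2 <= 2 (a^2 + b^2)]. *)
Lemma sqr_mulx_hermite_fun_le k x :
  (x * h k x) ^+ 2 <= k.+1%:R * h k.+1 x ^+ 2 + k%:R * h k.-1 x ^+ 2.
Proof.
have := hermite_fun_recE k x.
have := @sqr_sqrtr R k.+1%:R (ler0n _ _); have := @sqr_sqrtr R k%:R (ler0n _ _).
move: (h k x) (h k.+1 x) (h k.-1 x) => y u v.
move: (Num.sqrt k%:R) (Num.sqrt k.+1%:R) => a b <- <- e.
have -> : (x * y) ^+ 2 = (sq2 * x * y) ^+ 2 / 2.
  have -> : (sq2 * x * y) ^+ 2 = sq2 * sq2 * (x * y) ^+ 2 by ring.
  by rewrite sq2K; field.
rewrite e ler_pdivrMr// -subr_ge0.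
have -> : (b ^+ 2 * u ^+ 2 + a ^+ 2 * v ^+ 2) * 2 - (b * u + a * v) ^+ 2 = (b * u - a * v) ^+ 2.
  by ring.
exact: sqr_ge0.
Qed.

Lemma pow_hermite_integrable n j k :
  mu.-integrable setT (EFin \o (fun x => x ^+ n * (h j x * h k x))).
Proof.
have [C hC] := (schwartzP (hermite_schwartz R j)).2 n 0%N.
apply: (@integrable_dominated _ _ _ mu _ (fun x => C * `|h k x|)).
- apply: measurable_funM; last by apply: measurable_funM; exact: hermite_fun_measurable.
  by apply: continuous_measurable; exact: exprn_continuous.
- by move=> x; rewrite mulrA normrM ler_wpM2r//; exact: hC.
- exact: (integrableZl measurableT _ (integrable_norm (hermite_fun_integrable k))).
Qed.

Lemma sqr_hermite_integrable n k :
  mu.-integrable setT (EFin \o (fun x => x ^+ n * h k x ^+ 2)).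
Proof.
rewrite (_ : (fun x => x ^+ n * h k x ^+ 2) = (fun x => x ^+ n * (h k x * h k x))).
  exact: pow_hermite_integrable.
by apply/funext => x; rewrite expr2.
Qed.

(** Each factor [x ^+ 2] costs a factor of order [k] and a shift of the index by one. *)
Lemma int_weight_le n k (M N : R) :
  \int[mu]_x (x ^+ n.*2 * h k.+1 x ^+ 2) <= M -> \int[mu]_x (x ^+ n.*2 * h k.-1 x ^+ 2) <= N ->
  \int[mu]_x (x ^+ n.+1.*2 * h k x ^+ 2) <= k.+1%:R * M + k%:R * N.
Proof.
move=> hM hN.
apply: (@le_trans _ _ (\int[mu]_x (k.+1%:R * (x ^+ n.*2 * h k.+1 x ^+ 2) +
    k%:R * (x ^+ n.*2 * h k.-1 x ^+ 2)))); last first.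
  rewrite RintegralD//; last 2 first.
  - exact: (integrableZl measurableT _ (sqr_hermite_integrable _ _)).
  - exact: (integrableZl measurableT _ (sqr_hermite_integrable _ _)).
  rewrite !RintegralZl//; [|exact: sqr_hermite_integrable|exact: sqr_hermite_integrable].
  by rewrite lerD// ler_wpM2l.
apply: le_Rintegral => //.
- exact: sqr_hermite_integrable.
- exact: (integrableD measurableT (integrableZl measurableT k.+1%:R (sqr_hermite_integrable _ _))
    (integrableZl measurableT k%:R (sqr_hermite_integrable _ _))).
move=> x _; rewrite doubleS (exprS x n.*2.+1) (exprS x n.*2).
have -> : x * (x * x ^+ n.*2) * h k x ^+ 2 = x ^+ n.*2 * (x * h k x) ^+ 2 by ring.
have -> : k.+1%:R * (x ^+ n.*2 * h k.+1 x ^+ 2) + k%:R * (x ^+ n.*2 * h k.-1 x ^+ 2) =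
  x ^+ n.*2 * (k.+1%:R * h k.+1 x ^+ 2 + k%:R * h k.-1 x ^+ 2) by ring.
by rewrite ler_wpM2l ?sqr_mulx_hermite_fun_le// -mul2n exprM exprn_ge0// sqr_ge0.
Qed.

Lemma int_weight0 k : \int[mu]_x (x ^+ 0.*2 * h k x ^+ 2) = 1.
Proof.
rewrite -[RHS]/(true%:R) -(eqxx k) -hermite_fun_orthonormal.
by apply: eq_Rintegral => x _; rewrite mul1r expr2.
Qed.

Lemma int_weight1_le k : \int[mu]_x (x ^+ 1.*2 * h k x ^+ 2) <= (2 * k + 1)%:R.
Proof.
have := @int_weight_le 0 k 1 1; rewrite !int_weight0 !lexx => /(_ isT isT) h1.
by apply: le_trans h1 _; rewrite !mulr1 -natrD ler_nat addSn addnn -mul2n addn1.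
Qed.

(** The weight is a combination of [1], [x ^+ 2] and [x ^+ 4], so two applications of
    the previous estimate suffice; the growth in [k] is thus quadratic. *)
Lemma int_hermite_fun_weight_le k :
  \int[mu]_x ((1 + x ^+ 2) ^+ 2 * h k x ^+ 2) <= 9 * k.+1%:R ^+ 2.
Proof.
have w2 : \int[mu]_x (x ^+ 2.*2 * h k x ^+ 2) <= k.+1%:R * (2 * k.+1 + 1)%:R + k%:R * (2 * k + 1)%:R.
  apply: le_trans (int_weight_le (int_weight1_le k.+1) (int_weight1_le k.-1)) _.
  by rewrite lerD2l ler_wpM2l// ler_nat leq_add2r leq_mul2l leq_pred.
have -> : \int[mu]_x ((1 + x ^+ 2) ^+ 2 * h k x ^+ 2) =
  \int[mu]_x (x ^+ 0.*2 * h k x ^+ 2) + 2 * \int[mu]_x (x ^+ 1.*2 * h k x ^+ 2) +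
  \int[mu]_x (x ^+ 2.*2 * h k x ^+ 2).
  have i n := sqr_hermite_integrable n k.
  have i2 : mu.-integrable setT (EFin \o (fun x => 2 * (x ^+ 1.*2 * h k x ^+ 2))).
    exact: (integrableZl measurableT _ (i _)).
  have i3 := integrableD measurableT (i 0.*2) i2.
  rewrite -RintegralZl// -RintegralD// -RintegralD//.
  by apply: eq_Rintegral => x _; rewrite /= !exprS expr0; ring.
rewrite int_weight0.
apply: le_trans (lerD (lerD (lexx _) (ler_wpM2l _ (int_weight1_le k))) w2) _ => //.
rewrite !(natrD, natrM) -!natr1.
have : (0 : R) <= k%:R by [].
move: (k%:R) => y y0; nra.
Qed.

Lemma int_hermite_fun0 : \int[mu]_x h 0 x = Num.sqrt (2 * pi) * h 0 0.
Proof.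
have hE x : h 0 x = Num.sqrt (2 * pi) * h 0 0 * normal_pdf 0 1 x.
  rewrite normal_pdfE ?oner_neq0// /normal_peak /normal_fun !hermite_fun0.
  rewrite subr0 expr1n mul1r expr0n/= oppr0 mul0r expR0 mulr1 -[pi *+ 2]mulr_natl.
  rewrite mulrACA mulfV ?mul1r// gt_eqF// sqrtr_gt0 mulr_gt0// pi_gt0//.
rewrite (_ : \int[mu]_x h 0 x = \int[mu]_x (Num.sqrt (2 * pi) * h 0 0 * normal_pdf 0 1 x)).
  rewrite RintegralZl//; last exact: integrable_normal_pdf.
  by rewrite /Rintegral integral_normal_pdf/= mulr1.
by apply: eq_Rintegral => x _; exact: hE.
Qed.

Section fourier_transform.

Let A k (u c : R) : R := \int[mu]_x (h k x * cos (u * x + c)).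

Lemma mulx_hermite_integrable k : mu.-integrable setT (EFin \o (fun x => h k x * x)).
Proof.
have [C hC] := (schwartzP (hermite_schwartz R k)).2 3%N 0%N.
have [D hD] := (schwartzP (hermite_schwartz R k)).2 1%N 0%N.
apply: (@decay_integrable _ _ (D + C)).
  apply: measurable_funM; [exact: hermite_fun_measurable|exact: measurable_id].
move=> x; rewrite ler_pdivlMr ?ltr_pwDl ?sqr_ge0// mulrDr mulr1 lerD//.
  by have := hD x; rewrite expr1 mulrC.
have {}hC : `|x ^+ 3 * h k x| <= C by exact: hC.
apply: le_trans hC; rewrite -(@ger0_norm _ (x ^+ 2)) ?sqr_ge0// -normrM.
by rewrite (_ : h k x * x * x ^+ 2 = x ^+ 3 * h k x)//; ring.
Qed.

Lemma is_derive_A k c u : is_derive u (1 : R) (fun u => A k u c)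
  (\int[mu]_x (h k x * x * cos (u * x + (c + pi / 2)))).
Proof.
have := @derive_integral_cos _ _ R mu (h k) id (cst c) _ _ _ _ u.
have -> : \int[mu]_x (h k x * id x * cos (u * id x + cst c x + pi / 2)) =
  \int[mu]_x (h k x * x * cos (u * x + (c + pi / 2))).
  by apply: eq_Rintegral => x _; rewrite /= addrA.
apply; [exact: measurable_id|exact: measurable_cst|exact: hermite_fun_integrable|].
exact: mulx_hermite_integrable.
Qed.

(** Integration by parts, with the raising operator producing [h k.+1]. *)
Lemma A_raise k u c : sq2 * Num.sqrt k.+1%:R * A k.+1 u c =
  \int[mu]_x (h k x * x * cos (u * x + c)) + u * A k u (c + pi / 2).
Proof.
pose dh x := x * h k x - sq2 * Num.sqrt k.+1%:R * h k.+1 x.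
pose g x := dh x * cos (u * x + c) + h k x * (u * cos (u * x + (c + pi / 2))).
have mc v : measurable_fun setT (fun x : R => u * x + v).
  by apply: measurable_funD => //; apply: measurable_funM.
have i1 : mu.-integrable setT (EFin \o (fun x => h k x * x * cos (u * x + c))).
  by apply: integrable_mul_cos; [exact: mc|exact: mulx_hermite_integrable].
have i2 j v : mu.-integrable setT (EFin \o (fun x => h j x * cos (u * x + v))).
  by apply: integrable_mul_cos; [exact: mc|exact: hermite_fun_integrable].
have i3 := integrableZl measurableT u (i2 k (c + pi / 2)).
have i4 := integrableZl measurableT (sq2 * Num.sqrt k.+1%:R) (i2 k.+1 c).
have gE x : g x = h k x * x * cos (u * x + c) + u * (h k x * cos (u * x + (c + pi / 2))) -
  sq2 * Num.sqrt k.+1%:R * (h k.+1 x * cos (u * x + c)) by rewrite /g /dh; ring.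
have i13 := integrableD measurableT i1 i3.
have gi : mu.-integrable setT (EFin \o g).
  by rewrite (funext gE); exact: (integrableB measurableT i13 i4).
have dg x : is_derive x (1 : R) (fun x => h k x * cos (u * x + c)) (g x).
  have d1 := is_derive_hermite_fun k x.
  have d0 : is_derive x (1 : R) (fun x : R => u * x + c) u.
    have : is_derive x (1 : R) (cst u * (id : R -> R) + cst c) u; last exact.
    by apply: is_derive_eq; rewrite /GRing.scale/= mulr0 addr0 mulr1 addr0.
  have d2 : is_derive x (1 : R) (cos \o (fun x : R => u * x + c)) (- sin (u * x + c) * u).
    exact: is_derive1_comp.
  have : is_derive x (1 : R) (h k * (cos \o (fun x : R => u * x + c))) (g x); last exact.
  by apply: is_derive_eq; rewrite /g /dh addrA cosD_pihalf /GRing.scale/=; ring.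
have [C hC] := schwartz_decay (hermite_schwartz R k).
have g0 : \int[mu]_x g x = 0.
  apply: (@integral_derive0 _ _ g C dg) => //.
  - have ch := hermite_fun_continuous.
    have cc v : continuous (fun x : R => cos (u * x + v)).
      move=> x; apply: (@continuous_comp _ _ _ (fun x : R => u * x + v) cos); last exact: continuous_cos.
      by apply: cvgD; [apply: cvgM; [exact: cvg_cst|exact: cvg_id]|exact: cvg_cst].
    rewrite /g /dh => x; apply: cvgD; apply: cvgM; try exact: ch; try exact: cc.
      apply: cvgB; apply: cvgM; try exact: ch; [exact: cvg_id|exact: cvg_cst].
    apply: cvgM; [exact: cvg_cst|exact: cc].
  - move=> x; rewrite normrM; apply: le_trans (hC x).
    by rewrite ler_piMr// norm_cos_le1.
have := g0; rewrite (funext gE) RintegralB// => /eqP; rewrite subr_eq0 RintegralD//.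
by rewrite RintegralZl// RintegralZl// => /eqP.
Qed.

(** Hermite functions are eigenfunctions of the Fourier transform, with eigenvalue
    [sqrt (2 pi) (-i)^k]; the phase [c] encodes real and imaginary part at once.
    The Gaussian case solves [A' = - v A]; the induction step follows because both
    sides are raised by the same operator. *)
Lemma hermite_fun_fourier k u c :
  A k u c = Num.sqrt (2 * pi) * h k u * cos (c + k%:R * (pi / 2)).
Proof.
elim: k u c => [|k IH] u c.
  rewrite mul0r addr0.
  have dA v : is_derive v (1 : R) (fun u => A 0 u c) (- v * A 0 v c).
    have d := is_derive_A 0 c v; apply: is_derive_eq.
    have := A_raise 0 v (c + pi / 2).
    set I := (X in _ = X + _ -> _).
    have -> : sq2 * Num.sqrt 1%:R * A 1 v (c + pi / 2) = 2 * I.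
      rewrite sqrtr1 mulr1 /A /I -!RintegralZl//.
      - by apply: eq_Rintegral => x _; rewrite -hermite_fun_rec0 !mulrA sq2K; ring.
      - apply: integrable_mul_cos; last exact: mulx_hermite_integrable.
        by apply: measurable_funD => //; apply: measurable_funM.
      - apply: integrable_mul_cos; last exact: hermite_fun_integrable.
        by apply: measurable_funD => //; apply: measurable_funM.
    have -> : A 0 v (c + pi / 2 + pi / 2) = - A 0 v c.
      rewrite /A -mulN1r -RintegralZl//.
        apply: eq_Rintegral => x _; rewrite -addrA -splitr addrA cosDpi; ring.
      apply: integrable_mul_cos; last exact: hermite_fun_integrable.
      by apply: measurable_funD => //; apply: measurable_funM.
    by move=> E; rewrite -/I; apply: (@addrI _ I); rewrite mulNr -mulrN -E; ring.
  have dE v : is_derive v (1 : R) (expR \o (2^-1 *: ((id : R -> R) * id))) (expR (2^-1 * (v * v)) * v).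
    have d : is_derive v (1 : R) (2^-1 *: ((id : R -> R) * id)) v.
      by apply: is_derive_eq; rewrite /GRing.scale/=; field.
    exact: is_derive1_comp.
  (* The product of [A 0] with [exp (u^2 / 2)] has zero derivative. *)
  have := @is_derive_0_is_cst R ((fun u => A 0 u c) * (expR \o (2^-1 *: ((id : R -> R) * id)))) u 0.
  have E0 : A 0 0 c = Num.sqrt (2 * pi) * h 0 0 * cos c.
    rewrite /A -int_hermite_fun0 -RintegralZr//; last exact: hermite_fun_integrable.
    by apply: eq_Rintegral => x _; rewrite mul0r add0r.
  have hu : h 0 0 = h 0 u * expR (2^-1 * (u * u)).
    rewrite !hermite_fun0 -mulrA -expRD expr0n/= oppr0 mul0r; congr (_ * expR _).
    by field.
  rewrite !fctE /= /GRing.scale/= !mulr0 expR0 mulr1 E0 hu => h0.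
  have e0 : expR (2^-1 * (u * u)) != 0 by rewrite gt_eqF// expR_gt0.
  apply: (mulIf e0).
  have dz v : is_derive v (1 : R) ((fun u => A 0 u c) * (expR \o (2^-1 *: ((id : R -> R) * id)))) 0.
    by apply: is_derive_eq; rewrite /GRing.scale/= /GRing.scale/=; ring.
  by have {}h0 := h0 dz; rewrite h0; ring.
have s0 : sq2 * Num.sqrt k.+1%:R != 0 by rewrite mulf_neq0 ?sq2_neq0// gt_eqF// sqrtr_gt0.
apply: (mulfI s0); rewrite A_raise IH.
have d1 := is_derive_A k (c - pi / 2) u.
have d2 := is_derive_hermite_fun k u.
pose th := c - pi / 2 + k%:R * (pi / 2).
have d3 : is_derive u (1 : R) (fun u => A k u (c - pi / 2))
   (Num.sqrt (2 * pi) * cos th * (u * h k u - sq2 * Num.sqrt k.+1%:R * h k.+1 u)).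
  rewrite (_ : (fun u => A k u (c - pi / 2)) = (Num.sqrt (2 * pi) * cos th) *: h k).
    exact: is_derive_eq.
  by apply/funext => v; rewrite IH fctE /GRing.scale/= -/th; ring.
have := @derive_val _ _ _ _ _ _ _ d1; rewrite (@derive_val _ _ _ _ _ _ _ d3) subrK => <-.
have -> : c + pi / 2 + k%:R * (pi / 2) = th + pi by rewrite /th; field.
have -> : c + k.+1%:R * (pi / 2) = th + pi by rewrite /th -natr1; field.
by rewrite cosDpi; ring.
Qed.

End fourier_transform.

End hermite_functions.

(** * Exchange of integrals *)

Section fubini_kernel.
Context d1 d2 (T1 : measurableType d1) (T2 : measurableType d2) (R : realType).
Context (m1 : {sigma_finite_measure set T1 -> \bar R}).
Context (m2 : {sigma_finite_measure set T2 -> \bar R}).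

(** A bounded kernel keeps the integrand dominated by a product of integrable
    functions. *)
Lemma Fubini_kernel (f : T1 -> R) (g : T2 -> R) (c : T1 * T2 -> R) :
  m1.-integrable setT (EFin \o f) -> m2.-integrable setT (EFin \o g) ->
  measurable_fun setT c -> (forall z, `|c z| <= 1) ->
  \int[m1]_x (f x * \int[m2]_y (g y * c (x, y))) =
  \int[m2]_y (g y * \int[m1]_x (f x * c (x, y))).
Proof.
move=> fi gi mc c1.
have mf := integrable_measurable fi; have mg := integrable_measurable gi.
pose F (z : T1 * T2) : \bar R := (f z.1 * g z.2 * c z)%:E.
have mF : measurable_fun setT F.
  apply/measurable_EFinP; apply: measurable_funM => //; apply: measurable_funM.
    exact: (measurableT_comp mf measurable_fst).
  exact: (measurableT_comp mg measurable_snd).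
have cx x : measurable_fun setT (fun y => c (x, y)).
  exact: (measurableT_comp mc (measurable_pair1 x)).
have cy y : measurable_fun setT (fun x => c (x, y)).
  exact: (measurableT_comp mc (measurable_pair2 y)).
have gci x : m2.-integrable setT (EFin \o (fun y => g y * c (x, y))).
  apply: (@integrable_dominated _ _ _ m2 _ (fun y => `|g y|)).
  - exact: measurable_funM.
  - by move=> y; rewrite normrM ler_piMr.
  - exact: integrable_norm.
have fci y : m1.-integrable setT (EFin \o (fun x => f x * c (x, y))).
  apply: (@integrable_dominated _ _ _ m1 _ (fun x => `|f x|)).
  - exact: measurable_funM.
  - by move=> x; rewrite normrM ler_piMr.
  - exact: integrable_norm.
have iF : (m1 \x m2)%E.-integrable setT F.
  apply/integrable12ltyP => //.
  pose K := \int[m2]_y `|g y|.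
  have K0 : 0 <= K by exact: Rintegral_ge0.
  have KE : K%:E = (\int[m2]_y `|g y|%:E)%E.
    by rewrite fineK//; exact: (integrable_fin_num measurableT (integrable_norm gi)).
  apply: (@le_lt_trans _ _ (\int[m1]_x (K * `|f x|)%:E)%E); last first.
    have /integrableP[_] := integrableZl measurableT K (integrable_norm fi).
    apply: le_lt_trans; rewrite le_eqVlt; apply/orP; left; apply/eqP.
    by apply: eq_integral => x _; rewrite /= normrM normr_id (ger0_norm K0).
  apply: ge0_le_integral => //.
  - by move=> x _; apply: integral_ge0.
  - by apply: (measurable_fun_fubini_tonelli_F (fun z => `|F z|%E)) => //; exact: measurableT_comp.
  - by apply/measurable_EFinP; apply: measurable_funM => //; exact: measurableT_comp.
  - move=> x _; rewrite /F/= mulrC EFinM KE -ge0_integralZl_EFin//; last first.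
      by apply/measurable_EFinP; exact: measurableT_comp.
    apply: ge0_le_integral => //.
    + apply/measurable_EFinP; apply: measurableT_comp => //.
      by apply: measurable_funM => //; exact: measurable_funM.
    + by apply/measurable_EFinP; apply: measurable_funM => //; exact: measurableT_comp.
    + by move=> y _; rewrite -EFinM lee_fin !normrM ler_piMr// mulr_ge0.
have := Fubini iF; rewrite /F/= => E.
transitivity (fine (\int[m1]_x \int[m2]_y F (x, y)))%E.
  congr fine; apply: eq_integral => x _; rewrite /F/= EFinM fineK; last first.
    exact: (integrable_fin_num measurableT (gci x)).
  rewrite -integralZl//; last exact: gci.
  by apply: eq_integral => y _; rewrite -EFinM mulrA.
rewrite E; congr fine; apply: eq_integral => y _; rewrite /F/= EFinM fineK; last first.
  exact: (integrable_fin_num measurableT (fci y)).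
rewrite -integralZl//; last exact: fci.
by apply: eq_integral => x _; rewrite -EFinM mulrA (mulrC (g y)).
Qed.
End fubini_kernel.

Section line2.
Context {R : realType}.
Local Notation mu := (@lebesgue_measure R).
Implicit Types f g : R -> R.

Lemma cos_lipschitz (x y : R) : `|cos x - cos y| <= `|x - y|.
Proof.
wlog xy : x y / x <= y.
  move=> h; have [/h//|/ltW/h] := leP x y.
  by rewrite distrC [leRHS]distrC.
move: xy; rewrite le_eqVlt => /orP[/eqP ->|xy]; first by rewrite !subrr.
have d z : z \in `]x, y[ -> is_derive z (1 : R) cos (- sin z) by move=> _; exact: is_derive_cos.
have [c _ e] := @MVT R cos (fun x => - sin x) x y xy d (continuous_subspaceT (@continuous_cos R)).
rewrite distrC e normrM distrC normrN ler_piMl//.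
by rewrite ler_norml sin_geN1 sin_le1.
Qed.

Lemma Rintegral_itv_add f (a x b : R) : a <= x -> x <= b ->
  mu.-integrable `[a, b] (EFin \o f) ->
  \int[mu]_(t in `[a, b]) f t = \int[mu]_(t in `[a, x]) f t + \int[mu]_(t in `[x, b]) f t.
Proof.
move=> ax xb fi; apply/eqP; rewrite addrC -subr_eq; apply/eqP.
rewrite Rintegral_itvB//.
rewrite Rintegral_itv_obnd_cbnd//.
apply: (@integrableS _ _ _ mu `[a, b] `]x, b] _ _ _ _ fi); [exact: measurable_itv|exact: measurable_itv|].
by apply: subset_itvr; rewrite bnd_simp.
Qed.

Lemma continuous_itv_integrable f (a b : R) : continuous f ->
  mu.-integrable `[a, b] (EFin \o f).
Proof.
move=> cf; apply: continuous_compact_integrable; first exact: segment_compact.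
exact: continuous_subspaceT.
Qed.

(** The integrand is continuous in [u] and dominated by [|f|]. *)
Lemma cos_transform_continuous f c : mu.-integrable setT (EFin \o f) ->
  continuous (fun u : R => \int[mu]_x (f x * cos (u * x + c))).
Proof.
move=> fi a; have mf := integrable_measurable fi.
pose F (u x : R) := f x * cos (u * x + c).
have := @continuity_under_integral _ _ _ mu F setT measurableT (a - 1) (a + 1).
move=> /(_ _ _ (fun x => `|f x|) (integrable_norm fi) _ a); apply.
- move=> u _; apply: integrable_mul_cos => //.
  by apply: measurable_funD => //; apply: measurable_funM.
- apply/aeW => x _ u _; apply: cvgM; first exact: cvg_cst.
  apply: (@continuous_comp _ _ _ (fun u : R => u * x + c) cos); last exact: continuous_cos.
  by apply: cvgD; [apply: cvgM; [exact: cvg_id|exact: cvg_cst]|exact: cvg_cst].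
- by move=> u _; apply/aeW => x _; rewrite normrM ler_piMr// norm_cos_le1.
by rewrite inE/= in_itv/= ltrBlDr ltrDl ltr01.
Qed.

Lemma Fubini_cos f g c :
  mu.-integrable setT (EFin \o f) -> mu.-integrable setT (EFin \o g) ->
  \int[mu]_u (f u * \int[mu]_x (g x * cos (u * x + c))) =
  \int[mu]_x (g x * \int[mu]_u (f u * cos (x * u + c))).
Proof.
move=> fi gi.
have := @Fubini_kernel _ _ _ _ R mu mu f g (fun z => cos (z.1 * z.2 + c)) fi gi.
move=> ->.
- apply: eq_Rintegral => x _; congr (_ * _); apply: eq_Rintegral => u _ /=.
  by rewrite [x * u]mulrC.
- apply: measurable_cos_comp; apply: measurable_funD => //.
  by apply: measurable_funM; [exact: measurable_fst|exact: measurable_snd].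
- by move=> z; exact: norm_cos_le1.
Qed.

End line2.

Section L2more.
Context d (T : measurableType d) (R : realType) (mu : {measure set T -> \bar R}).

Lemma Lnorm2_le (f g : T -> R) : measurable_fun setT f -> measurable_fun setT g ->
  (forall x, `|f x| <= `|g x|) ->
  (Lnorm mu 2%:E (EFin \o f) <= Lnorm mu 2%:E (EFin \o g))%E.
Proof.
move=> mf mg fg; rewrite unlock.
have mp (h : T -> R) : measurable_fun setT h -> measurable_fun setT (fun x => (`|(EFin \o h) x| `^ 2)%E).
  move=> mh; apply: (@measurableT_comp _ _ _ _ _ _ (fun x => (x `^ 2)%E)) => //=.
    exact: measurable_poweR.
  by apply/measurable_EFinP; exact: measurableT_comp.
rewrite gt0_ler_poweR//.
- by rewrite in_itv/= leey integral_ge0// => x _; exact: poweR_ge0.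
- by rewrite in_itv/= leey integral_ge0// => x _; exact: poweR_ge0.
apply: ge0_le_integral => //; [by move=> x _; exact: poweR_ge0|exact: mp|exact: mp|].
move=> x _; rewrite gt0_ler_poweR//=; first by rewrite in_itv/= leey andbT.
- by rewrite in_itv/= leey andbT.
- by rewrite lee_fin.
Qed.

End L2more.

(** * The operator on Hermite functions and on signed indicators *)

Section Tm.
Context {R : realType}.
Local Open Scope complex_scope.
Local Notation mu := (@lebesgue_measure R).
Local Notation h := (hermite_fun R).
Local Notation phase k := (k%:R * (pi / 2) : R).

(** The real part of [i ^ k * z]: this rotation makes the transform of [h k] real. *)
Definition Re_rot (k : nat) (z : R[i]) : R :=
  cos (phase k) * complex.Re z - sin (phase k) * complex.Im z.

Lemma Re_rotB k z w : Re_rot k (z - w) = Re_rot k z - Re_rot k w.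
Proof. by case: z w => [a b] [c e]; rewrite /Re_rot/=; ring. Qed.

Lemma Re_rot_le k z : `|Re_rot k z| <= Normc.normc z.
Proof.
case: z => a b; rewrite /Re_rot /Normc.normc/= -[leLHS]sqrtr_sqr ler_sqrt; last first.
  by rewrite addr_ge0// sqr_ge0.
have := cos2Dsin2 (phase k); move: (cos _) (sin _) => c s E.
rewrite -subr_ge0.
have -> : a ^+ 2 + b ^+ 2 - (c * a - s * b) ^+ 2 = (s * a + c * b) ^+ 2 +
   (a ^+ 2 + b ^+ 2) * (1 - (c ^+ 2 + s ^+ 2)) by ring.
by rewrite E subrr mulr0 addr0 sqr_ge0.
Qed.

Lemma Re_rotZ k (r : R) z : Re_rot k (r%:C * z) = r * Re_rot k z.
Proof. by case: z => a b; rewrite /Re_rot/=; ring. Qed.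

Lemma Re_fourier f u : complex.Re (fourier f u) = \int[mu]_x (f x * cos (u * x + 0)).
Proof.
rewrite /fourier /Cintegral /=; apply: eq_Rintegral => x _.
by rewrite /expi /= cosN addr0; ring.
Qed.

Lemma Im_fourier f u : complex.Im (fourier f u) = \int[mu]_x (f x * cos (u * x + pi / 2)).
Proof.
rewrite /fourier /Cintegral /=; apply: eq_Rintegral => x _.
by rewrite /expi /= sinN cosD_pihalf; ring.
Qed.

Lemma integrable_cos_affine f (u c : R) : mu.-integrable setT (EFin \o f) ->
  mu.-integrable setT (EFin \o (fun x => f x * cos (u * x + c))).
Proof.
move=> fi; apply: integrable_mul_cos fi.
by apply: measurable_funD => //; exact: measurable_funM.
Qed.

Lemma Re_rot_fourier k f u : mu.-integrable setT (EFin \o f) ->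
  Re_rot k (fourier f u) = \int[mu]_x (f x * cos (u * x + - phase k)).
Proof.
move=> fi; rewrite /Re_rot Re_fourier Im_fourier.
have i c := integrable_cos_affine u c fi.
rewrite -!RintegralZl// -RintegralB//; last 2 first.
- exact: (integrableZl measurableT _ (i _)).
- exact: (integrableZl measurableT _ (i _)).
by apply: eq_Rintegral => x _; rewrite cosB cosD_pihalf addr0; ring.
Qed.

Lemma fourier_hermite k u : fourier (h k) u =
  Num.sqrt (2 * pi) * h k u * cos (phase k) +i* (- (Num.sqrt (2 * pi) * h k u * sin (phase k))).
Proof.
have : fourier (h k) u = complex.Re (fourier (h k) u) +i* complex.Im (fourier (h k) u) by [].
move=> ->; rewrite Re_fourier Im_fourier !hermite_fun_fourier add0r.
by rewrite [pi / 2 + _]addrC cosD_pihalf mulrN.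
Qed.

Lemma measurable_Re_fourier f : mu.-integrable setT (EFin \o f) ->
  measurable_fun setT (fun u => complex.Re (fourier f u)).
Proof.
move=> fi; rewrite (_ : (fun u => _) = fun u => \int[mu]_x (f x * cos (u * x + 0))).
  by apply: continuous_measurable; exact: cos_transform_continuous.
by apply/funext => u; rewrite Re_fourier.
Qed.

Lemma measurable_Im_fourier f : mu.-integrable setT (EFin \o f) ->
  measurable_fun setT (fun u => complex.Im (fourier f u)).
Proof.
move=> fi; rewrite (_ : (fun u => _) = fun u => \int[mu]_x (f x * cos (u * x + pi / 2))).
  by apply: continuous_measurable; exact: cos_transform_continuous.
by apply/funext => u; rewrite Im_fourier.
Qed.

Lemma measurable_Re_rot k (F : R -> R[i]) :
  measurable_fun setT (fun u => complex.Re (F u)) ->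
  measurable_fun setT (fun u => complex.Im (F u)) ->
  measurable_fun setT (fun u => Re_rot k (F u)).
Proof. by move=> m1 m2; apply: measurable_funB; apply: measurable_funM. Qed.

Lemma indic_trunc_integrable (f : R -> R) n : f \in Lfun mu 2%:E ->
  mu.-integrable setT (EFin \o (f \* \1_`[- n%:R, n%:R])).
Proof.
move=> fL; apply: (Lfun2_mul_integrable fL).
apply: Lfun2I; first exact: measurable_indic.
rewrite (_ : (fun x => _) = \1_`[- n%:R, n%:R]).
  exact: (@integrable_indic_itv R _ _ true false).
by apply/funext => x; rewrite indicE; case: (x \in _); rewrite ?expr1n ?expr0n.
Qed.

(** As the transform of [h k] is explicit, Parseval's identity is Fubini's theorem
    for the truncations of [g], followed by passage to the limit on both sides. *)
Lemma parseval_hermite k (g : R -> R) G : is_fourierL2 g G ->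
  Num.sqrt (2 * pi) * \int[mu]_x (g x * h k x) = \int[mu]_u (Re_rot k (G u) * h k u).
Proof.
move=> [gL [ReG ImG] cvG].
pose g_ n : R -> R := g \* \1_`[- n%:R, n%:R].
have gi n : mu.-integrable setT (EFin \o g_ n) by exact: indic_trunc_integrable.
pose F_ n u := Re_rot k (fourier (g_ n) u).
have mF_ n : measurable_fun setT (F_ n).
  by apply: measurable_Re_rot; [exact: measurable_Re_fourier|exact: measurable_Im_fourier].
have mG : measurable_fun setT (fun u => Re_rot k (G u)).
  by apply: measurable_Re_rot; [exact: (Lfun2_measurable ReG)|exact: (Lfun2_measurable ImG)].
have hL : h k \in Lfun mu 2%:E by exact: (schwartz_Lfun2 (hermite_schwartz R k)).
have GL : (fun u => Re_rot k (G u)) \in Lfun mu 2%:E.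
  have L2 (c : R) f : f \in Lfun mu 2%:E -> (fun u => c * f u) \in Lfun mu 2%:E.
    move=> fL; have := @Lfun_scale _ _ _ mu f c 2 _ fL.
    by rewrite (_ : c \o* f = fun u => c * f u);
       [apply; rewrite ler1n|apply/funext => u; rewrite /= mulrC].
  have := @rpredB _ (Lfun mu 2%:E) _ _ (L2 (cos (phase k)) _ ReG) (L2 (sin (phase k)) _ ImG).
  by apply; rewrite lee_fin ler1n.
have bF n u : `|F_ n u| <= \int[mu]_x `|g_ n x|.
  rewrite /F_ Re_rot_fourier//.
  have ii := integrable_cos_affine u (- phase k) (gi n).
  apply: le_trans (le_normr_Rintegral measurableT ii) _.
  apply: le_Rintegral => //; [exact: integrable_norm ii|exact: integrable_norm (gi n)|].
  by move=> x _; rewrite normrM ler_piMr// norm_cos_le1.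
have Fhi n : mu.-integrable setT (EFin \o (F_ n \* h k)).
  apply: (@integrable_dominated _ _ _ mu _ (fun u => (\int[mu]_x `|g_ n x|) * `|h k u|)).
  - exact: (measurable_funM (mF_ n) (hermite_fun_measurable k)).
  - by move=> u; rewrite normrM ler_wpM2r.
  - exact: (integrableZl measurableT _ (integrable_norm (hermite_fun_integrable k))).
have lhs : \int[mu]_u (F_ n u * h k u) @[n --> \oo] --> \int[mu]_u (Re_rot k (G u) * h k u).
  apply: Lfun2_cvg_mul => //; first exact: Lfun2_mul_integrable.
  have Lge0 n : (0 <= Lnorm mu 2%:E (fun u => (F_ n u - Re_rot k (G u))%:E))%E by exact: Lnorm_ge0.
  apply: (@squeeze_cvge _ _ _ _ (cst 0%E) _ _ _ _ _ cvG).
  - apply: nearW => n; rewrite Lge0/=.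
    apply: (@Lnorm2_le _ _ _ mu (fun u => F_ n u - Re_rot k (G u))
      (fun u => Normc.normc (fourier (g_ n) u - G u))).
    + exact: (measurable_funB (mF_ n) mG).
    + have -> : (fun u => Normc.normc (fourier (g_ n) u - G u)) = (fun u => Num.sqrt
          ((complex.Re (fourier (g_ n) u) - complex.Re (G u)) ^+ 2 +
           (complex.Im (fourier (g_ n) u) - complex.Im (G u)) ^+ 2)).
        by apply/funext => u; rewrite /Normc.normc; case: (fourier _ u) (G u) => [a b] [c e].
      apply: (measurableT_comp (f := @Num.sqrt R)).
        by apply: continuous_measurable; exact: sqrt_continuous.
      by apply: measurable_funD; apply: measurable_funX; apply: measurable_funB;
        [exact: measurable_Re_fourier|exact: (Lfun2_measurable ReG)|
         exact: measurable_Im_fourier|exact: (Lfun2_measurable ImG)].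
    + move=> u; rewrite -Re_rotB; apply: le_trans (Re_rot_le _ _) _; exact: ler_norm.
  - exact: cvg_cst.
have rhs : \int[mu]_x (g_ n x * h k x) @[n --> \oo] --> \int[mu]_x (g x * h k x).
  have := cvg_Rintegral_trunc (Lfun2_mul_integrable gL hL).
  apply: cvg_trans; apply: near_eq_cvg; apply: nearW => n.
  apply: eq_Rintegral => x _; rewrite patch_indic /g_ /=; ring.
have E n : \int[mu]_u (F_ n u * h k u) = Num.sqrt (2 * pi) * \int[mu]_x (g_ n x * h k x).
  transitivity (\int[mu]_u (h k u * \int[mu]_x (g_ n x * cos (u * x + - phase k)))).
    by apply: eq_Rintegral => u _; rewrite /F_ Re_rot_fourier// mulrC.
  rewrite (Fubini_cos _ (hermite_fun_integrable k) (gi n)).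
  rewrite -RintegralZl//; last first.
    apply: (@integrable_dominated _ _ _ mu _ (fun x => `|g x| * `|h k x|)).
    - by apply: measurable_funM; [exact: integrable_measurable (gi n)|exact: hermite_fun_measurable].
    - move=> x; rewrite /g_ /= !normrM ler_wpM2r// ler_piMr//.
      by rewrite indicE; case: (x \in _); rewrite ?normr1 ?normr0.
    - have := integrable_norm (Lfun2_mul_integrable gL hL).
      by rewrite (_ : _ \o _ = fun x => `|g x| * `|h k x|)//; apply/funext => x /=; rewrite normrM.
  apply: eq_Rintegral => x _.
  have := hermite_fun_fourier k x (- phase k); rewrite addNr cos0 mulr1 => ->.
  by ring.
have h2 : \int[mu]_u (F_ n u * h k u) @[n --> \oo] --> Num.sqrt (2 * pi) * \int[mu]_x (g x * h k x).
  by rewrite (funext E); apply: cvgMl_tmp.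
exact: (cvg_unique _ h2 lhs).
Qed.

Section with_m.
Variable m : R -> R.
Hypothesis am : admissible m.

Let mm : measurable_fun setT m. Proof. by case: am. Qed.
Let m0 u : 0 <= m u. Proof. by case: am. Qed.

Definition m_int : R := \int[mu]_u (m u / (1 + u ^+ 2)).

Lemma m_integrable : mu.-integrable setT (EFin \o (fun u => m u / (1 + u ^+ 2))).
Proof.
have mf : measurable_fun setT (fun u : R => m u / (1 + u ^+ 2)).
  apply: measurable_funM; first exact: mm.
  apply: continuous_measurable => x; apply: cvgV; first by rewrite gt_eqF// ltr_pwDl// sqr_ge0.
  apply: cvgD; [exact: cvg_cst|exact: exprn_continuous].
apply/integrableP; split; first exact/measurable_EFinP.
case: am => _ _ _ _; apply: le_lt_trans; rewrite le_eqVlt; apply/orP; left; apply/eqP.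
by apply: eq_integral => u _ /=; rewrite ger0_norm// divr_ge0// addr_ge0// sqr_ge0.
Qed.

Lemma m_int_ge0 : 0 <= m_int.
Proof. by apply: Rintegral_ge0 => u _; rewrite divr_ge0 ?m0// addr_ge0// sqr_ge0. Qed.

Lemma measurable_sqrtm : measurable_fun setT (fun u => Num.sqrt (m u)).
Proof.
apply: (measurableT_comp (f := @Num.sqrt R)) => //.
by apply: continuous_measurable; exact: sqrt_continuous.
Qed.

Lemma measurable_mh k : measurable_fun setT (fun u => Num.sqrt (m u) * h k u).
Proof. by apply: measurable_funM; [exact: measurable_sqrtm|exact: hermite_fun_measurable]. Qed.

Let dom k u := k.+1%:R * (m u / (1 + u ^+ 2)) +
  k.+1%:R^-1 * ((1 + u ^+ 2) ^+ 2 * h k u ^+ 2).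

Lemma weight_integrable k :
  mu.-integrable setT (EFin \o (fun u => (1 + u ^+ 2) ^+ 2 * h k u ^+ 2)).
Proof.
have i n := @sqr_hermite_integrable R n k.
rewrite (_ : (fun u => (1 + u ^+ 2) ^+ 2 * h k u ^+ 2) = (fun u => u ^+ 0 * h k u ^+ 2 + 2 * (u ^+ 2 * h k u ^+ 2) + u ^+ 4 * h k u ^+ 2)).
  exact: (integrableD measurableT (integrableD measurableT (i 0%N)
    (integrableZl measurableT 2 (i 2))) (i 4)).
by apply/funext => u; ring.
Qed.

(** Cauchy-Schwarz against [m u / (1 + u ^+ 2)], in its arithmetic-geometric
    form; the splitting weight [k.+1] balances the two terms, the second of which
    has integral of order [k.+1 ^+ 2].  The factor [1 + |u|] on the left serves the
    bound on [T_m h_k] and the bound on its Lipschitz constant simultaneously. *)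
Lemma mh_le k u : (1 + `|u|) * `|Num.sqrt (m u) * h k u| <= dom k u.
Proof.
rewrite normrM (ger0_norm (sqrtr_ge0 _)) /dom.
have u2 : `|u| ^+ 2 = u ^+ 2 by rewrite real_normK ?num_real.
have h2 : `|h k u| ^+ 2 = h k u ^+ 2 by rewrite real_normK ?num_real.
have s2 : Num.sqrt (m u) ^+ 2 = m u by rewrite sqr_sqrtr.
rewrite -u2 -h2 -{2}s2.
have := normr_ge0 u; have := normr_ge0 (h k u); have := sqrtr_ge0 (m u).
have : 0 < k.+1%:R :> R by [].
move: (Num.sqrt _) (`|h k u|) (`|u|) (k.+1%:R) => s y v n n0 s0 y0 v0.
have w0 : 0 < 1 + v ^+ 2 by rewrite ltr_pwDl// sqr_ge0.
(* Completing the square in [s]; the remainder is nonnegative as [(1 + v)^2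
   <= 4 (1 + v^2)]. *)
have E : n * (s ^+ 2 / (1 + v ^+ 2)) + n^-1 * ((1 + v ^+ 2) ^+ 2 * y ^+ 2) - (1 + v) * (s * y) =
  (n * s - 2^-1 * (1 + v) * (1 + v ^+ 2) * y) ^+ 2 / (n * (1 + v ^+ 2)) +
  (1 + v ^+ 2) * y ^+ 2 * (1 + v ^+ 2 - 4^-1 * (1 + v) ^+ 2) / n.
  by field; rewrite !gt_eqF.
rewrite -subr_ge0 E addr_ge0//; first by rewrite divr_ge0 ?sqr_ge0// ltW// mulr_gt0.
apply: divr_ge0; last exact: ltW.
apply: mulr_ge0; first by rewrite mulr_ge0 ?sqr_ge0// ltW.
by nra.
Qed.

Lemma dom_integrable k : mu.-integrable setT (EFin \o dom k).
Proof.
exact: (integrableD measurableT (integrableZl measurableT k.+1%:R m_integrable)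
  (integrableZl measurableT k.+1%:R^-1 (weight_integrable k))).
Qed.

Lemma int_dom_le k : \int[mu]_u dom k u <= k.+1%:R * (m_int + 9).
Proof.
rewrite RintegralD//; last 2 first.
- exact: (integrableZl measurableT k.+1%:R m_integrable).
- exact: (integrableZl measurableT k.+1%:R^-1 (weight_integrable k)).
rewrite RintegralZl//; last exact: m_integrable.
rewrite RintegralZl//; last exact: weight_integrable.
rewrite mulrDr lerD// ler_pdivrMl//.
by apply: le_trans (int_hermite_fun_weight_le k) _; rewrite [leRHS]mulrA [leRHS]mulrC.
Qed.

Lemma mh_integrable k : mu.-integrable setT (EFin \o (fun u => Num.sqrt (m u) * h k u)).
Proof.
apply: (@integrable_dominated _ _ _ mu _ (dom k)); last exact: dom_integrable.
- exact: measurable_mh.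
- by move=> u; apply: le_trans (mh_le k u); rewrite ler_peMl// lerDl.
Qed.

Local Notation w k := (Tm_schwartz m (hermite_schwartz R k)).

Lemma Tm_hermiteE k t : w k t = (Num.sqrt (2 * pi))^-1 *
  \int[mu]_u (Num.sqrt (m u) * h k u * cos (t * u + - phase k)).
Proof.
have p0 : Num.sqrt (2 * pi) != 0 :> R by rewrite gt_eqF// sqrtr_gt0 mulr_gt0// pi_gt0.
have p2 : Num.sqrt (2 * pi) * Num.sqrt (2 * pi) = 2 * pi :> R.
  by rewrite -expr2 sqr_sqrtr// mulr_ge0// pi_ge0.
rewrite /Tm_schwartz.
rewrite (_ : complex.Re _ = \int[mu]_u (Num.sqrt (2 * pi) *
   (Num.sqrt (m u) * h k u * cos (t * u + - phase k)))); last first.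
  apply: eq_Rintegral => u _; rewrite fourier_hermite /expi/= cosB [u * t]mulrC; ring.
rewrite RintegralZl//; last exact: (integrable_cos_affine _ _ (mh_integrable k)).
have e : (2 * pi)^-1 * Num.sqrt (2 * pi) = (Num.sqrt (2 * pi))^-1 :> R.
  have pp : 2 * pi != 0 :> R by rewrite mulf_neq0// gt_eqF// pi_gt0.
  by apply: (mulfI p0); rewrite mulfV// [LHS]mulrCA p2 mulVf.
by rewrite -e -[RHS]mulrA.
Qed.

Definition Tm_bound : R := (Num.sqrt (2 * pi))^-1 * (m_int + 9).

Lemma Tm_bound_ge0 : 0 <= Tm_bound.
Proof. by rewrite mulr_ge0 ?invr_ge0 ?sqrtr_ge0// addr_ge0 ?m_int_ge0. Qed.

Lemma Tm_hermite_bounded k t : `|w k t| <= Tm_bound * k.+1%:R.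
Proof.
rewrite Tm_hermiteE normrM ger0_norm ?invr_ge0 ?sqrtr_ge0// -mulrA ler_wpM2l ?invr_ge0 ?sqrtr_ge0//.
have ii := integrable_cos_affine t (- phase k) (mh_integrable k).
apply: le_trans (le_normr_Rintegral measurableT ii) _.
rewrite [leRHS]mulrC; apply: le_trans (int_dom_le k).
apply: le_Rintegral => //; [exact: integrable_norm ii|exact: dom_integrable|].
move=> u _; apply: le_trans (mh_le k u); rewrite normrM.
apply: (@le_trans _ _ (`|Num.sqrt (m u) * h k u|)); first by rewrite ler_piMr// norm_cos_le1.
by rewrite ler_peMl// lerDl.
Qed.

Lemma Tm_hermite_lipschitz k t s : `|w k t - w k s| <= Tm_bound * k.+1%:R * `|t - s|.
Proof.
have ii v := integrable_cos_affine v (- phase k) (mh_integrable k).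
rewrite !Tm_hermiteE -mulrBr -RintegralB//.
rewrite normrM ger0_norm ?invr_ge0 ?sqrtr_ge0// -!mulrA ler_wpM2l ?invr_ge0 ?sqrtr_ge0//.
have iB := integrableB measurableT (ii t) (ii s).
apply: le_trans (le_normr_Rintegral measurableT iB) _.
apply: (@le_trans _ _ (\int[mu]_u (`|t - s| * dom k u))).
  apply: le_Rintegral => //; first exact: (integrable_norm iB).
    exact: (integrableZl measurableT _ (dom_integrable k)).
  move=> u _; rewrite -mulrBr normrM mulrC.
  apply: (@le_trans _ _ (`|(t - s) * u| * `|Num.sqrt (m u) * h k u|)).
    rewrite ler_wpM2r//; apply: le_trans (cos_lipschitz _ _) _.
    by rewrite opprD addrACA subrr addr0 -mulrBl.
  rewrite normrM -mulrA ler_wpM2l//; apply: le_trans (mh_le k u).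
  by rewrite ler_wpM2r// lerDr.
rewrite RintegralZl//; last exact: dom_integrable.
by rewrite [leRHS]mulrA [leRHS]mulrC ler_wpM2l// mulrC int_dom_le.
Qed.

Lemma Tm_hermite_continuous k : continuous (w k).
Proof.
move=> t; rewrite (_ : w k = fun s => (Num.sqrt (2 * pi))^-1 *
  \int[mu]_u (Num.sqrt (m u) * h k u * cos (s * u + - phase k))); last first.
  by apply/funext => s; exact: Tm_hermiteE.
apply: cvgM; first exact: cvg_cst.
exact: (@cos_transform_continuous R (fun u => Num.sqrt (m u) * h k u) (- phase k) (mh_integrable k) t).
Qed.

Lemma signed_indic_integrable (t : R) : mu.-integrable setT (EFin \o signed_indic t).
Proof.
rewrite /signed_indic; case: ifP => _; first exact: (@integrable_indic_itv R _ _ true false).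
have := @integrable_indic_itv R t 0 true false.
exact: integrableN.
Qed.

(** A function of bounded support equals its large truncations, so that the sequence
    defining the transform is eventually constant. *)
Lemma fourierL2_signed_indic (t : R) F k : is_fourierL2 (signed_indic t) F ->
  {ae mu, forall u, Re_rot k (F u) = Re_rot k (fourier (signed_indic t) u)}.
Proof.
move=> [_ [ReF ImF] cvF]; have si := signed_indic_integrable t.
pose D u := Normc.normc (fourier (signed_indic t) u - F u).
have mD : measurable_fun setT D.
  have -> : D = (fun u => Num.sqrt
      ((complex.Re (fourier (signed_indic t) u) - complex.Re (F u)) ^+ 2 +
       (complex.Im (fourier (signed_indic t) u) - complex.Im (F u)) ^+ 2)).
    by apply/funext => u; rewrite /D /Normc.normc; case: (fourier _ u) (F u) => [a b] [c e].
  apply: (measurableT_comp (f := @Num.sqrt R)).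
    by apply: continuous_measurable; exact: sqrt_continuous.
  by apply: measurable_funD; apply: measurable_funX; apply: measurable_funB;
    [exact: measurable_Re_fourier|exact: (Lfun2_measurable ReF)|
     exact: measurable_Im_fourier|exact: (Lfun2_measurable ImF)].
have D0 : Lnorm mu 2%:E (EFin \o D) = 0%E.
  have cD : (Lnorm mu 2%:E (fun u => (Normc.normc (fourier
      (signed_indic t \* \1_`[- n%:R, n%:R]) u - F u))%:E) @[n --> \oo] --> Lnorm mu 2%:E (EFin \o D))%E.
    apply: cvg_near_cst; near=> n.
    suff -> : signed_indic t \* \1_`[- n%:R, n%:R] = signed_indic t by [].
    have tn : `|t| <= n%:R by near: n; exact: nbhs_infty_ger.
    apply/funext => x /=; rewrite [X in _ * X]indicE; case: (boolP (x \in _)) => [_|xn].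
      by rewrite mulr1.
    rewrite mulr0; apply/esym; rewrite /signed_indic.
    move: tn; rewrite ler_norml => /andP[tn1 tn2].
    have xout a b : - n%:R <= a -> b <= n%:R -> (\1_`[a, b] x : R) = 0.
      move=> an bn; rewrite indicE; case: (boolP (x \in _)) => //.
      rewrite inE/= in_itv/= => /andP[x1 x2]; move/negP: xn => [].
      by rewrite inE/= in_itv/= (le_trans an x1) (le_trans x2 bn).
    by case: (leP 0 t) => t0 /=; rewrite xout ?oppr0// oppr_le0.
  exact: (cvg_unique _ cD cvF).
have two0 : (0 < 2%:E :> \bar R)%E by rewrite lte_fin.
have h : EFin \o D = \0 %[ae mu].
  by apply: (Lnorm_eq0_eq0 _ two0 D0); exact/measurable_EFinP.
apply: (@filterS _ _ (ae_filter_ringOfSetsType mu) _ _ _ h) => u /= /(_ I) [] Du.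
apply/eqP; rewrite -subr_eq0 -normr_eq0 eq_le normr_ge0 andbT distrC -Re_rotB.
by rewrite -Du; exact: Re_rot_le.
Unshelve. all: by end_near.
Qed.

(** Parseval for [T_m 1_[0,t]] moves the factor [sqrt m] onto the transform of
    [h k]; Fubini then recovers the cosine transform [w k]. *)
Lemma Tm_pairing_signed (t : R) g k : is_Tm m (signed_indic t) g ->
  \int[mu]_x (g x * h k x) = \int[mu]_x (signed_indic t x * w k x).
Proof.
move=> [F fF gF].
have p0 : Num.sqrt (2 * pi) != 0 :> R by rewrite gt_eqF// sqrtr_gt0 mulr_gt0// pi_gt0.
have si := signed_indic_integrable t.
apply: (mulfI p0); rewrite (parseval_hermite _ gF).
case: fF => sL [ReF ImF] cF; have ae := fourierL2_signed_indic k (And3 sL (conj ReF ImF) cF).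
transitivity (\int[mu]_u ((Num.sqrt (m u) * h k u) *
    \int[mu]_x (signed_indic t x * cos (u * x + - phase k)))).
  rewrite /Rintegral; congr fine; apply: ae_eq_integral => //.
  - apply/measurable_EFinP; apply: measurable_funM; last exact: hermite_fun_measurable.
    under eq_fun do rewrite Re_rotZ.
    apply: measurable_funM; first exact: measurable_sqrtm.
    by apply: measurable_Re_rot; [exact: (Lfun2_measurable ReF)|exact: (Lfun2_measurable ImF)].
  - apply/measurable_EFinP; apply: measurable_funM; first exact: measurable_mh.
    by apply: continuous_measurable; exact: cos_transform_continuous.
  apply: (@filterS _ _ (ae_filter_ringOfSetsType mu) _ _ _ ae) => u /= E _; congr EFin.
  by rewrite Re_rotZ E Re_rot_fourier// /Rintegral mulrAC.
rewrite (Fubini_cos _ (mh_integrable k) si) -RintegralZl//.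
  by apply: eq_Rintegral => x _; rewrite Tm_hermiteE [RHS]mulrCA mulVKf.
apply: (@integrable_dominated _ _ _ mu _ (fun x => Tm_bound * k.+1%:R * `|signed_indic t x|)).
- apply: measurable_funM; first exact: integrable_measurable si.
  by apply: continuous_measurable; exact: Tm_hermite_continuous.
- by move=> x; rewrite normrM mulrC ler_wpM2r// Tm_hermite_bounded.
- exact: (integrableZl measurableT _ (integrable_norm si)).
Qed.

(** The three sign configurations of the endpoints. *)
Lemma Tm_pairing_increment (s t : R) gs gt k : s <= t ->
  is_Tm m (signed_indic s) gs -> is_Tm m (signed_indic t) gt ->
  \int[mu]_x (gt x * h k x) - \int[mu]_x (gs x * h k x) = \int[mu]_(x in `[s, t]) w k x.
Proof.
move=> st Ts Tt; rewrite (Tm_pairing_signed k Ts) (Tm_pairing_signed k Tt).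
have cw : continuous (w k) by exact: Tm_hermite_continuous.
have E v : \int[mu]_x (signed_indic v x * w k x) =
    if 0 <= v then \int[mu]_(x in `[0, v]) w k x else - \int[mu]_(x in `[v, 0]) w k x.
  rewrite /signed_indic; case: ifP => _.
    rewrite [RHS]Rintegral_mkcond; apply: eq_Rintegral => x _.
    by rewrite patch_indic /= mulrC.
  rewrite [in RHS]Rintegral_mkcond -mulN1r -RintegralZl//.
    by apply: eq_Rintegral => x _; rewrite patch_indic /=; ring.
  rewrite -restrict_EFin.
  exact: ((@integrable_mkcond _ _ _ mu _ (EFin \o w k) (@measurable_itv R `[v, 0])).1
    (continuous_itv_integrable v 0 cw)).
rewrite !E; case: (leP 0 t) => t0; case: (leP 0 s) => s0.
- rewrite (@Rintegral_itv_add _ _ 0 s t)//; last exact: continuous_itv_integrable.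
  by rewrite addrC addKr.
- rewrite opprK [in RHS](@Rintegral_itv_add _ _ s 0 t)//; last exact: continuous_itv_integrable.
    by rewrite addrC.
  exact: ltW.
- by have := lt_le_trans t0 (le_trans s0 st); rewrite ltxx.
- rewrite opprK (@Rintegral_itv_add _ _ s t 0)//; [|exact: ltW|exact: continuous_itv_integrable].
  by rewrite addrCA addNr addr0.
Qed.

End with_m.

End Tm.

(** * Moments of a Gaussian variable from its characteristic function *)

Section moments.
Context d (T : measurableType d) (R : realType) (P : probability T R).
Implicit Types f g : T -> R.
Local Notation "''E' f" := (\int[P]_x f x) (at level 10, f at level 8).

(** Variables with moments of all orders form an algebra, which spares integrability
    bookkeeping for polynomials in Gaussian variables. *)
Definition allmom f := measurable_fun setT f /\
  forall n, P.-integrable setT (EFin \o (fun x => f x ^+ n)).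

Lemma allmom_integrable f : allmom f -> P.-integrable setT (EFin \o f).
Proof.
by move=> [_ /(_ 1%N)]; rewrite (_ : (fun x => f x ^+ 1) = f).
Qed.

Lemma prob_integrable_cst (c : R) : P.-integrable setT (EFin \o (cst c)).
Proof.
apply: measurable_bounded_integrable => //.
  by rewrite (@le_lt_trans _ _ 1%E) ?probability_le1// ltry.
by exists `|c|; split; [exact: num_real|move=> x cx y _ /=; exact: ltW].
Qed.

Lemma allmom_cst (c : R) : allmom (cst c).
Proof. by split=> // n; exact: (prob_integrable_cst (c ^+ n)). Qed.

(** [|f g|^n <= |f|^(2n) + |g|^(2n)]. *)
Lemma allmomM f g : allmom f -> allmom g -> allmom (fun x => f x * g x).
Proof.
move=> [mf fn] [mg gn]; split; first exact: measurable_funM.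
move=> n; apply: (@integrable_dominated _ _ _ P _ (fun x => f x ^+ (n * 2) + g x ^+ (n * 2))).
- by apply: measurable_funX; exact: measurable_funM.
- move=> x; rewrite exprMn !exprM normrM.
  have := normr_ge0 (f x ^+ n); have := normr_ge0 (g x ^+ n).
  rewrite -[(f x ^+ n) ^+ 2]real_normK ?num_real// -[(g x ^+ n) ^+ 2]real_normK ?num_real//.
  move: `|_| `|_| => u v u0 v0; nra.
- exact: (integrableD measurableT (fn _) (gn _)).
Qed.

Lemma allmomD f g : allmom f -> allmom g -> allmom (fun x => f x + g x).
Proof.
move=> [mf fn] [mg gn]; split; first exact: measurable_funD.
move=> n; apply: (@integrable_dominated _ _ _ P _
   (fun x => 2 ^+ n * (`|f x ^+ n| + `|g x ^+ n|))).
- by apply: measurable_funX; exact: measurable_funD.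
- move=> x; rewrite !normrX.
  apply: (@le_trans _ _ ((2 * Num.max `|f x| `|g x|) ^+ n)).
    rewrite lerXn2r ?nnegrE ?mulr_ge0 ?le_max ?normr_ge0//.
    apply: le_trans (ler_normD _ _) _; rewrite mulr_natl mulr2n.
    by rewrite lerD// le_max lexx ?orbT.
  rewrite exprMn ler_wpM2l ?exprn_ge0//.
  by case: (leP `|f x| `|g x|) => _; rewrite ?lerDl ?lerDr exprn_ge0.
- have i := integrableD measurableT (integrable_norm (fn n)) (integrable_norm (gn n)).
  exact: (integrableZl measurableT _ i).
Qed.

Lemma allmomZ (c : R) f : allmom f -> allmom (fun x => c * f x).
Proof. by move=> fm; have := allmomM (allmom_cst c) fm. Qed.

Lemma allmom_Lfun2 f : allmom f -> f \in Lfun P 2%:E.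
Proof. by move=> [mf /(_ 2) fi]; exact: Lfun2I. Qed.

Lemma one_minus_cos_ge0 (x : R) : 0 <= 1 - cos x.
Proof. by rewrite subr_ge0 cos_le1. Qed.

Lemma sin_half_sqr (x : R) : 1 - cos x = 2 * sin (x / 2) ^+ 2.
Proof.
by rewrite {1}[x]splitr cosD -{1}(cos2Dsin2 (x / 2)); ring.
Qed.

Lemma norm_sin_le (x : R) : `|sin x| <= `|x|.
Proof.
have := @cos_lipschitz R (x + pi / 2) (pi / 2).
by rewrite cosD_pihalf cos_pihalf subr0 normrN addrK.
Qed.

Lemma one_minus_cos_le (x : R) : 1 - cos x <= x ^+ 2 / 2.
Proof.
rewrite sin_half_sqr.
have := norm_sin_le (x / 2); rewrite -ler_sqr ?nnegrE//.
by rewrite !real_normK ?num_real// expr_div_n => h; lra.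
Qed.

(** This form of [2 (1 - cos x) ~ x^2] gives the second moments from the
    characteristic function through Fatou's lemma. *)
Lemma cvg_one_minus_cos (x : R) :
  2 * (1 - cos (x / n.+1%:R)) * n.+1%:R ^+ 2 @[n --> \oo] --> x ^+ 2.
Proof.
have ds : is_derive (0 : R) (1 : R) (fun t : R => sin (t * x)) x.
  have d0 : is_derive (0 : R) (1 : R) (fun t : R => t * x) x.
    have : is_derive (0 : R) (1 : R) ((id : R -> R) * cst x) x; last exact.
    by apply: is_derive_eq; rewrite /GRing.scale/= mulr0 add0r mulr1.
  have : is_derive (0 : R) (1 : R) (sin \o (fun t : R => t * x)) (cos (0 * x) * x).
    exact: is_derive1_comp.
  by rewrite mul0r cos0 mul1r.
have := @ex_derive _ _ _ _ _ _ _ ds; rewrite /derivable => /cvg_ex[l hl].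
have lx : l = x.
  by have := @derive_val _ _ _ _ _ _ _ ds; rewrite /derive => <-; apply/esym/cvg_lim.
rewrite lx in hl.
have hs : (2 * n.+1%:R) * sin (x / (2 * n.+1%:R)) @[n --> \oo] --> x.
  pose u n : R := 2^-1 * n.+1%:R^-1.
  have uE n : u n = (2 * n.+1%:R)^-1 by rewrite /u invfM.
  have u0 : (forall n, u n != 0) /\ u n @[n --> \oo] --> (0 : R).
    split => [n|]; first by rewrite uE invr_eq0 mulf_neq0// pnatr_eq0.
    by rewrite -[0](mulr0 2^-1); apply: cvgMl_tmp; exact: cvg_harmonic.
  have := (cvgr_dnbhsP _ _ _).1 hl u u0.
  apply: cvg_trans; apply: near_eq_cvg; apply: nearW => n /=.
  rewrite addr0 mul0r sin0 subr0 uE invrK /GRing.scale/= mulr1.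
  by rewrite [_^-1 * x]mulrC.
have -> : (fun n => 2 * (1 - cos (x / n.+1%:R)) * n.+1%:R ^+ 2) =
  (fun n => ((2 * n.+1%:R) * sin (x / (2 * n.+1%:R))) ^+ 2).
  apply/funext => n; rewrite sin_half_sqr invfM.
  have -> : x / n.+1%:R / 2 = x * (2^-1 / n.+1%:R) by field.
  by rewrite !exprMn; ring.
by rewrite expr2; apply: cvgM.
Qed.

Lemma is_derive_add_mulid (f g : R -> R) (a b t df dg : R) :
  is_derive t (1 : R) f df -> is_derive t (1 : R) g dg ->
  is_derive t (1 : R) (a *: f + (b *: (id : R -> R)) * g)
    (a * df + (b * g t + t * b * dg)).
Proof.
move=> d1 d2.
have di := is_deriveZ b (is_derive_id t (1 : R)).
apply: (is_derive_eq (is_deriveD (is_deriveZ a d1) (is_deriveM di d2))).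
transitivity (a * df + (b * t * dg + g t * (b * 1))) => //; ring.
Qed.

Section one_variable.
Variables (q : T -> R) (sigma : R).
Hypothesis mq : measurable_fun setT q.
Hypothesis charq : forall t c : R, 'E (fun x => cos (t * q x + c)) = cos c * expR (- (t ^+ 2 * sigma) / 2).

Let C j (t c : R) : R := 'E (fun x => q x ^+ j * cos (t * q x + c)).

Lemma pow_integrable n j : P.-integrable setT (EFin \o (fun x => q x ^+ n.*2)) -> (j <= n.*2)%N ->
  P.-integrable setT (EFin \o (fun x => q x ^+ j)).
Proof.
move=> iq jn; apply: (@integrable_dominated _ _ _ P _ (fun x => 1 + q x ^+ n.*2)).
- exact: measurable_funX.
- move=> x; rewrite normrX -[q x ^+ n.*2]ger0_norm; last first.
    by rewrite -muln2 exprM sqr_ge0.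
  rewrite normrX; case: (leP `|q x| 1) => q1.
    by apply: (@le_trans _ _ 1); [exact: exprn_ile1|rewrite lerDl exprn_ge0].
  by apply: le_trans (ler_weXn2l _ jn) _; [exact: ltW|rewrite lerDr].
- exact: (integrableD measurableT (prob_integrable_cst 1) iq).
Qed.

Lemma is_derive_C j t c :
  P.-integrable setT (EFin \o (fun x => q x ^+ j)) ->
  P.-integrable setT (EFin \o (fun x => q x ^+ j.+1)) ->
  is_derive t (1 : R) (fun t => C j t c) (C j.+1 t (c + pi / 2)).
Proof.
move=> i1 i2.
have i3 : P.-integrable setT (EFin \o (fun x => q x ^+ j * q x)).
  by rewrite (_ : (fun x => _) = (fun x => q x ^+ j.+1))//; apply/funext => x; rewrite exprSr.
have := @derive_integral_cos _ _ R P (fun x => q x ^+ j) q (cst c) mq (measurable_cst _) i1 i3 t.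
rewrite (_ : \int[P]_x _ = C j.+1 t (c + pi / 2))//.
by apply: eq_Rintegral => x _; rewrite /= exprSr addrA.
Qed.

(** Gaussian integration by parts for monomials, by differentiating the identity for
    [j] in the frequency [t]; the case [j = 0] is the derivative of the
    characteristic function.  Only moments up to order [n.*2] are used. *)
Lemma stein_pow n j t c : P.-integrable setT (EFin \o (fun x => q x ^+ n.*2)) -> (j < n.*2)%N ->
  C j.+1 t c = j%:R * sigma * C j.-1 t c + t * sigma * C j t (c + pi / 2).
Proof.
move=> iq; elim: j t c => [|j IH] t c jn.
  have d1 := @is_derive_C 0 t (c - pi / 2) (pow_integrable iq (ltnW jn)) (pow_integrable iq jn).
  have d2 : is_derive t (1 : R) (fun t => C 0 t (c - pi / 2))
      (- (t * sigma) * (cos (c - pi / 2) * expR (- (t ^+ 2 * sigma) / 2))).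
    have -> : (fun t => C 0 t (c - pi / 2)) = cos (c - pi / 2) *:
        (expR \o ((- (sigma / 2)) *: ((id : R -> R) * id))).
      apply/funext => u; rewrite /C fctE /= /GRing.scale/=.
      rewrite (_ : \int[P]_x _ = 'E (fun x => cos (u * q x + (c - pi / 2)))); last first.
        by apply: eq_Rintegral => x _; rewrite expr0 mul1r.
      rewrite charq; congr (_ * expR _).
      rewrite (_ : ((id : R -> R) * id) u = u * u)// /GRing.scale/=; by field.
    have d0 : is_derive t (1 : R) ((- (sigma / 2)) *: ((id : R -> R) * id)) (- (t * sigma)).
      by apply: is_derive_eq; rewrite /GRing.scale/=; field.
    have de : is_derive t (1 : R) (expR \o ((- (sigma / 2)) *: ((id : R -> R) * id)))
       (expR (((- (sigma / 2)) *: ((id : R -> R) * id)) t) * - (t * sigma)).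
      exact: is_derive1_comp.
    apply: is_derive_eq; rewrite /GRing.scale/= fctE /= /GRing.scale/=.
    rewrite (_ : - (sigma / 2) * (t * t) = - (t ^+ 2 * sigma) / 2); last by field.
    by ring.
  have := @derive_val _ _ _ _ _ _ _ d1; rewrite (@derive_val _ _ _ _ _ _ _ d2) subrK => <-.
  rewrite !mul0r add0r -charq.
  rewrite (_ : C 0 t (c + pi / 2) = - 'E (fun x => cos (t * q x + (c - pi / 2)))); first by ring.
  have ic : P.-integrable setT (EFin \o (fun x => 1 * cos (t * q x + (c - pi / 2)))).
    apply: integrable_mul_cos (prob_integrable_cst 1).
    by apply: measurable_funD => //; exact: measurable_funM.
  rewrite -mulN1r -RintegralZl//; last first.
    by move: ic; rewrite (_ : (fun x => 1 * _) = fun x => cos (t * q x + (c - pi / 2)))//; apply/funext => x; rewrite mul1r.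
  apply: eq_Rintegral => x _; rewrite expr0 mul1r.
  have -> : t * q x + (c + pi / 2) = t * q x + (c - pi / 2) + pi by field.
  by rewrite cosDpi; ring.
have ip i : (i <= j.+2)%N -> P.-integrable setT (EFin \o (fun x => q x ^+ i)).
  by move=> ij; apply: (pow_integrable iq); exact: leq_trans ij jn.
have d1 := @is_derive_C j.+1 t (c - pi / 2) (ip _ (leqnSn _)) (ip _ (leqnn _)).
have d3 := @is_derive_C j t c (ip _ (leqW (leqnSn _))) (ip _ (leqnSn _)).
have d2 : is_derive t (1 : R) (fun t => C j.-1 t (c - pi / 2)) (C j.-1.+1 t c).
  rewrite -[c in C j.-1.+1 t c](subrK (pi / 2)); apply: is_derive_C; apply: ip.
    by rewrite (leq_trans (leq_pred j))// leqW.
  by case: (j) => // j'; rewrite /= leqW.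
have d4 : is_derive t (1 : R) (fun t => C j.+1 t (c - pi / 2))
   (j%:R * sigma * C j.-1.+1 t c + (sigma * C j t c + t * sigma * C j.+1 t (c + pi / 2))).
  have -> : (fun t => C j.+1 t (c - pi / 2)) =
     (j%:R * sigma) *: (fun t => C j.-1 t (c - pi / 2)) +
     (sigma *: (id : R -> R)) * (fun t => C j t c).
    apply/funext => u; rewrite (IH _ _ (ltnW jn)) !fctE /GRing.scale/= subrK.
    by ring.
  exact: is_derive_add_mulid d2 d3.
have := @derive_val _ _ _ _ _ _ _ d1; rewrite (@derive_val _ _ _ _ _ _ _ d4) subrK => <-.
by case: (j) => [|j']; rewrite /= -?natr1; ring.
Qed.

(** By the identity for monomials, the integral of [q^(2n) (1 - cos (t q))] is at most
    [K t^2]; dividing by [t^2] and letting [t] tend to zero, Fatou's lemma bounds the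
    moment of order [2n + 2]. *)
Lemma even_moments_step n : P.-integrable setT (EFin \o (fun x => q x ^+ n.*2)) ->
  P.-integrable setT (EFin \o (fun x => q x ^+ n.+1.*2)).
Proof.
move=> iq.
have q0 x : 0 <= q x ^+ n.*2 by rewrite -muln2 exprM sqr_ge0.
have ic t c : P.-integrable setT (EFin \o (fun x => q x ^+ n.*2 * cos (t * q x + c))).
  by apply: integrable_mul_cos iq; apply: measurable_funD => //; exact: measurable_funM.
have i1 t : P.-integrable setT (EFin \o (fun x => q x ^+ n.*2 * (1 - cos (t * q x)))).
  rewrite (_ : (fun x => _) = (fun x => q x ^+ n.*2 - q x ^+ n.*2 * cos (t * q x + 0))).
    exact: (integrableB measurableT iq (ic t 0)).
  by apply/funext => x; rewrite addr0; ring.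
(* For [n = 0] this is [1 - exp (- t^2 sigma / 2) <= t^2 sigma / 2]. *)
have [K KP] : exists K : R, forall t, 'E (fun x => q x ^+ n.*2 * (1 - cos (t * q x))) <= K * t ^+ 2.
  have E t : 'E (fun x => q x ^+ n.*2 * (1 - cos (t * q x))) = C n.*2 0 0 - C n.*2 t 0.
    rewrite /C -RintegralB//.
    by apply: eq_Rintegral => x _; rewrite mul0r !addr0 cos0; ring.
  case: n iq q0 ic i1 E => [|n] iq q0 ic i1 E.
    exists (sigma / 2) => t; rewrite E /C.
    have c0 u : 'E (fun x => q x ^+ 0 * cos (u * q x + 0)) = expR (- (u ^+ 2 * sigma) / 2).
      rewrite (_ : \int[P]_x _ = 'E (fun x => cos (u * q x + 0))).
        by rewrite charq cos0 mul1r.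
      by apply: eq_Rintegral => x _; rewrite expr0 mul1r.
    rewrite !c0 expr0n mul0r oppr0 mul0r expR0.
    by have := expR_ge1Dx (- (t ^+ 2 * sigma) / 2); lra.
  set M := 'E (fun x => q x ^+ n.+1.*2).
  exists (`|n.*2.+1%:R * sigma| * (M / 2) + `|sigma| * M) => t.
  rewrite E doubleS.
  have S u := @stein_pow n.+1 n.*2.+1 u 0 iq (leqnn _).
  rewrite (S 0) (S t) !mul0r addr0 /= opprD addrA -mulrBr.
  apply: (le_trans (ler_norm _)); rewrite [leRHS]mulrDl.
  apply: (le_trans (ler_normB _ _)).
  have ij j (u c : R) : (j <= n.+1.*2)%N ->
      P.-integrable setT (EFin \o (fun x => q x ^+ j * cos (u * q x + c))).
    move=> jn; apply: integrable_mul_cos (pow_integrable iq jn).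
    by apply: measurable_funD => //; exact: measurable_funM.
  apply: lerD.
    rewrite normrM -!mulrA ler_wpM2l//.
    have n2 : (n.*2 <= n.+1.*2)%N by rewrite leq_double.
    have iB := integrableB measurableT (ij _ 0 0 n2) (ij _ t 0 n2).
    rewrite /C -RintegralB//; [|exact: ij|exact: ij].
    apply: le_trans (le_normr_Rintegral measurableT iB) _.
    have -> : M * (2^-1 * t ^+ 2) = 'E (fun x => (t ^+ 2 / 2) * q x ^+ n.+1.*2).
      by rewrite RintegralZl//; rewrite -/M; ring.
    apply: le_Rintegral => //; [exact: integrable_norm iB|exact: (integrableZl measurableT _ iq)|].
    move=> x _; rewrite mul0r !addr0 cos0 -mulrBr normrM.
    rewrite (ger0_norm (one_minus_cos_ge0 _)) ger0_norm; last by rewrite -muln2 exprM sqr_ge0.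
    apply: le_trans (ler_wpM2l _ (one_minus_cos_le _)) _; first by rewrite -muln2 exprM sqr_ge0.
    by rewrite doubleS !exprS; rewrite le_eqVlt; apply/orP; left; apply/eqP; field.
  have i3 := ij n.*2.+1 t (0 + pi / 2) (leqnSn _).
  rewrite -mulrA mulrCA normrM -mulrA ler_wpM2l// normrM.
  have -> : M * t ^+ 2 = `|t| * ('E (fun x => `|t| * q x ^+ n.+1.*2)).
    by rewrite RintegralZl// -/M -[t ^+ 2]real_normK ?num_real// expr2; ring.
  rewrite ler_wpM2l//.
  apply: le_trans (le_normr_Rintegral measurableT i3) _.
  apply: le_Rintegral => //; [exact: integrable_norm i3|exact: (integrableZl measurableT _ iq)|].
  move=> x _; rewrite add0r cosD_pihalf normrM normrN normrX.
  apply: le_trans (ler_wpM2l _ (norm_sin_le _)) _; first exact: exprn_ge0.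
  rewrite normrM -[q x ^+ n.+1.*2]ger0_norm// normrX doubleS !exprS.
  by rewrite le_eqVlt; apply/orP; left; apply/eqP; ring.
pose f N x := q x ^+ n.*2 * (2 * (1 - cos (q x / N.+1%:R)) * N.+1%:R ^+ 2).
have f0 N x : 0 <= f N x by rewrite /f mulr_ge0// mulr_ge0 ?exprn_ge0// mulr_ge0// one_minus_cos_ge0.
have mf N : measurable_fun setT (f N).
  apply: measurable_funM; first exact: measurable_funX.
  apply: measurable_funM => //; apply: measurable_funM => //; apply: measurable_funB => //.
  by apply: measurable_cos_comp; exact: measurable_funM.
have fK N : (\int[P]_x (f N x)%:E <= (2 * K)%:E)%E.
  have iN : P.-integrable setT (EFin \o f N).
    rewrite (_ : f N = fun x => (2 * N.+1%:R ^+ 2) * (q x ^+ n.*2 * (1 - cos (N.+1%:R^-1 * q x)))).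
      exact: (integrableZl measurableT _ (i1 _)).
    by apply/funext => x; rewrite /f [q x / _]mulrC; ring.
  rewrite -(fineK (integrable_fin_num measurableT iN)) lee_fin -/(Rintegral _ _ _).
  rewrite (_ : \int[P]_x f N x = (2 * N.+1%:R ^+ 2) *
      'E (fun x => q x ^+ n.*2 * (1 - cos (N.+1%:R^-1 * q x)))); last first.
    rewrite -RintegralZl//; apply: eq_Rintegral => x _; rewrite /f [q x / _]mulrC; ring.
  apply: le_trans (ler_wpM2l _ (KP _)) _; first by rewrite mulr_ge0 ?sqr_ge0.
  have : N.+1%:R != 0 :> R by rewrite pnatr_eq0.
  move: (N.+1%:R : R) => z z0.
  by rewrite le_eqVlt; apply/orP; left; apply/eqP; field.
have lim x : limn_einf (fun N => (f N x)%:E) = (q x ^+ n.+1.*2)%:E.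
  apply: (cvg_limn_einf_sup _).1; apply/cvg_EFin; first exact: nearW.
  rewrite (_ : q x ^+ n.+1.*2 = q x ^+ n.*2 * q x ^+ 2); last by rewrite -exprD addn2.
  apply: cvgM; first exact: cvg_cst.
  exact: cvg_one_minus_cos.
have F : (\int[P]_x limn_einf (fun N => (f N x)%:E) <=
    limn_einf (fun N => \int[P]_x (f N x)%:E))%E.
  apply: fatou => // [N|N x _]; last by rewrite lee_fin.
  exact/measurable_EFinP.
have L : (limn_einf (fun N => \int[P]_x (f N x)%:E) <= (2 * K)%:E)%E.
  rewrite limn_einf_lim; apply: lime_le; first exact: is_cvg_einfs.
  apply: nearW => N; apply: le_trans (fK N).
  by apply: ereal_inf_lbound; exists N => /=.
apply/integrableP; split.
  by apply/measurable_EFinP; exact: measurable_funX.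
apply: le_lt_trans (ltry (2 * K)); apply: le_trans (le_trans F L).
rewrite le_eqVlt; apply/orP; left; apply/eqP; apply: eq_integral => x _.
by rewrite lim /= ger0_norm// -muln2 exprM sqr_ge0.
Qed.

Lemma allmom_of_char : allmom q.
Proof.
split => // n; apply: (@pow_integrable n); last by rewrite -addnn leq_addr.
elim: n => [|n IH]; last exact: even_moments_step.
exact: (prob_integrable_cst 1).
Qed.

End one_variable.

End moments.

(** * Gaussian integration by parts *)

Section gaussian_family.
Context d (T : measurableType d) (R : realType) (P : probability T R).
Variables (V : lmodType R) (ip : V -> V -> R) (Q : V -> T -> R).
Hypothesis ipDZ : forall s t a (c : R), ip s (t + c *: a) = ip s t + c * ip s a.
Hypothesis ipC : forall s t, ip s t = ip t s.
Hypothesis QDZ : forall s t (c : R) w, Q (s + c *: t) w = Q s w + c * Q t w.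
Hypothesis mQ : forall s, measurable_fun setT (Q s).
Hypothesis charQ : forall s c,
  \int[P]_w cos (Q s w + c) = cos c * expR (- ip s s / 2).
Implicit Types (f g : T -> R) (s a : V).
Local Notation "''E' f" := (\int[P]_x f x) (at level 10, f at level 8).

Lemma ip0 s : ip s 0 = 0.
Proof. by have := ipDZ s 0 0 (-1); rewrite scaler0 addr0 mulN1r subrr. Qed.

Lemma Q0 w : Q 0 w = 0.
Proof. by have := QDZ 0 0 (-1) w; rewrite scaler0 addr0 mulN1r subrr. Qed.

Lemma QZ c s w : Q (c *: s) w = c * Q s w.
Proof. by rewrite -[c *: s]add0r QDZ Q0 add0r. Qed.

Lemma ipZZ c s : ip (c *: s) (c *: s) = c ^+ 2 * ip s s.
Proof.
have ipZ t : ip t (c *: s) = c * ip t s by rewrite -[c *: s]add0r ipDZ ip0 add0r.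
by rewrite ipZ ipC ipZ mulrA -expr2.
Qed.

Lemma ipDZ2 s t (c : R) : ip (s + c *: t) (s + c *: t) =
  ip s s + c * (2 * ip t s) + c ^+ 2 * ip t t.
Proof. rewrite ipDZ ![ip (s + _) _]ipC !ipDZ [ip s t]ipC; ring. Qed.

Lemma allmom_Q s : allmom P (Q s).
Proof.
apply: (@allmom_of_char _ _ _ P _ (ip s s)) => // t c.
have := charQ (t *: s) c; rewrite ipZZ => <-.
by apply: eq_Rintegral => w _; rewrite QZ.
Qed.

(** Gaussian integration by parts for [f], with [g] in the role of the derivative of
    [f] in the direction [s].  Testing against all the cosines [cos (Q th + c)] makes
    the property stable under multiplication by [Q a] ([steinM]): one differentiates
    the identity in [th]. *)
Definition stein s f g := [/\ allmom P f, allmom P g & forall th c,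
  'E (fun w => Q s w * f w * cos (Q th w + c)) =
  'E (fun w => g w * cos (Q th w + c)) +
  ip s th * 'E (fun w => f w * cos (Q th w + c + pi / 2))].

Lemma measurable_Qc th c : measurable_fun setT (fun w => Q th w + c).
Proof. exact: measurable_funD. Qed.

Lemma is_derive_E f th a c : allmom P f ->
  is_derive (0 : R) (1 : R)
    (fun t => 'E (fun w => f w * cos (Q (th + t *: a) w + c)))
    ('E (fun w => f w * Q a w * cos (Q th w + c + pi / 2))).
Proof.
move=> fm.
have := @derive_integral_cos _ _ R P f (Q a) (fun w => Q th w + c) (mQ a)
  (measurable_Qc th c) (allmom_integrable fm)
  (allmom_integrable (allmomM fm (allmom_Q a))) 0.
set F := (X in is_derive _ _ X _ -> _); set G := (X in _ -> is_derive _ _ X _).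
have -> : F = G.
  apply/funext => t; apply: eq_Rintegral => w _; rewrite QDZ.
  by congr (_ * cos _); ring.
rewrite (_ : \int[P]_x _ = 'E (fun w => f w * Q a w * cos (Q th w + c + pi / 2)))//.
by apply: eq_Rintegral => w _; congr (_ * cos _); ring.
Qed.

(** The derivative of the characteristic functional at [th] in the direction [s]. *)
Lemma stein1 s : stein s (cst 1) (cst 0).
Proof.
split; [exact: allmom_cst|exact: allmom_cst|move=> th c].
have d1 := @is_derive_E (cst 1) th s (c - pi / 2) (allmom_cst _ 1).
have d2 : is_derive (0 : R) (1 : R)
    (fun t => 'E (fun w => cst 1 w * cos (Q (th + t *: s) w + (c - pi / 2))))
    (- ip s th * (cos (c - pi / 2) * expR (- ip th th / 2))).
  pose h : R -> R := fun t => - ip th th / 2 + t * (- ip s th) + t ^+ 2 * (- ip s s / 2).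
  have dh : is_derive (0 : R) (1 : R) h (- ip s th).
    pose p : {poly R} := (- ip th th / 2)%:P + (- ip s th) *: 'X + (- ip s s / 2) *: 'X^2.
    have -> : h = horner p.
      by apply/funext => t; rewrite /h /p !(hornerD, hornerZ, hornerC, hornerX, hornerXn); ring.
    have := is_derive_poly p 0; rewrite /p !(derivD, derivZ, derivC, derivX, derivXn) => dp.
    apply: (is_derive_eq dp).
    rewrite !(hornerD, hornerZ, hornerMn, hornerXn) -polyC1 !hornerC /= expr1.
    by rewrite mulr2n; ring.
  have de : is_derive (0 : R) (1 : R) (expR \o h) (expR (h 0) * (- ip s th)).
    exact: is_derive1_comp.
  have -> : (fun t => 'E (fun w => cst 1 w * cos (Q (th + t *: s) w + (c - pi / 2)))) =
     cos (c - pi / 2) *: (expR \o h).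
    apply/funext => t; rewrite fctE /= /GRing.scale/=.
    rewrite (_ : \int[P]_w _ = 'E (fun w => cos (Q (th + t *: s) w + (c - pi / 2)))).
      by rewrite charQ ipDZ2; congr (_ * expR _); rewrite /h; field.
    by apply: eq_Rintegral => w _; rewrite mul1r.
  apply: (is_derive_eq (is_deriveZ (cos (c - pi / 2)) de)).
  by rewrite /h /GRing.scale/= mul0r expr0n mul0r !addr0; ring.
have := @derive_val _ _ _ _ _ _ _ d1; rewrite (@derive_val _ _ _ _ _ _ _ d2).
rewrite -charQ => h.
transitivity ('E (fun w => cst 1 w * Q s w * cos (Q th w + (c - pi / 2) + pi / 2))).
  by apply: eq_Rintegral => w _; rewrite mul1r mulr1; congr (_ * cos _); ring.
rewrite -h [X in _ = X + _](_ : _ = 0) ?add0r; last first.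
  by under eq_Rintegral do rewrite /= mul0r; rewrite Rintegral_cst//= mul0r.
rewrite mulNr -mulrN; congr (_ * _).
rewrite -mulN1r -RintegralZl//; last first.
  have : P.-integrable setT (EFin \o (fun w => 1 * cos (Q th w + (c - pi / 2)))).
    by apply: (integrable_mul_cos (measurable_Qc _ _)); exact: prob_integrable_cst.
  by under eq_fun do rewrite mul1r.
apply: eq_Rintegral => w _; rewrite mul1r.
have -> : Q th w + c + pi / 2 = Q th w + (c - pi / 2) + pi by field.
by rewrite cosDpi; ring.
Qed.

(** Differentiate the identity for [f] at [th + t a], phase [c - pi / 2], in [t = 0].
    The derivative of the factor [ip s (th + t a)] is the new term [ip s a * f]. *)
Lemma steinM s a f g : stein s f g ->
  stein s (fun w => Q a w * f w) (fun w => ip s a * f w + Q a w * g w).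
Proof.
move=> [fm gm E].
have am := allmom_Q a; have sm := allmom_Q s.
have afm := allmomM am fm; have agm := allmomM am gm.
split=> //; first by apply: allmomD => //; exact: allmomZ.
move=> th c.
have d1 := is_derive_E th a (c - pi / 2) (allmomM sm fm).
have d2 := is_derive_E th a (c - pi / 2) gm.
have d3 := is_derive_E th a (c - pi / 2 + pi / 2) fm.
have d4 := is_derive_add_mulid 1 (ip s a) (is_deriveD d2 (is_deriveZ (ip s th) d3)) d3.
have := @derive_val _ _ _ _ _ _ _ d1.
set F := (X in is_derive _ _ X _) in d1.
rewrite -/F.
set G := (X in is_derive _ _ X _) in d4.
have -> : F = G.
  apply/funext => t; rewrite /F /G E ipDZ.
  rewrite [RHS](_ : _ = 'E (fun w => g w * cos (Q (th + t *: a) w + (c - pi / 2))) +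
    (ip s th + t * ip s a) * 'E (fun w => f w * cos (Q (th + t *: a) w + (c - pi / 2 + pi / 2)))); last first.
    pose A := 'E (fun w => g w * cos (Q (th + t *: a) w + (c - pi / 2))).
    pose B := 'E (fun w => f w * cos (Q (th + t *: a) w + (c - pi / 2 + pi / 2))).
    by transitivity (1 * (A + ip s th * B) + (ip s a * t) * B) => //; rewrite -/A -/B; ring.
  congr (_ + _ * _); apply: eq_Rintegral => w _.
  by rewrite -[in LHS]addrA.
rewrite (@derive_val _ _ _ _ _ _ _ d4) => h.
transitivity ('E (fun w => Q s w * f w * Q a w * cos (Q th w + (c - pi / 2) + pi / 2))).
  by apply: eq_Rintegral => w _; rewrite mulrCA mulrA [_ * Q a w]mulrC -mulrA addrA subrK.
rewrite -h.
have ic f0 : allmom P f0 -> P.-integrable setT (EFin \o (fun w => f0 w * cos (Q th w + c))).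
  move=> f0m; apply: (integrable_mul_cos (measurable_Qc _ _)).
  exact: allmom_integrable.
have -> : 'E (fun w => (ip s a * f w + Q a w * g w) * cos (Q th w + c)) =
   ip s a * 'E (fun w => f w * cos (Q th w + c)) + 'E (fun w => Q a w * g w * cos (Q th w + c)).
  rewrite -RintegralZl//; last exact: ic.
  rewrite -RintegralD//; [|exact: (integrableZl measurableT _ (ic _ fm))|exact: ic].
  by apply: eq_Rintegral => w _; rewrite mulrDl mulrA.
rewrite scale0r addr0 !mul0r addr0 mul1r subrK /GRing.scale/=.
rewrite [LHS]addrC addrA; congr (_ + _ + _ * _); apply: eq_Rintegral => w _.
  by rewrite addrA subrK [g w * _]mulrC.
by rewrite [f w * _]mulrC.
Qed.

Lemma steinD s f g f' g' : stein s f g -> stein s f' g' ->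
  stein s (fun w => f w + f' w) (fun w => g w + g' w).
Proof.
move=> [fm gm E] [fm' gm' E']; split; [exact: allmomD|exact: allmomD|].
move=> th c; have sm := allmom_Q s.
have ic f0 (e : R) : allmom P f0 -> P.-integrable setT (EFin \o (fun w => f0 w * cos (Q th w + e))).
  move=> f0m; apply: (integrable_mul_cos (measurable_Qc _ _)).
  exact: allmom_integrable.
have icp f0 : allmom P f0 -> P.-integrable setT (EFin \o (fun w => f0 w * cos (Q th w + c + pi / 2))).
  by move=> /(ic _ (c + pi / 2)); under eq_fun do rewrite addrA.
have D (f1 f2 : T -> R) (k : T -> R) : P.-integrable setT (EFin \o (fun w => f1 w * k w)) ->
    P.-integrable setT (EFin \o (fun w => f2 w * k w)) ->
   'E (fun w => (f1 w + f2 w) * k w) = 'E (fun w => f1 w * k w) + 'E (fun w => f2 w * k w).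
  move=> i1 i2; rewrite -RintegralD//.
  by apply: eq_Rintegral => w _; rewrite mulrDl.
under eq_Rintegral do rewrite mulrDr.
rewrite !D; try solve [exact: icp | exact: ic | by apply: ic; exact: allmomM].
by rewrite E E'; ring.
Qed.

Lemma steinZ s f g (k : R) : stein s f g ->
  stein s (fun w => k * f w) (fun w => k * g w).
Proof.
move=> [fm gm E]; split; [exact: allmomZ|exact: allmomZ|].
move=> th c; have sm := allmom_Q s.
have ic f0 (e : R) : allmom P f0 -> P.-integrable setT (EFin \o (fun w => f0 w * cos (Q th w + e))).
  move=> f0m; apply: (integrable_mul_cos (measurable_Qc _ _)).
  exact: allmom_integrable.
have icp f0 : allmom P f0 -> P.-integrable setT (EFin \o (fun w => f0 w * cos (Q th w + c + pi / 2))).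
  by move=> /(ic _ (c + pi / 2)); under eq_fun do rewrite addrA.
have Z (f1 : T -> R) (h : T -> R) : P.-integrable setT (EFin \o (fun w => f1 w * h w)) ->
   'E (fun w => (k * f1 w) * h w) = k * 'E (fun w => f1 w * h w).
  move=> i1; rewrite -RintegralZl//.
  by apply: eq_Rintegral => w _; rewrite mulrA.
under eq_Rintegral do rewrite mulrCA.
rewrite !Z; try solve [exact: icp | exact: ic | by apply: ic; exact: allmomM].
by rewrite E; ring.
Qed.

Lemma stein_poly s a (p : {poly R}) f g : stein s f g ->
  stein s (fun w => p.[Q a w] * f w)
    (fun w => ip s a * (p^`()).[Q a w] * f w + p.[Q a w] * g w).
Proof.
move=> S; elim/poly_ind: p => [|p c IH].
  have := steinZ 0 S.
  set F := (X in stein _ X _ -> _); set G := (X in stein _ _ X -> _).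
  congr stein; apply/funext => w; rewrite /F /G ?deriv0 !horner0; ring.
have := steinD (steinM a IH) (steinZ c S).
set F := (X in stein _ X _ -> _); set G := (X in stein _ _ X -> _).
congr stein; apply/funext => w; rewrite /F /G.
  by rewrite hornerMXaddC; ring.
by rewrite !(derivD, derivM, derivX, derivC) !(hornerD, hornerM, hornerX, hornerC); ring.
Qed.

Lemma stein_E s f g : stein s f g -> 'E (fun w => Q s w * f w) = 'E g.
Proof.
move=> [_ _ /(_ 0 0)]; rewrite ip0 mul0r addr0.
under eq_Rintegral do rewrite Q0 addr0 cos0 mulr1.
by move=> ->; apply: eq_Rintegral => w _; rewrite Q0 addr0 cos0 mulr1.
Qed.

Variable e : nat -> V.
Hypothesis ipe : forall j k, ip (e j) (e k) = (j == k)%:R.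

Definition prodQ (l : seq nat) (p : nat -> {poly R}) (w : T) : R :=
  \prod_(j <- l) (p j).[Q (e j) w].

Lemma prodQ_subst l p k r w : uniq l -> k \in l ->
  prodQ l (fun j => if j == k then r else p j) w =
  r.[Q (e k) w] * \prod_(j <- l | j != k) (p j).[Q (e j) w].
Proof.
move=> ul kl; rewrite /prodQ (bigD1_seq k)//= eqxx; congr (_ * _).
by apply: eq_bigr => j /negPf ->.
Qed.

(** The Leibniz rule for the derivative of a product in the direction [s]. *)
Lemma stein_prodQ s l p : uniq l -> stein s (prodQ l p)
  (fun w => \sum_(k <- l) ip s (e k) *
     prodQ l (fun j => if j == k then (p j)^`() else p j) w).
Proof.
elim: l => [_|k l IH /andP[kl ul]].
  have := stein1 s.
  by congr stein; apply/funext => w; rewrite ?/prodQ !big_nil.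
have := stein_poly (e k) (p k) (IH ul).
congr stein; apply/funext => w; first by rewrite /prodQ big_cons.
rewrite big_cons /prodQ big_cons eqxx mulrA; congr (_ * _ + _).
  rewrite big_seq [RHS]big_seq; apply: eq_bigr => j jl.
  by case: eqP => // jk; rewrite -jk jl in kl.
rewrite mulr_sumr; apply: eq_big_seq => j jl.
rewrite big_cons; case: eqP => [jk|_]; first by rewrite jk jl in kl.
by rewrite mulrCA.
Qed.

(** By [He_(n+1) = X He_n - He_n'] the product is, up to the factor [c], equal to
    [Q_k F - F'], where [F] has [He_n] in position [k] and [F'] is its derivative in
    the direction [e k]; orthogonality of the other directions makes the two
    expectations equal. *)
Lemma E_prodQ_hermite l p k (c : R) n : uniq l -> k \in l ->
  p k = c *: hermite R n.+1 -> 'E (prodQ l p) = 0.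
Proof.
move=> ul kl pk.
pose q j := if j == k then hermite R n else p j.
have [qm dm _] := stein_prodQ (e k) q ul.
have := stein_E (stein_prodQ (e k) q ul).
have -> : (fun w => \sum_(k0 <- l) ip (e k) (e k0) *
     prodQ l (fun j => if j == k0 then (q j)^`() else q j) w) =
   prodQ l (fun j => if j == k then (hermite R n)^`() else p j).
  apply/funext => w; rewrite (bigD1_seq k)//= ipe eqxx mul1r big1 ?addr0; last first.
    by move=> j jk; rewrite ipe eq_sym (negPf jk) mul0r.
  by apply: eq_bigr => j _; rewrite /q; case: eqP.
move=> h.
have dm' : allmom P (prodQ l (fun j => if j == k then (hermite R n)^`() else p j)).
  move: dm; congr allmom.
  apply/funext => w; rewrite (bigD1_seq k)//= ipe eqxx mul1r big1 ?addr0; last first.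
    by move=> j jk; rewrite ipe eq_sym (negPf jk) mul0r.
  by apply: eq_bigr => j _; rewrite /q; case: eqP.
transitivity ('E (fun w => c * (Q (e k) w * prodQ l q w -
   prodQ l (fun j => if j == k then (hermite R n)^`() else p j) w))).
  apply: eq_Rintegral => w _; rewrite !prodQ_subst// /prodQ (bigD1_seq k)//= pk.
  rewrite (_ : hermite R n.+1 = 'X * hermite R n - (hermite R n)^`())//.
  by rewrite !(hornerD, hornerN, hornerM, hornerX, hornerC, hornerZ); ring.
have i1 := allmom_integrable (allmomM (allmom_Q (e k)) qm).
have i2 := allmom_integrable dm'.
rewrite RintegralZl//; last exact: (integrableB measurableT i1 i2).
by rewrite RintegralB// h subrr mulr0.
Qed.

(** Integration by parts lowers one Hermite index, and by the preceding lemma only the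
    empty product has nonzero expectation. *)
Lemma E_Q_prodQ s l (al : nat -> nat) : uniq l ->
  'E (fun w => Q s w * prodQ l (fun j => hermite R (al j)) w) =
  \sum_(k <- l) ip s (e k) * (all (fun j => al j == (j == k)) l)%:R.
Proof.
move=> ul; have S := stein_prodQ s (fun j => hermite R (al j)) ul.
pose G k := prodQ l (fun j => if j == k then (hermite R (al j))^`() else hermite R (al j)).
rewrite (stein_E S).
have Gm k : k \in l -> allmom P (G k).
  have [_ + _] := stein_prodQ (e k) (fun j => hermite R (al j)) ul.
  move=> + kl; congr allmom.
  apply/funext => w; rewrite (bigD1_seq k)//= ipe eqxx mul1r big1 ?addr0//.
  by move=> j jk; rewrite ipe eq_sym (negPf jk) mul0r.
have sumE (l' : seq nat) : {subset l' <= l} ->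
    allmom P (fun w => \sum_(k <- l') ip s (e k) * G k w) /\
    'E (fun w => \sum_(k <- l') ip s (e k) * G k w) = \sum_(k <- l') ip s (e k) * 'E (G k).
  elim: l' => [_|k l' IH kl].
    rewrite big_nil; split.
      have := allmom_cst P 0; congr allmom; apply/funext => w; by rewrite big_nil.
    by under eq_Rintegral do rewrite big_nil; rewrite Rintegral_cst//= mul0r.
  have [im iE] : allmom P (fun w => \sum_(k <- l') ip s (e k) * G k w) /\
     'E (fun w => \sum_(k <- l') ip s (e k) * G k w) = \sum_(k <- l') ip s (e k) * 'E (G k).
    by apply: IH => j jl; apply: kl; rewrite inE jl orbT.
  have km := Gm k (kl k (mem_head _ _)); split.
    have := allmomD (allmomZ (ip s (e k)) km) im; congr allmom.
    by apply/funext => w; rewrite big_cons.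
  under eq_Rintegral do rewrite big_cons.
  have ik := allmom_integrable km.
  rewrite RintegralD//; last 2 first.
  - exact: (integrableZl measurableT _ ik).
  - exact: (allmom_integrable im).
  by rewrite RintegralZl// big_cons iE.
rewrite (sumE l (fun _ x => x)).2 big_seq [RHS]big_seq.
apply: eq_bigr => k kl; congr (_ * _).
case: (boolP (all _ _)) => [/allP h|].
  rewrite (_ : \int[P]_w _ = 'E (cst 1)).
    by rewrite Rintegral_cst//= mul1r probability_setT.
  apply: eq_Rintegral => w _; rewrite /G /prodQ big_seq big1// => j jl.
  have /eqP -> := h j jl.
  case: eqP => [jk|jk]; last by rewrite -[hermite R false]polyC1 hornerC.
  by rewrite (deriv_hermite 0) scale1r -[hermite R 0]polyC1 hornerC.
rewrite -has_predC => /hasP[j jl /= aj].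
case: (eqVneq j k) => [jk|jk].
  subst j; rewrite eqxx /= in aj.
  case E : (al k) => [|[|n]]; last 2 first.
  - by rewrite E in aj.
  - rewrite /G.
    apply: (@E_prodQ_hermite l _ k n.+2%:R n ul kl).
    by rewrite eqxx E deriv_hermite.
  rewrite (_ : \int[P]_w _ = 'E (cst 0)).
    by rewrite Rintegral_cst//= mul0r.
  apply: eq_Rintegral => w _; rewrite /G /prodQ (bigD1_seq k)//= eqxx E /=.
  by rewrite derivC horner0 mul0r.
case E : (al j) => [|n]; first by rewrite E (negPf jk) in aj.
apply: (@E_prodQ_hermite l _ j 1 n ul jl).
by rewrite (negPf jk) E scale1r.
Qed.

End gaussian_family.

(** * Chaos coefficients of the increments of the process *)

Section white_noise_chaos.
Context (R : realType) (P : probability (white_noise_space R) R).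
Hypothesis wnP : is_white_noise P.
Local Notation mu := (@lebesgue_measure R).
Local Notation Omega := (white_noise_space R).
Implicit Types s t : schwartz R.

(** Evaluation is continuous for the weak-* topology. *)
Lemma measurable_eval s : measurable_fun setT (fun w : Omega => w s).
Proof.
apply: (measurability _ (RGenOpens.measurableE R)) => _ [_ [a [b ->] <-]].
rewrite setTI; apply: sub_sigma_algebra.
have : continuous (fun w : tempered R => w s).
  move=> w.
  apply: (@continuous_comp _ _ _ (@tempered_eval R) (fun f : {ptws schwartz R -> R} => f s)).
    exact: initial_continuous.
  exact: (@proj_continuous (schwartz R) (fun=> R) s).
move/continuousP; apply; exact: interval_open.
Qed.

Definition L2ip s t : R := \int[mu]_x (s x * t x).

Lemma L2ipDZ s t u (c : R) : L2ip s (t + c *: u) = L2ip s t + c * L2ip s u.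
Proof.
have i1 := schwartz_mul_integrable s t.
have i2 := schwartz_mul_integrable s u.
rewrite /L2ip -RintegralZl// -RintegralD//; last exact: (integrableZl measurableT _ i2).
by apply: eq_Rintegral => x _ /=; rewrite !fctE /GRing.scale/=; ring.
Qed.

Lemma L2ipC s t : L2ip s t = L2ip t s.
Proof. by apply: eq_Rintegral => x _; rewrite mulrC. Qed.

(** The imaginary part of the characteristic functional gives [E sin = 0], so that the
    phase factors out. *)
Lemma white_noise_char s (c : R) :
  \int[P]_w cos (w s + c) = cos c * expR (- L2ip s s / 2).
Proof.
have /eqP := wnP s; rewrite eq_complex /= => /andP[/eqP hc /eqP hs].
have ms : measurable_fun setT (fun w : Omega => w s) := measurable_eval s.
have ic : P.-integrable setT (EFin \o (fun w : Omega => cos (w s))).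
  have := integrable_mul_cos ms (prob_integrable_cst P 1).
  by congr (integrable _ _ _); apply/funext => w /=; rewrite mul1r.
have is_ : P.-integrable setT (EFin \o (fun w : Omega => sin (w s))).
  have mt : measurable_fun setT (fun w : Omega => w s - pi / 2) by exact: measurable_funB.
  have := integrable_mul_cos mt (prob_integrable_cst P 1).
  by congr (integrable _ _ _); apply/funext => w /=; rewrite mul1r cosB cos_pihalf sin_pihalf mulr0 add0r mulr1.
transitivity (\int[P]_w (cos c * cos (w s) - sin c * sin (w s))).
  by apply: eq_Rintegral => w _; rewrite cosD; ring.
have ic' := integrableZl measurableT (cos c) ic.
have is' := integrableZl measurableT (sin c) is_.
rewrite RintegralB// RintegralZl// RintegralZl// hc hs mulr0 subr0.
by congr (_ * expR (- _ / 2)); apply: eq_Rintegral => x _; rewrite expr2.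
Qed.

Lemma allmom_Halpha al : allmom P (Halpha al).
Proof.
have lin s t (c : R) (w : Omega) : w (s + c *: t) = w s + c * w t by rewrite linearD linearZ.
by have [] := stein_prodQ L2ipDZ L2ipC lin measurable_eval white_noise_char
  (hermite_schwartz R) 0 (fun k => hermite R (al k)) (fset_uniq (finsupp al)).
Qed.

Lemma E_eval_Halpha s al : \int[P]_w (w s * Halpha al w) =
  \sum_(k <- finsupp al) L2ip s (hermite_schwartz R k) *
     (all (fun j => al j == (j == k) :> nat) (finsupp al))%:R.
Proof.
have lin s1 t (c : R) (w : Omega) : w (s1 + c *: t) = w s1 + c * w t by rewrite linearD linearZ.
have oe j k : L2ip (hermite_schwartz R j) (hermite_schwartz R k) = (j == k)%:R.
  exact: hermite_fun_orthonormal.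
exact: (E_Q_prodQ L2ipDZ L2ipC lin measurable_eval white_noise_char oe s al (fset_uniq _)).
Qed.

Lemma finsupp_meps k : finsupp (meps k) = [fset k]%fset.
Proof.
apply/fsetP => j; rewrite mem_finsupp mepsE inE.
by case: (j == k).
Qed.

Lemma E_eval_meps s k :
  \int[P]_w (w s * Halpha (meps k) w) = \int[mu]_x (s x * hermite_fun R k x).
Proof.
rewrite E_eval_Halpha finsupp_meps big_seq_fset1.
rewrite (_ : all _ _ = true) ?mulr1//.
by apply/allP => j _; rewrite mepsE.
Qed.

Lemma E_eval_out s al : (forall k, meps k != al) -> \int[P]_w (w s * Halpha al w) = 0.
Proof.
move=> hal; rewrite E_eval_Halpha big_seq big1// => k kal.
case: (boolP (all _ _)) => [/allP h|_]; last by rewrite mulr0.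
have /eqP[] := hal k; apply/fsfunP => j; rewrite mepsE.
have [jal|/negPf jal] := boolP (j \in finsupp al); first by rewrite (eqP (h j jal)).
rewrite fsfun_dflt ?jal//; case: eqP => // jk.
by rewrite jk kal in jal.
Qed.

(** Both pairings are continuous in [L^2], so that identities for Schwartz functions
    pass to the limit along the sequence defining [Q_f]. *)
Lemma is_Q_limit f X al : is_Q P f X -> exists2 s : nat -> schwartz R,
  (forall k, \int[mu]_x (s n x * hermite_fun R k x) @[n --> \oo] -->
     \int[mu]_x (f x * hermite_fun R k x)) &
  \int[P]_w (w (s n) * Halpha al w) @[n --> \oo] --> \int[P]_w (X w * Halpha al w).
Proof.
move=> [fL XL [s [sf sX]]]; exists s => [k|].
  have hL := schwartz_Lfun2 (hermite_schwartz R k).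
  apply: (@Lfun2_cvg_mul _ _ _ mu s f (hermite_fun R k)) => //.
  - by move=> n; exact: schwartz_measurable.
  - exact: Lfun2_measurable fL.
  - by move=> n; have := schwartz_mul_integrable (s n) (hermite_schwartz R k).
  - exact: Lfun2_mul_integrable.
have HL := allmom_Lfun2 (allmom_Halpha al).
apply: (@Lfun2_cvg_mul _ _ _ P (fun n (w : Omega) => w (s n)) X (Halpha al)) => //.
- by move=> n; exact: measurable_eval.
- exact: Lfun2_measurable XL.
- move=> n; apply: Lfun2_mul_integrable => //.
  have lin s1 t (c : R) (w : Omega) : w (s1 + c *: t) = w s1 + c * w t by rewrite linearD linearZ.
  exact: (allmom_Lfun2 (allmom_Q L2ipDZ L2ipC lin measurable_eval white_noise_char (s n))).
- exact: Lfun2_mul_integrable.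
Qed.

Lemma is_Q_meps f X k : is_Q P f X ->
  \int[P]_w (X w * Halpha (meps k) w) = \int[mu]_x (f x * hermite_fun R k x).
Proof.
move=> /(is_Q_limit (meps k))[s sf sX].
apply: (cvg_unique (@Rhausdorff R) sX).
rewrite /= (_ : (fun n => _) = fun n => \int[mu]_x (s n x * hermite_fun R k x)); first exact: sf.
by apply/funext => n; exact: E_eval_meps.
Qed.

Lemma is_Q_out f X al : is_Q P f X -> (forall k, meps k != al) ->
  \int[P]_w (X w * Halpha al w) = 0.
Proof.
move=> /(is_Q_limit al)[s sf sX] hal.
apply: (cvg_unique (@Rhausdorff R) sX).
rewrite /= (_ : (fun n => _) = cst 0); first exact: cvg_cst.
by apply/funext => n; exact: E_eval_out.
Qed.

Lemma chaos_coef_increment m X (s t : R) : admissible m -> is_Xm P m X -> s <= t ->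
  chaos_coef P (X t \- X s) =
  fchaos (fun k => \int[mu]_(x in `[s, t]) Tm_schwartz m (hermite_schwartz R k) x).
Proof.
move=> am XP st.
have [gt Tt Qt] := XP t; have [gs Ts Qs] := XP s.
have E al : chaos_coef P (X t \- X s) al =
   (\int[P]_w (X t w * Halpha al w) - \int[P]_w (X s w * Halpha al w)) / (mfact al)%:R.
  rewrite /chaos_coef; congr (_ / _).
  have HL := allmom_Lfun2 (allmom_Halpha al).
  have [_ XtL _] := Qt; have [_ XsL _] := Qs.
  rewrite -RintegralB//; [|exact: Lfun2_mul_integrable..].
  by apply: eq_Rintegral => w _; rewrite /= mulrBl.
apply: fchaosE => [k|al hal]; rewrite E.
  rewrite !(is_Q_meps _ Qt) !(is_Q_meps _ Qs) (Tm_pairing_increment am k st Ts Tt).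
  rewrite (_ : mfact (meps k) = 1%N) ?divr1//.
  by rewrite /mfact finsupp_meps big_seq_fset1 mepsE eqxx.
by rewrite (is_Q_out Qt hal) (is_Q_out Qs hal) subrr mul0r.
Qed.

End white_noise_chaos.

(** * Riemann integrals in the dual Kondratiev spaces *)

Section partitions.
Context (R : realType).
Local Notation mu := (@lebesgue_measure R).
Implicit Types (a b : R) (s : seq R) (f : R -> R).

Lemma pt_last a b s : itv_partition a b s -> pt a s (size s) = b.
Proof. by move=> [_ /eqP <-]; exact: (nth_last 0 (a :: s)). Qed.

Lemma pt_lt a b s k : itv_partition a b s -> (k < size s)%N -> pt a s k < pt a s k.+1.
Proof. by move=> [/(pathP 0) h _] ks; exact: h. Qed.

Lemma pt_in a b s k : itv_partition a b s -> (k <= size s)%N -> a <= pt a s k <= b.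
Proof.
move=> abs ks; rewrite /pt (set_nth_default b)//.
by rewrite itv_partition_nth_ge// itv_partition_nth_le.
Qed.

Lemma sum_pt a b s : itv_partition a b s ->
  \sum_(k < size s) (pt a s k.+1 - pt a s k) = b - a.
Proof.
move=> abs; rewrite -(pt_last abs) -(big_mkord xpredT (fun k => pt a s k.+1 - pt a s k)).
by rewrite telescope_sumr.
Qed.

Lemma le_mesh a s k : (k < size s)%N -> pt a s k.+1 - pt a s k <= mesh a s.
Proof.
move=> ks; exact: (le_bigmax _ (fun k : 'I_(size s) => pt a s k.+1 - pt a s k) (Ordinal ks)).
Qed.

Lemma Rintegral_itv_cst (c d r : R) : c <= d ->
  \int[mu]_(t in `[c, d]) r = r * (d - c).
Proof.
move=> cd; have := @Rintegral_cst _ _ R mu `[c, d] (measurable_itv _) r.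
rewrite /= => ->; rewrite lebesgue_measure_itv/= lte_fin.
case: (ltP c d) => [cd'|dc] //=.
have -> : d = c by apply/le_anti; rewrite dc cd.
by rewrite subrr.
Qed.

Lemma integrable_subitv f a b c d : a <= c -> d <= b ->
  mu.-integrable `[a, b] (EFin \o f) -> mu.-integrable `[c, d] (EFin \o f).
Proof.
move=> ac db; apply: integrableS => //.
by apply: subset_itv; rewrite bnd_simp.
Qed.

Lemma Rintegral_partition f a b s : mu.-integrable `[a, b] (EFin \o f) ->
  itv_partition a b s -> \int[mu]_(t in `[a, b]) f t =
  \sum_(k < size s) \int[mu]_(t in `[pt a s k, pt a s k.+1]) f t.
Proof.
move=> fi abs; rewrite -[in LHS](pt_last abs).
suff H n : (n <= size s)%N -> \int[mu]_(t in `[a, pt a s n]) f t =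
    \sum_(k < n) \int[mu]_(t in `[pt a s k, pt a s k.+1]) f t by exact: H.
elim: n => [_|n IH ns].
  by rewrite big_ord0 /pt /= set_itv1 Rintegral_set1.
have /andP[_ nb] := pt_in abs ns.
have /andP[an _] := pt_in abs (ltnW ns).
rewrite (@Rintegral_itv_add _ _ a (pt a s n))//; last 2 first.
- by rewrite ltW// (pt_lt abs).
- exact: integrable_subitv fi.
by rewrite big_ord_recr /= IH// ltnW.
Qed.

End partitions.

Section riemann_integral.
Context (R : realType) (p : nat).
Local Notation mu := (@lebesgue_measure R).
Implicit Types (G : multi_index -> R) (c d : R).

Lemma bnd_mono q q' G M : (q <= q')%N -> bnd q G M -> bnd q' G M.
Proof.
move=> qq h A; apply: le_trans (h A); apply: ler_sum => al _.
rewrite ler_wpM2l ?sqr_ge0// lef_pV2 ?posrE ?exprn_gt0 ?ltr0n ?m2N_gt0//.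
by rewrite ler_weXn2l// ler1n m2N_gt0.
Qed.

Lemma Rintegral_sum_seq (T : Type) (s : seq T) (F : T -> R -> R) c d :
  (forall x, mu.-integrable `[c, d] (EFin \o F x)) ->
  mu.-integrable `[c, d] (EFin \o (fun t => \sum_(x <- s) F x t)) /\
  \int[mu]_(t in `[c, d]) (\sum_(x <- s) F x t) = \sum_(x <- s) \int[mu]_(t in `[c, d]) F x t.
Proof.
move=> Fi;
elim: s => [|x s [IHi IHE]].
  split.
    have := integrable0 mu `[c, d]; congr (integrable _ _ _).
    by apply/funext => t; rewrite /= big_nil.
  rewrite big_nil; under eq_Rintegral do rewrite big_nil.
  by rewrite /Rintegral integral0.
split.
  have := @integrableD _ _ R mu _ (measurable_itv _) _ _ (Fi x) IHi; congr (integrable _ _ _).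
  by apply/funext => t; rewrite /= big_cons.
under eq_Rintegral do rewrite big_cons.
by rewrite RintegralD// big_cons IHE.
Qed.

(** Minkowski's integral inequality by duality: with [I] the integral and [S] its
    squared norm, [S] is the integral of the pairing of [I] with [psi t], which is at
    most [sqrt S * e] for every [t]. *)
Lemma bnd_Rintegral (psi : R -> multi_index -> R) c d e : c <= d -> 0 <= e ->
  (forall ga, mu.-integrable `[c, d] (EFin \o (psi ^~ ga))) ->
  (forall t, c <= t <= d -> bnd p (psi t) e) ->
  bnd p (fun ga => \int[mu]_(t in `[c, d]) psi t ga) ((d - c) * e).
Proof.
move=> cd e0 psii h A.
pose I ga := \int[mu]_(t in `[c, d]) psi t ga.
pose W ga : R := (m2N ga)%:R ^- p.
pose S := \sum_(ga <- A) I ga ^+ 2 * W ga.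
have W0 ga : 0 < W ga by exact: wt_gt0.
have S0 : 0 <= S by apply: sumr_ge0 => ga _; rewrite mulr_ge0 ?sqr_ge0// ltW.
pose F ga t := (I ga * W ga) * psi t ga.
have Fi ga : mu.-integrable `[c, d] (EFin \o F ga).
  exact: (@integrableZl _ _ R mu _ (measurable_itv _) _ _ (psii ga)).
have [Si SE] := Rintegral_sum_seq A Fi.
have q0 := sqrtr_ge0 S; have qS := sqr_sqrtr S0.
set q := Num.sqrt S in q0 qS.
have le1 : S <= q * ((d - c) * e).
  have -> : S = \int[mu]_(t in `[c, d]) \sum_(ga <- A) F ga t.
    rewrite SE; apply: eq_bigr => ga _.
    by rewrite /F RintegralZl//; rewrite -/(I ga); ring.
  have -> : q * ((d - c) * e) = \int[mu]_(t in `[c, d]) (q * e).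
    by rewrite Rintegral_itv_cst//; ring.
  apply: le_Rintegral => //.
    exact: continuous_itv_integrable (@cst_continuous _ _ _).
  move=> t tcd; apply: le_trans (ler_norm _) _.
  rewrite -ler_sqr ?nnegrE ?mulr_ge0// real_normK ?num_real//.
  have V0 ga : 0 < (m2N ga)%:R ^+ p :> R by rewrite exprn_gt0// ltr0n m2N_gt0.
  apply: le_trans (cauchy_schwarz_sum _ _ _ V0) _.
  rewrite [leRHS]exprMn qS ler_pM//.
  - by apply: sumr_ge0 => ga _; rewrite mulr_ge0 ?sqr_ge0// ltW.
  - by apply: sumr_ge0 => ga _; rewrite mulr_ge0 ?sqr_ge0// invr_ge0 ltW.
  - rewrite le_eqVlt; apply/orP; left; apply/eqP; apply: eq_bigr => ga _.
    by rewrite /W; field; rewrite gt_eqF.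
  - by apply: h; move: tcd; rewrite /= in_itv.
rewrite -/S -qS; move: le1; rewrite -{1}qS => le1.
have [q1|q1] := eqVneq q 0; first by rewrite q1 expr0n /= sqr_ge0.
have {}q0 : 0 < q by rewrite lt_neqAle eq_sym q1.
have : q <= (d - c) * e by rewrite -(ler_pM2l q0) -expr2.
by move=> qe; rewrite ler_sqr ?nnegrE ?mulr_ge0 ?subr_ge0// ltW.
Qed.

Section continuous_path.
Variables (a b M : R) (phi : R -> multi_index -> R).
Hypothesis ab : a < b.
Hypothesis M0 : 0 <= M.
Hypothesis phiM : forall t, t \in `[a, b] -> bnd p (phi t) M.
Hypothesis phiC : forall t e, t \in `[a, b] -> 0 < e -> exists2 d : R, 0 < d &
  forall u, u \in `[a, b] -> `|u - t| < d -> bnd p (phi u - phi t) e.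

(** Heine's theorem, through the Lebesgue number. *)
Lemma bnd_path_uniform e : 0 < e -> exists2 d : R, 0 < d &
  forall u v, u \in `[a, b] -> v \in `[a, b] -> `|u - v| < d -> bnd p (phi u - phi v) e.
Proof.
move=> e0; have e2 : 0 < e / 2 by rewrite divr_gt0.
have /choice[d dP] (t : R) : exists d : R, t \in `[a, b] -> 0 < d /\
    forall u, u \in `[a, b] -> `|u - t| < d -> bnd p (phi u - phi t) (e / 2).
  have [tab|_] := boolP (t \in `[a, b]); last by exists 0.
  by have [d d0 dP] := phiC tab e2; exists d.
have [s [r [r0 sab sP]]] := segment_lebesgue_number (fun t tab => (dP t tab).1).
exists r => // u v uab vab uv; have [t /sab tab tP] := sP v vab.
have [_ tC] := dP t tab.
have hu := tC u uab (tP u uv).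
have hv := tC v vab (tP v _).
rewrite [e]splitr (_ : phi u - phi v = (phi u - phi t) - (phi v - phi t)); last first.
  by rewrite opprB addrA subrK.
apply: bndD; [exact: ltW|exact: ltW|exact: hu|apply: bndN; apply: hv].
by rewrite subrr normr0.
Qed.

Lemma coord_integrable ga : mu.-integrable `[a, b] (EFin \o (phi ^~ ga)).
Proof.
apply: continuous_compact_integrable; first exact: segment_compact.
apply/subspace_continuousP => t tab; apply/cvgrPdist_lt => e e0.
have W0 := @wt_gt0 R p ga.
pose e' := e / 2 * Num.sqrt ((m2N ga)%:R ^- p).
have e'0 : 0 < e' by rewrite mulr_gt0 ?divr_gt0// sqrtr_gt0.
have [d d0 dP] := phiC tab e'0.
rewrite near_withinE; apply/nbhs_ballP; exists d => //= u tu uab.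
have ut : `|u - t| < d by rewrite distrC.
have := bnd_coord ga (dP u uab ut).
rewrite /e' exprMn sqr_sqrtr; last exact: ltW.
have e2 : 0 <= e / 2 by rewrite divr_ge0// ltW.
rewrite ler_pM2r// -real_normK ?num_real// ler_sqr ?nnegrE//.
rewrite distrC => h; apply: le_lt_trans h _.
by rewrite ltr_pdivrMr// ltr_pMr// ltr1n.
Qed.

Definition path_integral : multi_index -> R := fun ga => \int[mu]_(t in `[a, b]) phi t ga.

Lemma bnd_path_integral : bnd p path_integral ((b - a) * M).
Proof.
apply: (bnd_Rintegral (ltW ab) M0) => [ga|]; first exact: coord_integrable.
by move=> t tab; apply: phiM; rewrite in_itv.
Qed.

(** On each subinterval the error is the integral of [phi (xi k) - phi t], of norm at
    most [e]. *)
Lemma riemann_sum_bnd d e s (xi : nat -> R) : 0 <= e ->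
  (forall u v, u \in `[a, b] -> v \in `[a, b] -> `|u - v| < d -> bnd p (phi u - phi v) e) ->
  itv_partition a b s -> mesh a s < d ->
  (forall k, (k < size s)%N -> pt a s k <= xi k <= pt a s k.+1) ->
  bnd p (\sum_(k < size s) (pt a s k.+1 - pt a s k) *: phi (xi k) - path_integral)
    ((b - a) * e).
Proof.
move=> e0 unif abs ms xiP.
have inab k t : (k < size s)%N -> pt a s k <= t <= pt a s k.+1 -> t \in `[a, b].
  move=> ks /andP[kt tk]; rewrite in_itv /=.
  have /andP[h1 _] := pt_in abs (ltnW ks); have /andP[_ h2] := pt_in abs ks.
  by rewrite (le_trans h1)// (le_trans tk).
have le_pt k : (k < size s)%N -> pt a s k <= pt a s k.+1.
  by move=> ks; rewrite ltW// (pt_lt abs).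
have sub_i k ga : (k < size s)%N ->
    mu.-integrable `[pt a s k, pt a s k.+1] (EFin \o (phi ^~ ga)).
  move=> ks; apply: (integrable_subitv _ _ (coord_integrable ga)).
    by have /andP[] := pt_in abs (ltnW ks).
  by have /andP[] := pt_in abs ks.
have cst_i k (r : R) : mu.-integrable `[pt a s k, pt a s k.+1] (EFin \o cst r).
  exact: continuous_itv_integrable (@cst_continuous _ _ _).
pose D k : multi_index -> R := fun ga =>
  \int[mu]_(t in `[pt a s k, pt a s k.+1]) (phi (xi k) ga - phi t ga).
have -> : \sum_(k < size s) (pt a s k.+1 - pt a s k) *: phi (xi k) - path_integral =
    \sum_(k < size s) D k.
  apply/funext => ga; rewrite !fctE fct_sumE fct_sumE /path_integral.
  rewrite (Rintegral_partition (coord_integrable ga) abs) -sumrB.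
  apply: eq_bigr => k _; rewrite /D RintegralB//; [|exact: cst_i|exact: sub_i].
  by congr (_ - _); rewrite Rintegral_itv_cst ?le_pt// mulrC.
rewrite -(sum_pt abs) mulr_suml.
apply: (bnd_sum (M := fun k => (pt a s k.+1 - pt a s k) * e)) => k ks.
  by rewrite mulr_ge0// subr_ge0 le_pt.
apply: (bnd_Rintegral (psi := fun t ga => phi (xi k) ga - phi t ga)) => //.
- exact: le_pt.
- by move=> ga; exact: (@integrableB _ _ R mu _ (measurable_itv _) _ _ (cst_i k _) (sub_i k ga ks)).
- move=> t tk; apply: unif; [exact: inab (xiP k ks)|exact: inab tk|].
  have /andP[x1 x2] := xiP k ks; have /andP[t1 t2] := tk.
  apply: le_lt_trans (le_lt_trans (le_mesh a ks) ms).
  by rewrite ler_norml; apply/andP; split; lra.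
Qed.

Lemma is_RInt_path : is_RInt p a b phi path_integral.
Proof.
split.
  apply/in_H'P; exists ((b - a) * M + 1); last first.
    apply: bnd_le bnd_path_integral; last by rewrite lerDl.
    by rewrite mulr_ge0// subr_ge0 ltW.
  by rewrite ltr_wpDl// mulr_ge0// subr_ge0 ltW.
move=> e e0.
have e'0 : 0 < e / 2 / (b - a) by rewrite !divr_gt0// subr_gt0.
have [d d0 dP] := bnd_path_uniform e'0; exists d => // s xi abs ms xiP.
apply: H'norm_lt => //.
have := riemann_sum_bnd (ltW e'0) dP abs ms xiP.
by rewrite mulrC divfK// gt_eqF// subr_gt0.
Qed.

End continuous_path.

End riemann_integral.

(** * Wick products with the noise *)

Section wick_white_noise.
Context (R : realType).
Local Notation mu := (@lebesgue_measure R).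
Implicit Types (G : multi_index -> R).

(** For [r >= 3] the terms are at most [1 / (8 (k + 1)^2)], which is dominated by the
    telescoping [1 / (k + 1) - 1 / (k + 2)]. *)
Lemma sum_weight_le1 r n : (2 < r)%N ->
  \sum_(k < n) k.+1%:R * (2 * k.+1)%:R ^- r <= 1 :> R.
Proof.
move=> r3.
suff h : \sum_(k < n) k.+1%:R * (2 * k.+1)%:R ^- r <= 1 - n.+1%:R^-1 :> R.
  by apply: le_trans h _; rewrite lerBlDr lerDl invr_ge0.
elim: n => [|n IH]; first by rewrite big_ord0 invr1 subrr.
rewrite big_ord_recr /=; apply: le_trans (lerD IH (_ : _ <= n.+1%:R^-1 - n.+2%:R^-1)) _; last first.
  by rewrite addrA subrK.
have x0 : 0 < n.+1%:R :> R by rewrite ltr0n.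
apply: (@le_trans _ _ (n.+1%:R * (2 * n.+1)%:R ^- 3)).
  rewrite ler_pM2l// lef_pV2 ?posrE ?exprn_gt0 ?ltr0n//.
  by rewrite ler_weXn2l// ler1n.
rewrite natrM -[n.+2]addn1 natrD.
move: (n.+1%:R : R) x0 (ler1n R n.+1) => x x0; rewrite /= => x1.
have -> : x^-1 - (x + 1)^-1 = (x * (x + 1))^-1 by field; rewrite !gt_eqF// addr_gt0.
have -> : x * (2 * x) ^- 3 = (8 * x ^+ 2)^-1 by field; rewrite gt_eqF.
rewrite lef_pV2 ?posrE ?mulr_gt0 ?exprn_gt0 ?addr_gt0//.
have : 1 <= x by rewrite x1.
by rewrite expr2 mulrCA ler_pM2l//; lra.
Qed.

Lemma bnd_wick_linear r G (v : nat -> R) M C : (2 < r)%N -> 0 <= M -> 0 <= C ->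
  bnd (2 * r) G M -> (forall k, `|v k| <= C * k.+1%:R) ->
  bnd (2 * r) (wick G (fchaos v)) (C * M).
Proof.
move=> r3 M0 C0 GM vC; apply: bnd_wick => // n.
rewrite -[leRHS]mulr1; apply: le_trans (ler_wpM2l C0 (sum_weight_le1 n r3)).
by rewrite mulr_sumr; apply: ler_sum => k _; rewrite mulrA ler_wpM2r.
Qed.

Variable m : R -> R.
Hypothesis am : admissible m.
Let w t k := Tm_schwartz m (hermite_schwartz R k) t.
Let B := Tm_bound m.

Let B0 : 0 <= B. Proof. exact: Tm_bound_ge0. Qed.

Lemma bnd_wick_Wm r G M t : (2 < r)%N -> 0 <= M -> bnd (2 * r) G M ->
  bnd (2 * r) (wick G (Wm m t)) (B * M).
Proof.
move=> r3 M0 GM; apply: (bnd_wick_linear (v := w t)) => // k.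
exact: Tm_hermite_bounded.
Qed.

Lemma bnd_wick_WmB r G F M e s t : (2 < r)%N -> 0 <= M -> 0 <= e ->
  bnd (2 * r) F M -> bnd (2 * r) (G - F) e ->
  bnd (2 * r) (wick G (Wm m t) - wick F (Wm m s)) (B * e + B * `|t - s| * M).
Proof.
move=> r3 M0 e0 FM GFe.
have -> : wick G (Wm m t) - wick F (Wm m s) =
    wick (G - F) (Wm m t) + wick F (fchaos (w t - w s)).
  by rewrite wickB_fchaos -wick_fchaosB addrA subrK.
apply: bndD; [exact: mulr_ge0|by rewrite mulr_ge0// mulr_ge0|exact: bnd_wick_Wm|].
apply: bnd_wick_linear => //; first by rewrite mulr_ge0.
by move=> k; rewrite mulrAC; exact: Tm_hermite_lipschitz.
Qed.

(** The coefficient [int_s^t w_k] differs from [(t - s) w_k(s)] by at most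
    [B (k + 1) (t - s)^2], by the Lipschitz bound. *)
Lemma bnd_wick_increment r G M s t : (2 < r)%N -> 0 <= M -> s <= t ->
  bnd (2 * r) G M ->
  bnd (2 * r) (wick G (fchaos (fun k => \int[mu]_(x in `[s, t]) w x k)) -
    (t - s) *: wick G (Wm m s)) ((t - s) * (B * (t - s) * M)).
Proof.
move=> r3 M0 st GM; have ts0 : 0 <= t - s by rewrite subr_ge0.
rewrite -wick_fchaosZ wick_fchaosB mulrA.
apply: bnd_wick_linear => //; first by rewrite mulr_ge0// mulr_ge0.
move=> k.
have wi : mu.-integrable `[s, t] (EFin \o (fun x => w x k)).
  by apply: continuous_itv_integrable; exact: Tm_hermite_continuous.
have ci (c : R) : mu.-integrable `[s, t] (EFin \o cst c).
  exact: continuous_itv_integrable (@cst_continuous _ _ _).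
have wB : mu.-integrable `[s, t] (EFin \o (fun x => w x k - w s k)).
  exact: (@integrableB _ _ R mu _ (measurable_itv _) _ _ wi (ci _)).
rewrite (_ : _ k = \int[mu]_(x in `[s, t]) (w x k - w s k)); last first.
  rewrite RintegralB//; last exact: ci.
  rewrite [in RHS](Rintegral_itv_cst (w s k) st).
  by congr (_ - _); exact: mulrC.
apply: (@le_trans _ _ (\int[mu]_(x in `[s, t]) `|w x k - w s k|)).
  exact: le_normr_Rintegral.
rewrite (_ : _ * k.+1%:R = \int[mu]_(x in `[s, t]) (B * k.+1%:R * (t - s))); last first.
  by rewrite Rintegral_itv_cst//; ring.
apply: le_Rintegral => //; [exact: integrable_norm wB|exact: ci|].
move=> x; rewrite /= in_itv /= => /andP[sx xt].
apply: le_trans (Tm_hermite_lipschitz am k x s) _.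
have Bk : 0 <= B * k.+1%:R by rewrite mulr_ge0.
apply: (ler_wpM2l Bk); rewrite ger0_norm ?subr_ge0//.
exact: lerB.
Qed.

End wick_white_noise.

Theorem theorem5p1 (R : realType) (m : R -> R)
  (P : probability (white_noise_space R) R)
  (X : R -> white_noise_space R -> R) (a b : R) (Y : R -> Sm1 R) :
  admissible m -> is_white_noise P -> is_Xm P m X -> a < b ->
  {within `[a, b], continuous Y} ->
  exists2 p : nat, (0 < p)%N &
    [/\ forall t, t \in `[a, b] -> in_H' p (wick (Y t) (Wm m t)),
        H'_continuous p a b (fun t => wick (Y t) (Wm m t)) &
        exists2 I, is_RInt p a b (fun t => wick (Y t) (Wm m t)) I &
          mesh_lim p a b (fun s => \sum_(k < size s)
            wick (Y (pt a s k))
                 (chaos_coef P (X (pt a s k.+1) \- X (pt a s k)))) I].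
Proof.
move=> am wnP XP ab cY.
have [k [M [k0 M0 YM]]] := strong_bounded cY.
(* [r >= 3] makes the noise a bounded multiplier, and [2 r >= k + 1] makes
   [Y] norm continuous into [H'_(2r)]. *)
pose r := k.+3; have r3 : (2 < r)%N by [].
have B0 := Tm_bound_ge0 am; set B := Tm_bound m in B0.
have YMr t : t \in `[a, b] -> bnd (2 * r) (Y t) M.
  move=> tab; apply: bnd_mono (YM t tab).
  by rewrite (leq_trans (leq_addr 3 k))// addn3 leq_pmull.
pose phi t := wick (Y t) (Wm m t).
have phiM t : t \in `[a, b] -> bnd (2 * r) (phi t) (B * M).
  by move=> tab; apply: bnd_wick_Wm => //; [exact: ltW|exact: YMr].
have BM0 : 0 <= B * M by rewrite mulr_ge0// ltW.
have phiC t e : t \in `[a, b] -> 0 < e -> exists2 d : R, 0 < d &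
    forall u, u \in `[a, b] -> `|u - t| < d -> bnd (2 * r) (phi u - phi t) e.
  move=> tab e0.
  have e10 : 0 < e / 2 / (B + 1) by rewrite !divr_gt0// ltr_wpDl.
  have [d1 d10 d1P] := strong_norm_continuous cY M0 YM tab e10.
  have d20 : 0 < e / 2 / (B * M + 1) by rewrite !divr_gt0// ltr_wpDl.
  exists (Num.min d1 (e / 2 / (B * M + 1))); first by rewrite lt_min d10.
  move=> u uab; rewrite lt_min => /andP[ud1 ud2].
  have YB : bnd (2 * r) ((Y u : multi_index -> R) - (Y t : multi_index -> R)) (e / 2 / (B + 1)).
    apply: bnd_mono (d1P u uab ud1).
    by rewrite (leq_trans (leq_addr 2 k.+1))// addn2 leq_pmull.
  have := bnd_wick_WmB am t u r3 (ltW M0) (ltW e10) (YMr t tab) YB.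
  have ? := ltW M0; have ? := ltW e10.
  apply: bnd_le; first by rewrite addr_ge0// mulr_ge0// mulr_ge0.
  rewrite [leRHS]splitr lerD//.
    rewrite mulrA ler_pdivrMr ?ltr_wpDl// mulrC ler_wpM2l// ?divr_ge0 ?ltW//.
    by rewrite ltrDl.
  rewrite -/B mulrAC; apply: le_trans (ler_wpM2l BM0 (ltW ud2)) _.
  rewrite mulrA ler_pdivrMr ?ltr_wpDl// mulrC ler_wpM2l// ?divr_ge0 ?ltW//.
  by rewrite ltrDl.
exists (2 * r)%N => //; split => [t tab|t tab e e0|].
- apply/in_H'P; exists (B * M + 1); first by rewrite ltr_wpDl.
  by apply: bnd_le (phiM t tab); rewrite ?lerDl.
- have e2 : 0 < e / 2 by rewrite divr_gt0.
  have [d d0 dP] := phiC t (e / 2) tab e2.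
  by exists d => // u uab ud; apply: H'norm_lt => //; exact: dP.
have RI := is_RInt_path ab BM0 phiM phiC.
exists (path_integral a b phi) => //.
move=> e e0.
pose D := b - a; have D0 : 0 < D by rewrite subr_gt0.
have e'0 : 0 < e / 4 / D by rewrite !divr_gt0.
have [d1 d10 d1P] := bnd_path_uniform phiC e'0.
have K0 : 0 < D * (B * M) + 1 by rewrite ltr_wpDl// mulr_ge0// ltW.
have d20 : 0 < e / 4 / (D * (B * M) + 1) by rewrite !divr_gt0.
(* [d1] controls the Riemann sum; the second bound makes the linearization
   error [D B M mesh] at most [e / 4]. *)
exists (Num.min d1 (e / 4 / (D * (B * M) + 1))); first by rewrite lt_min d10.
move=> s abs; rewrite lt_min => /andP[sd1 sd2]; apply: H'norm_lt => //.
have le_pt j : (j < size s)%N -> pt a s j <= pt a s j.+1.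
  by move=> js; rewrite ltW// (pt_lt abs).
have pt_ab j : (j <= size s)%N -> pt a s j \in `[a, b].
  by move=> js; rewrite in_itv /= (pt_in abs).
(* The error made in replacing one increment by its linear part. *)
pose E j := wick (Y (pt a s j)) (chaos_coef P (X (pt a s j.+1) \- X (pt a s j))) -
  (pt a s j.+1 - pt a s j) *: phi (pt a s j).
rewrite (_ : _ - _ = \sum_(j < size s) E j +
   (\sum_(j < size s) (pt a s j.+1 - pt a s j) *: phi (pt a s j) - path_integral a b phi)); last first.
  by rewrite addrA -big_split; congr (_ - _); apply: eq_bigr => j _; rewrite /= subrK.
have RS : bnd (2 * r) (\sum_(j < size s) (pt a s j.+1 - pt a s j) *: phi (pt a s j) -
    path_integral a b phi) (D * (e / 4 / D)).
  apply: (riemann_sum_bnd phiC (ltW e'0) d1P abs sd1) => j js.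
  by rewrite lexx le_pt.
have ES : bnd (2 * r) (\sum_(j < size s) E j) (D * (B * mesh a s * M)).
  have mesh0 j : (j < size s)%N -> 0 <= mesh a s.
    by move=> js; apply: le_trans (le_mesh a js); rewrite subr_ge0 le_pt.
  rewrite /D -(sum_pt abs) mulr_suml.
  apply: (bnd_sum (M := fun j => (pt a s j.+1 - pt a s j) * (B * mesh a s * M))) => j js.
    have ? := ltW M0; rewrite mulr_ge0 ?subr_ge0 ?le_pt// mulr_ge0// mulr_ge0//.
    exact: mesh0 js.
  rewrite /E (chaos_coef_increment wnP am XP (le_pt j js)).
  have := bnd_wick_increment am r3 (ltW M0) (le_pt j js) (YMr _ (pt_ab j (ltnW js))).
  have ? := ltW M0.
  apply: bnd_le; first by rewrite mulr_ge0 ?subr_ge0 ?le_pt// mulr_ge0// mulr_ge0// subr_ge0 le_pt.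
  rewrite ler_wpM2l ?subr_ge0 ?le_pt// ler_wpM2r// ler_wpM2l//.
  exact: le_mesh.
have s0 : (0 < size s)%N.
  by case: (s) abs => // /itv_partition_nil abE; move: ab; rewrite abE ltxx.
have mesh0 : 0 <= mesh a s.
  by apply: le_trans (le_mesh a s0); rewrite subr_ge0 le_pt.
have c1 : 0 <= D * (B * mesh a s * M).
  by rewrite mulr_ge0 ?(ltW D0)// mulr_ge0 ?(ltW M0)// mulr_ge0.
have c2 : 0 <= D * (e / 4 / D) by rewrite mulr_ge0 ?(ltW D0) ?(ltW e'0).
apply: bnd_le (bndD c1 c2 ES RS); first exact: addr_ge0.
have -> : e / 2 = e / 4 + e / 4 by field.
rewrite [D * (e / 4 / D)]mulrC divfK ?gt_eqF// lerD//.
rewrite mulrAC mulrA; apply: le_trans (ler_wpM2l _ (ltW sd2)) _.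
  by rewrite mulr_ge0// ltW.
rewrite [leLHS]mulrA ler_pdivrMr// mulrC ler_wpM2l ?divr_ge0 ?ltW//.
by rewrite ltrDl.
Qed.
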